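(* Let $G$ be either $SE(n)$ or $SA(n)$. Suppose $g\in C(\mathbb{R}^n,\mathbb{R})$ (with compact support) and $f\in C^3(\mathbb{R}^n,\mathbb{R})$, and let $x_1,\dots,x_N\in\mathbb{R}^n$ be given sampling points. Consider the QMC-Newton registration algorithm on $G$ described in the context, applied to either of the following two cost functions on $G$: (a) $\Phi:G\to\mathbb{R}$, $\Phi(A,t)=\int_{\mathbb{R}^n}f(Ax+t)g(x)\,dx$, with the coefficients $\alpha,\beta,\gamma,\delta,\epsilon$ of the algorithm computed with $E[h]=\int_{\mathbb{R}^n}g(x)h(x)\,dx$; (b) $\Psi:G\to\mathbb{R}$, $\Psi(A,t)=\frac1N\sum_{r=1}^N f(Ax_r+t)g(x_r)$, with the coefficients computed with $E[h]=\frac1N\sum_{r=1}^N g(x_r)h(x_r)$. Then in both cases the algorithm is locally quadratically convergent around each nondegenerate critical point $M^*\in G$ of the respective cost function: there is an open neighbourhood $V\subset G$ of $M^*$ such that for every initial point $M_0\in V$ the sequence $(M_m)$ generated by the algorithm converges quadratically to $M^*$.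
   Context: **Groups.** $SA(n)$ is the Lie group of real $(n+1)\times(n+1)$ matrices $M=\begin{pmatrix}A&t\\0&1\end{pmatrix}$ with $A\in SL(n)$, $t\in\mathbb{R}^n$; $SE(n)$ is the subgroup with $A\in SO(n)$. We write $M=(A,t)$. $so(n)$ denotes the skew-symmetric and $sl(n)$ the trace-zero real $n\times n$ matrices. A critical point of a function on $G$ is nondegenerate if the Hessian there (in local coordinates) is invertible. **Local parameterizations used for the update.** For an invertible matrix $B$, $B_Q$ is the orthogonal factor of its QR decomposition ($R$ with positive diagonal). For $G=SE(n)$, $\Omega\in so(n)$, $v\in\mathbb{R}^n$: $$\nu_M^{QR}(\Omega,v)=M\begin{pmatrix}(I+\Omega)_Q&(I+\frac12\Omega)v\\0&1\end{pmatrix}.$$ For $G=SA(n)$, $\Omega\in sl(n)$, $v\in\mathbb{R}^n$: $$\nu_M^{QR}(\Omega,v)=M\begin{pmatrix}\theta(\Omega)&(I+\frac12\Omega)v\\0&1\end{pmatrix},\qquad \theta(X)=(I+X_l-X_l^\top)_Q\,[\exp(X_d)+X_u+X_l^\top],$$ where $X=X_l+X_d+X_u$ is the decomposition into strictly lower triangular, diagonal and strictly upper triangular parts. **Algorithm.** Step 1: pick $M_0\in G$, set $m=0$. Step 2: for $M_m=(A,t)$ and $z=z(x)=Ax+t$ compute, for all $1\le i,j,k,l\le n$, with $E$ as in the claim, $$\alpha_i=E\Big[\tfrac{\partial f}{\partial x_i}(z)\Big],\quad \beta_{i,j}=E\Big[z_j\tfrac{\partial f}{\partial x_i}(z)\Big],\quad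 \gamma_{i,j,k}=E\Big[z_i\tfrac{\partial^2 f}{\partial x_j\partial x_k}(z)\Big],$$ $$\delta_{i,j,k,l}=E\Big[z_iz_j\tfrac{\partial^2 f}{\partial x_k\partial x_l}(z)\Big],\quad \epsilon_{i,j}=E\Big[\tfrac{\partial^2 f}{\partial x_i\partial x_j}(z)\Big].$$ Step 3: solve the linear system below for $(\Omega,v)$. Step 4: set $M_{m+1}=\nu^{QR}_{M_m}(\Omega,v)$. Step 5: increase $m$ by one and go to Step 2. All summation indices run over $1,\dots,n$ subject to the indicated restrictions. *System for $G=SE(n)$* (unknowns $v_k$ and $\Omega_{k,l}$, $k>l$; $\Omega$ is completed to a skew-symmetric matrix): $$\sum_{k>l}(\gamma_{l,k,i}-\gamma_{k,l,i})\Omega_{k,l}+\sum_k\epsilon_{i,k}v_k=-\alpha_i\qquad(1\le i\le n),$$ and for $1\le i<j\le n$ $$\tfrac12\sum_{k>j}(\beta_{i,k}+\beta_{k,i})\Omega_{k,j}-\tfrac12\sum_{k<j}(\beta_{i,k}+\beta_{k,i})\Omega_{j,k}-\tfrac12\sum_{k>i}(\beta_{j,k}+\beta_{k,j})\Omega_{k,i}+\tfrac12\sum_{k<i}(\beta_{j,k}+\beta_{k,j})\Omega_{i,k}$$ $$-\sum_{k>l}(\delta_{i,k,l,j}-\delta_{j,l,k,i}+\delta_{i,l,k,j}-\delta_{i,k,l,j})\Omega_{k,l}-\sum_k(\gamma_{j,k,i}-\gamma_{i,k,j})v_k=\beta_{i,j}-\beta_{j,i}.$$ *System for $G=SA(n)$*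 (unknowns $v_k$ and $\Omega_{k,l}$, $(k,l)\ne(n,n)$; then $\Omega_{n,n}=-\sum_{k\ne n}\Omega_{k,k}$): for $1\le i\le n$ $$\sum_{k\ne l}\gamma_{l,k,i}\Omega_{k,l}+\sum_{k\ne n}(\gamma_{k,k,i}-\gamma_{n,n,i})\Omega_{k,k}+\sum_k\epsilon_{i,k}v_k=-\alpha_i;$$ for $i\ne n$, $j\ne n$, $i\ne j$ $$\tfrac12\sum_k\beta_{i,k}\Omega_{j,k}+\tfrac12\sum_k\beta_{k,j}\Omega_{k,i}+\sum_{(k,l)\ne(n,n)}\delta_{j,l,k,i}\Omega_{k,l}-\delta_{j,n,n,i}\sum_{k\ne n}\Omega_{k,k}+\sum_k\gamma_{j,k,i}v_k=-\beta_{i,j};$$ for $i=n$, $j\ne n$ $$\tfrac12\sum_k\beta_{n,k}\Omega_{j,k}+\tfrac12\sum_{k\ne n}\beta_{k,j}\Omega_{k,n}+\sum_{(k,l)\ne(n,n)}\delta_{j,l,k,n}\Omega_{k,l}-\big(\delta_{j,n,n,n}+\tfrac12\beta_{n,j}\big)\sum_{k\ne n}\Omega_{k,k}+\sum_k\gamma_{j,k,n}v_k=-\beta_{n,j};$$ for $j=n$, $i\ne n$ $$\tfrac12\sum_{k\ne n}\beta_{i,k}\Omega_{n,k}+\tfrac12\sum_k\beta_{k,n}\Omega_{k,i}+\sum_{(k,l)\ne(n,n)}\delta_{n,l,k,i}\Omega_{k,l}-\big(\delta_{n,n,n,i}+\tfrac12\beta_{i,n}\big)\sum_{k\ne n}\Omega_{k,k}+\sum_k\gamma_{n,k,i}v_k=-\beta_{i,n};$$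 and for $i=j\ne n$ $$\tfrac12\sum_k\beta_{i,k}\Omega_{j,k}+\tfrac12\sum_k\beta_{k,j}\Omega_{k,i}+\sum_{(k,l)\ne(n,n)}\Big(\delta_{j,l,k,i}-\tfrac1n\big(\beta_{k,l}+\sum_m\delta_{l,m,k,m}\big)\Big)\Omega_{k,l}$$ $$-\Big(\delta_{j,n,n,i}-\tfrac1n\big(\beta_{n,n}+\sum_m\delta_{n,m,n,m}\big)\Big)\sum_{k\ne n}\Omega_{k,k}+\sum_k\Big(\gamma_{j,k,i}-\tfrac1n\sum_l\gamma_{l,l,k}\Big)v_k=-\beta_{i,j}+\tfrac1n\sum_k\beta_{k,k}.$$
   Formalization: Two printed formulas are corrected, as the claim fails with them: the update multiplies M by the increment from the left, not the right; and in the SE(n) system the δ-term is +(δ_{j,k,l,i}−δ_{j,l,k,i}+δ_{i,l,k,j}−δ_{i,k,l,j}). *)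

(* Defs.v *)
From HB Require Import structures.
From mathcomp Require Import all_boot all_order all_algebra.
From mathcomp Require Import all_classical all_reals all_analysis.
Import Order.TTheory GRing.Theory Num.Theory.
Import numFieldNormedType.Exports.

Set Implicit Arguments.
Unset Strict Implicit.
Unset Printing Implicit Defensive.

Local Open Scope classical_set_scope.
Local Open Scope ring_scope.

Section Calculus.
Variable R : realType.

Definition partial (n : nat) (i : 'I_n) (f : 'cV[R]_n -> R) : 'cV[R]_n -> R :=
  fun x => 'D_(delta_mx i 0) f x.

(* [U] is meant to be open. *)
Fixpoint is_Ck (k n : nat) (U : set 'cV[R]_n) (f : 'cV[R]_n -> R) : Prop :=
  (forall x, U x -> {for x, continuous f}) /\
  match k with
  | 0%N => True
  | k'.+1 => forall i : 'I_n,
      (forall x, U x -> derivable f x (delta_mx i 0)) /\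
      is_Ck k' U (partial i f)
  end.

Definition gradient (n : nat) (f : 'cV[R]_n -> R) (x : 'cV[R]_n) : 'cV[R]_n :=
  \col_i partial i f x.

Definition hessian (n : nat) (f : 'cV[R]_n -> R) (x : 'cV[R]_n) : 'M[R]_n :=
  \matrix_(i, j) partial i (partial j f) x.

Definition compactly_supported (n : nat) (g : 'cV[R]_n -> R) : Prop :=
  compact (closure [set x | g x != 0]).

(* The integral over R^n, as n nested one-dimensional Lebesgue integrals; by
   Fubini it is the n-dimensional Lebesgue integral for the continuous compactly
   supported integrands to which it is applied below. *)
Fixpoint integral_Rn (n : nat) : ('cV[R]_n -> R) -> R :=
  match n with
  | 0%N => fun h => h 0
  | n'.+1 => fun h =>
      \int[lebesgue_measure]_(s in [set: R])
        integral_Rn (fun y : 'cV[R]_n' => h (col_mx (s%:M : 'cV[R]_1) y))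
  end.

End Calculus.

Section Groups.
Variables (R : realType) (n : nat).

(* The pair (A, t), as a matrix of size n + 1. *)
Definition motion (A : 'M[R]_n) (t : 'cV[R]_n) : 'M[R]_(n + 1) :=
  block_mx A t 0 1%:M.

Definition linear_part (M : 'M[R]_(n + 1)) : 'M[R]_n := ulsubmx M.
Definition translation_part (M : 'M[R]_(n + 1)) : 'cV[R]_n := ursubmx M.

Definition act (M : 'M[R]_(n + 1)) (x : 'cV[R]_n) : 'cV[R]_n :=
  linear_part M *m x + translation_part M.

End Groups.

Inductive motion_group := SE | SA.

Section LieGroups.
Variables (R : realType) (n : nat).

Definition carrier (G : motion_group) : set 'M[R]_(n + 1) :=
  match G with
  | SE => [set M | exists A t,
                   [/\ A^T *m A = 1%:M, \det A = 1 & M = motion A t]]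
  | SA => [set M | exists A t, \det A = 1 /\ M = motion A t]
  end.

(* The linear part of the Lie algebra: so(n), respectively sl(n). *)
Definition lie_algebra (G : motion_group) : set 'M[R]_n :=
  match G with
  | SE => [set X | X^T = - X]
  | SA => [set X | \tr X = 0]
  end.

Definition open_in (G : motion_group) (V : set 'M[R]_(n + 1)) : Prop :=
  exists2 W : set 'M[R]_(n + 1), open W & V = carrier G `&` W.

(* [phi] restricted to [U] is the inverse of a chart of G around M: a smooth
   immersion of U into the matrices which is a homeomorphism onto an open subset
   of G, with phi 0 = M. *)
Definition local_coordinates (G : motion_group) (M : 'M[R]_(n + 1)) (d : nat)
    (phi : 'cV[R]_d -> 'M[R]_(n + 1)) : Prop :=
  exists U : set 'cV[R]_d,
    [/\ open U, U 0, phi 0 = M &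
     [/\ forall k i j, is_Ck k U (fun u => phi u i j),
         forall u w, U u -> 'D_w phi u = 0 -> w = 0,
         open_in G (phi @` U) &
         exists psi : 'M[R]_(n + 1) -> 'cV[R]_d,
           {in U, cancel phi psi} /\ {within phi @` U, continuous psi}]].

Definition nondegenerate_critical_point (G : motion_group)
    (F : 'M[R]_(n + 1) -> R) (M : 'M[R]_(n + 1)) : Prop :=
  exists d (phi : 'cV[R]_d -> 'M[R]_(n + 1)),
    [/\ local_coordinates G M phi,
        gradient (F \o phi) 0 = 0 &
        hessian (F \o phi) 0 \in unitmx].

End LieGroups.

Section Parameterization.
Variables (R : realType) (n : nat).

Definition is_QR (B Q T : 'M[R]_n) : Prop :=
  [/\ B = Q *m T, Q^T *m Q = 1%:M,
      forall i j : 'I_n, (j < i)%N -> T i j = 0 &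
      forall i, 0 < T i i].

(* For invertible B there is exactly one such Q; 1 is a junk value. *)
Definition QR_orth (B : 'M[R]_n) : 'M[R]_n :=
  xget 1%:M [set Q | exists T, is_QR B Q T].

Definition strict_lower (X : 'M[R]_n) : 'M[R]_n :=
  \matrix_(i, j) (if (j < i)%N then X i j else 0).
Definition strict_upper (X : 'M[R]_n) : 'M[R]_n :=
  \matrix_(i, j) (if (i < j)%N then X i j else 0).

(* The matrix exponential of the diagonal part of X. *)
Definition exp_diag (X : 'M[R]_n) : 'M[R]_n :=
  diag_mx (\row_i expR (X i i)).

Definition theta (X : 'M[R]_n) : 'M[R]_n :=
  QR_orth (1%:M + strict_lower X - (strict_lower X)^T)
    *m (exp_diag X + strict_upper X + (strict_lower X)^T).

Definition local_motion (G : motion_group) (Omega : 'M[R]_n) (v : 'cV[R]_n) :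
    'M[R]_(n + 1) :=
  motion (match G with
          | SE => QR_orth (1%:M + Omega)
          | SA => theta Omega
          end)
         ((1%:M + 2^-1 *: Omega) *m v).

(* The increment multiplies M from the left, i.e. it acts on z = A x + t: the
   coefficients below are taken with respect to z, so that the Newton systems
   are those of (Omega, v) |-> F (local_motion G Omega v *m M). The printed order
   M *m local_motion G Omega v does not fit these systems, and the iteration
   then fails to converge quadratically unless M commutes with the increments. *)
Definition nu_QR (G : motion_group) (M : 'M[R]_(n + 1))
    (Omega : 'M[R]_n) (v : 'cV[R]_n) : 'M[R]_(n + 1) :=
  local_motion G Omega v *m M.

End Parameterization.

Section Coefficients.
Variables (R : realType) (n : nat).
Variables (f : 'cV[R]_n -> R) (E : ('cV[R]_n -> R) -> R) (M : 'M[R]_(n + 1)).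

Definition alpha (i : 'I_n) : R := E (fun x => partial i f (act M x)).

Definition beta (i j : 'I_n) : R :=
  E (fun x => let z := act M x in z j 0 * partial i f z).

Definition gamma (i j k : 'I_n) : R :=
  E (fun x => let z := act M x in z i 0 * partial j (partial k f) z).

Definition delta (i j k l : 'I_n) : R :=
  E (fun x => let z := act M x in
              z i 0 * z j 0 * partial k (partial l f) z).

Definition epsilon (i j : 'I_n) : R :=
  E (fun x => partial i (partial j f) (act M x)).

End Coefficients.

Section Systems.
Variables (R : realType) (n : nat).
Variables (a : 'I_n.+1 -> R) (b : 'I_n.+1 -> 'I_n.+1 -> R)
  (c : 'I_n.+1 -> 'I_n.+1 -> 'I_n.+1 -> R)
  (d : 'I_n.+1 -> 'I_n.+1 -> 'I_n.+1 -> 'I_n.+1 -> R)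
  (e : 'I_n.+1 -> 'I_n.+1 -> R).
Variables (O : 'M[R]_n.+1) (v : 'cV[R]_n.+1).

(* The coefficient of O k l in the double sum of the second equation is
   E[H (z_i e_j - z_j e_i, z_l e_k - z_k e_l)], with H the Hessian of f at z.
   The printed system has - (d i k l j - d j l k i + d i l k j - d i k l j) in its
   place, a misprint: two of the terms cancel and the sign is opposite to that
   of the other terms. *)
Definition SE_system : Prop :=
  (forall i,
    \sum_(k < n.+1) \sum_(l < n.+1 | (l < k)%N) (c l k i - c k l i) * O k l
    + \sum_(k < n.+1) e i k * v k 0 = - a i) /\
  (forall i j : 'I_n.+1, (i < j)%N ->
    2^-1 * (\sum_(k < n.+1 | (j < k)%N) (b i k + b k i) * O k j)
    - 2^-1 * (\sum_(k < n.+1 | (k < j)%N) (b i k + b k i) * O j k)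
    - 2^-1 * (\sum_(k < n.+1 | (i < k)%N) (b j k + b k j) * O k i)
    + 2^-1 * (\sum_(k < n.+1 | (k < i)%N) (b j k + b k j) * O i k)
    + \sum_(k < n.+1) \sum_(l < n.+1 | (l < k)%N)
        (d j k l i - d j l k i + d i l k j - d i k l j) * O k l
    - \sum_(k < n.+1) (c j k i - c i k j) * v k 0
    = b i j - b j i).

(* The index written n in the text, with indices running over 1, ..., n. *)
Let o : 'I_n.+1 := ord_max.

Definition SA_system : Prop :=
  [/\ forall i,
        \sum_(k < n.+1) \sum_(l < n.+1 | k != l) c l k i * O k l
        + \sum_(k < n.+1 | k != o) (c k k i - c o o i) * O k k
        + \sum_(k < n.+1) e i k * v k 0 = - a i,
      forall i j, i != o -> j != o -> i != j ->
        2^-1 * (\sum_(k < n.+1) b i k * O j k)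
        + 2^-1 * (\sum_(k < n.+1) b k j * O k i)
        + \sum_(k < n.+1) \sum_(l < n.+1 | (k, l) != (o, o)) d j l k i * O k l
        - d j o o i * \sum_(k < n.+1 | k != o) O k k
        + \sum_(k < n.+1) c j k i * v k 0
        = - b i j,
      forall j, j != o ->
        2^-1 * (\sum_(k < n.+1) b o k * O j k)
        + 2^-1 * (\sum_(k < n.+1 | k != o) b k j * O k o)
        + \sum_(k < n.+1) \sum_(l < n.+1 | (k, l) != (o, o)) d j l k o * O k l
        - (d j o o o + 2^-1 * b o j) * \sum_(k < n.+1 | k != o) O k k
        + \sum_(k < n.+1) c j k o * v k 0
        = - b o j,
      forall i, i != o ->
        2^-1 * (\sum_(k < n.+1 | k != o) b i k * O o k)
        + 2^-1 * (\sum_(k < n.+1) b k o * O k i)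
        + \sum_(k < n.+1) \sum_(l < n.+1 | (k, l) != (o, o)) d o l k i * O k l
        - (d o o o i + 2^-1 * b i o) * \sum_(k < n.+1 | k != o) O k k
        + \sum_(k < n.+1) c o k i * v k 0
        = - b i o &
      forall i j, i = j -> i != o ->
        2^-1 * (\sum_(k < n.+1) b i k * O j k)
        + 2^-1 * (\sum_(k < n.+1) b k j * O k i)
        + \sum_(k < n.+1) \sum_(l < n.+1 | (k, l) != (o, o))
            (d j l k i - n.+1%:R^-1 * (b k l + \sum_(m < n.+1) d l m k m)) * O k l
        - (d j o o i - n.+1%:R^-1 * (b o o + \sum_(m < n.+1) d o m o m))
            * \sum_(k < n.+1 | k != o) O k k
        + \sum_(k < n.+1) (c j k i - n.+1%:R^-1 * \sum_(l < n.+1) c l l k) * v k 0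
        = - b i j + n.+1%:R^-1 * \sum_(k < n.+1) b k k].

End Systems.

Section Algorithm.
Variables (R : realType) (n : nat) (G : motion_group).
Variables (f : 'cV[R]_n.+1 -> R) (E : ('cV[R]_n.+1 -> R) -> R).

Definition newton_system (M : 'M[R]_(n.+1 + 1)) (O : 'M[R]_n.+1)
    (v : 'cV[R]_n.+1) : Prop :=
  let a := alpha f E M in let b := beta f E M in let c := gamma f E M in
  let d := delta f E M in let e := epsilon f E M in
  lie_algebra G O /\
  match G with
  | SE => SE_system a b c d e O v
  | SA => SA_system a b c d e O v
  end.

Definition generated (M0 : 'M[R]_(n.+1 + 1))
    (Ms : nat -> 'M[R]_(n.+1 + 1)) : Prop :=
  Ms 0%N = M0 /\
  forall m, exists O v, newton_system (Ms m) O v /\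
                        Ms m.+1 = nu_QR G (Ms m) O v.

Definition converges_quadratically (Ms : nat -> 'M[R]_(n.+1 + 1))
    (L : 'M[R]_(n.+1 + 1)) : Prop :=
  Ms @ \oo --> L /\
  exists C : R, forall m, `|Ms m.+1 - L| <= C * `|Ms m - L| ^+ 2.

(* The first conjunct says that the linear systems remain solvable. *)
Definition locally_quadratically_convergent (L : 'M[R]_(n.+1 + 1)) : Prop :=
  exists V : set 'M[R]_(n.+1 + 1),
    [/\ open_in G V, V L &
        forall M0, V M0 ->
          (exists Ms, generated M0 Ms) /\
          (forall Ms, generated M0 Ms -> converges_quadratically Ms L)].

End Algorithm.

Section Costs.
Variables (R : realType) (n : nat) (f g : 'cV[R]_n -> R).

Definition expect_int (h : 'cV[R]_n -> R) : R :=
  integral_Rn (fun x => g x * h x).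

Definition cost_int (M : 'M[R]_(n + 1)) : R :=
  integral_Rn (fun x => f (linear_part M *m x + translation_part M) * g x).

Variables (N : nat) (xs : 'I_N -> 'cV[R]_n).

Definition expect_sample (h : 'cV[R]_n -> R) : R :=
  N%:R^-1 * \sum_r g (xs r) * h (xs r).

Definition cost_sample (M : 'M[R]_(n + 1)) : R :=
  N%:R^-1 *
  \sum_r f (linear_part M *m xs r + translation_part M) * g (xs r).

End Costs.

(* Main.v *)
Require Import Defs.
From HB Require Import structures.
From mathcomp Require Import all_boot all_order all_algebra.
From mathcomp Require Import fingroup perm.
From mathcomp Require Import all_classical all_reals all_analysis.
From mathcomp Require Import ring lra.
Import Order.TTheory GRing.Theory Num.Theory.
Import numFieldNormedType.Exports.
Set Implicit Arguments.
Unset Strict Implicit.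
Unset Printing Implicit Defensive.
Local Open Scope classical_set_scope.
Local Open Scope ring_scope.

(** The Newton system at M is the equation Q_M (w, Y) = - b_M (Y) for all Y in
    the Lie algebra, where b_M (Y) is the derivative of the cost at M in the
    direction Y M, and Q_M is a symmetrized second derivative ([newton_form]).
    Testing against a basis of so(n) or sl(n) and of the translations gives the
    linear systems in the moments alpha, ..., epsilon ([newton_systemP]).

    Let L be a critical point and M = (1 + xi + O(e^2)) L a point of the group
    at distance e, with xi in the Lie algebra. Differentiating b once more and
    using b_L = 0, one finds b_M (Y) = Q_L (xi, Y) + O(e^2 |Y|)
    ([gradient_expansion]): the term b_L (Y xi) that arises may be replaced by
    its symmetrization, because b_L vanishes on commutators. As Q_M = Q_L + O(e)
    and Q_L is nondegenerate, the solution is w = - xi + O(e^2). The update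
    multiplies M by 1 + w + O(e^2), whichever parameterization that agrees with
    the exponential to first order is used ([local_motion_near1]), so that the
    new point is L + O(e^2) ([newton_step]). In a small ball this is also a
    contraction, and the iteration converges ([newton_convergence]).

    First order agreement of the parameterizations rests on the orthogonal QR
    factor of 1 + S being 1 + S + O(S^2) for skew S ([QR_orth_near1]), and the
    decomposition of M on det (1 + Y) = 1 + tr Y + O(Y^2) ([carrier_near1]).

    Nondegeneracy is given in an arbitrary chart phi. Its differential at 0 maps
    into the tangent space ([velocity_tangent]) and onto it ([chart_span]), which
    follows by lifting curves of the group through the chart and spares any
    dimension count. The Hessian of the cost in the chart is then the matrix of
    Q_L in the frame of coordinate directions ([chart_hessian]).

    Both cost functions are E (f o act M) for a functional E that is linear on
    continuous functions and bounded by the supremum over a ball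
    ([expect_int_bounded], [expect_sample_bounded]). Taylor estimates for f that
    are uniform on balls therefore pass through E. *)


(** * The sup norm of matrices and the determinant near the identity *)

Section MatrixNorm.
Variable R : realType.

Lemma mx_norm_leP m n (A : 'M[R]_(m, n)) r :
  0 <= r -> (forall i j, `|A i j| <= r) -> `|A| <= r.
Proof.
move=> r0 Ar; rewrite [leLHS]/Num.norm /= mx_normrE.
by apply/bigmax_leP; split=> // -[i j] _; apply: Ar.
Qed.

Lemma mx_entry_le m n (A : 'M[R]_(m, n)) i j : `|A i j| <= `|A|.
Proof.
rewrite [leRHS]/Num.norm /= mx_normrE.
by apply/bigmax_geP; right => /=; exists (i, j).
Qed.

Lemma norm_sum_ord_le n (F : 'I_n -> R) c :
  (forall i, `|F i| <= c) -> `|\sum_i F i| <= n%:R * c.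
Proof.
move=> Fc; rewrite (le_trans (ler_norm_sum _ _ _))//.
have -> : n%:R * c = \sum_(i < n) c by rewrite sumr_const card_ord mulr_natl.
exact: ler_sum.
Qed.

Lemma mx_normM m n k (A : 'M[R]_(m, n)) (B : 'M[R]_(n, k)) :
  `|A *m B| <= n%:R * `|A| * `|B|.
Proof.
apply: mx_norm_leP => [|i j]; first by rewrite !mulr_ge0.
rewrite mxE -mulrA norm_sum_ord_le// => l.
by rewrite normrM ler_pM// mx_entry_le.
Qed.

Lemma mx_norm_tr m n (A : 'M[R]_(m, n)) : `|A^T| = `|A|.
Proof.
apply/le_anti/andP; split; apply: mx_norm_leP => // i j; rewrite ?mxE ?mx_entry_le//.
by have := mx_entry_le A^T j i; rewrite mxE.
Qed.

Lemma norm_block_mx m n k l (A : 'M[R]_(m, n)) (B : 'M[R]_(m, k))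
    (C : 'M[R]_(l, n)) (D : 'M[R]_(l, k)) r :
  `|A| <= r -> `|B| <= r -> `|C| <= r -> `|D| <= r -> `|block_mx A B C D| <= r.
Proof.
move=> Ar Br Cr Dr; apply: mx_norm_leP => [|i j]; first exact: le_trans Ar.
case: (split_ordP i) => {}i ->; case: (split_ordP j) => {}j ->;
rewrite ?(block_mxEul, block_mxEur, block_mxEdl, block_mxEdr);
 exact: le_trans (mx_entry_le _ _ _) _.
Qed.

Lemma norm_ulsubmx m n k l (A : 'M[R]_(m + k, n + l)) : `|ulsubmx A| <= `|A|.
Proof. by apply: mx_norm_leP => // i j; rewrite !mxE mx_entry_le. Qed.
Lemma norm_ursubmx m n k l (A : 'M[R]_(m + k, n + l)) : `|ursubmx A| <= `|A|.
Proof. by apply: mx_norm_leP => // i j; rewrite !mxE mx_entry_le. Qed.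

Lemma norm_mxtrace n (A : 'M[R]_n) : `|\tr A| <= n%:R * `|A|.
Proof.
by apply: norm_sum_ord_le => i; exact: mx_entry_le.
Qed.

Lemma norm_scalar_mx n (a : R) : `|a%:M : 'M[R]_n| <= `|a|.
Proof.
by apply: mx_norm_leP => // i j; rewrite !mxE; case: eqP => _; rewrite ?mulr1n ?mulr0n ?normr0.
Qed.

Lemma prod_1D_expansion n : exists2 C : R, 0 <= C &
  forall (a : 'I_n -> R) e, 0 <= e <= 1 -> (forall i, `|a i| <= e) ->
  `|\prod_i (1 + a i) - 1 - \sum_i a i| <= C * e ^+ 2.
Proof.
elim: n => [|n [C C0 IH]].
  by exists 0 => // a e _ _; rewrite !big_ord0 !subrr normr0 mul0r.
exists (2 * C + n%:R) => [|a e e01 ae]; first by rewrite addr_ge0// mulr_ge0.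
rewrite !big_ord_recl.
have := IH (fun i => a (lift ord0 i)) e e01 (fun i => ae _).
set P := \prod_(i < n) _; set S := \sum_(i < n) _ => H.
have S1 : `|S| <= n%:R * e.
  exact: norm_sum_ord_le.
have -> : (1 + a ord0) * P - 1 - (a ord0 + S) = (1 + a ord0) * (P - 1 - S) + a ord0 * S.
  by ring.
rewrite (le_trans (ler_normD _ _))// !normrM mulrDl.
have a0 := ae ord0; case/andP: e01 => e0 e1.
rewrite lerD//; last first.
  by rewrite (le_trans (ler_pM _ _ a0 S1))// expr2; lra.
rewrite -mulrA ler_pM//.
by rewrite (le_trans (ler_normD _ _))// normr1; lra.
Qed.

Lemma perm_moved2 n (s : {perm 'I_n}) : s != 1%g ->
  exists i j, [/\ i != j, s i != i & s j != j].
Proof.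
move=> s1; have [i si] : exists i, s i != i.
  apply/existsP; apply: contraNT s1; rewrite negb_exists => /forallP h.
  by apply/eqP/permP => i; rewrite perm1; apply/eqP; move: (h i); rewrite negbK.
by exists i, (s i); rewrite (inj_eq perm_inj) (eq_sym i) si.
Qed.

(** In the Leibniz formula the identity contributes the product of the 1 + Y
    i i; every other permutation moves two indices at least, so that its term
    has two factors that are entries of Y, hence is of second order. *)
Lemma det_1D_expansion n : exists2 C : R, 0 <= C &
  forall Y : 'M[R]_n, `|Y| <= 1 -> `|\det (1%:M + Y) - 1 - \tr Y| <= C * `|Y| ^+ 2.
Proof.
have [C C0 HC] := prod_1D_expansion n.
exists (C + \sum_(s : {perm 'I_n}) 2 ^+ n) => [|Y Y1].
  by rewrite addr_ge0// sumr_ge0// => s _; rewrite exprn_ge0.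
rewrite /determinant (bigD1 1%g) //= odd_perm1 expr0 mul1r.
have -> : \prod_i (1%:M + Y) i ((1%g : {perm 'I_n}) i) = \prod_i (1 + Y i i) :> R.
  by apply: eq_bigr => i _; rewrite !mxE perm1 eqxx mulr1n.
set S := \sum_(i | _) _.
have -> : \prod_i (1 + Y i i) + S - 1 - \tr Y = (\prod_i (1 + Y i i) - 1 - \tr Y) + S.
  by ring.
rewrite (le_trans (ler_normD _ _))// mulrDl lerD//.
  by apply: HC => [|i]; rewrite ?mx_entry_le// Y1 andbT.
rewrite (le_trans (ler_norm_sum _ _ _))// [leRHS](_ : _ = \sum_(s : {perm 'I_n}) (2 ^+ n * `|Y| ^+ 2)); last first.
  by rewrite -mulr_suml.
rewrite [leRHS](bigD1 1%g) //= -[leLHS]add0r lerD//.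
apply: ler_sum => s s1.
rewrite normrM normrX normrN1 expr1n mul1r normr_prod.
have [i [j [ij si sj]]] := perm_moved2 s1.
rewrite (bigD1 i)//= (bigD1 j) 1?eq_sym//=.
have off k : s k != k -> `|(1%:M + Y) k (s k)| <= `|Y|.
  by move=> sk; rewrite !mxE eq_sym (negbTE sk) mulr0n add0r mx_entry_le.
rewrite mulrA mulrC ler_pM//; last by rewrite expr2 ler_pM//; exact: off.
  by rewrite prodr_ge0.
apply: (@le_trans _ _ (\prod_(k | (k != i) && (k != j)) 2)).
  apply: ler_prod => k _; rewrite normr_ge0/= !mxE (le_trans (ler_normD _ _))//.
  have := mx_entry_le Y k (s k).
  case: (k == s k); rewrite ?mulr1n ?mulr0n ?normr0 ?normr1; lra.
rewrite prodr_const ler_weXn2l// ?ler1n//.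
by rewrite -[X in (_ <= X)%N]card_ord max_card.
Qed.

End MatrixNorm.


(** * Cholesky and QR factorizations *)

Section QR.
Variable R : realType.

Definition upper_pos n (T : 'M[R]_n) : Prop :=
  (forall i j : 'I_n, (j < i)%N -> T i j = 0) /\ (forall i, 0 < T i i).

Lemma det_upper n (T : 'M[R]_n) :
  (forall i j : 'I_n, (j < i)%N -> T i j = 0) -> \det T = \prod_i T i i.
Proof.
move=> T0; rewrite -det_tr det_trig.
  by apply: eq_bigr => i _; rewrite mxE.
by apply/is_trig_mxP => i j ij; rewrite mxE T0.
Qed.

Lemma det_upper_pos n (T : 'M[R]_n) : upper_pos T -> 0 < \det T.
Proof. by case=> T0 Tp; rewrite det_upper// prodr_gt0. Qed.

Lemma upper_pos_unit n (T : 'M[R]_n) : upper_pos T -> T \in unitmx.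
Proof. by move=> /det_upper_pos d0; rewrite unitmxE unitfE gt_eqF. Qed.

Definition posdef n (P : 'M[R]_n) : Prop :=
  P^T = P /\ forall x : 'cV[R]_n, x != 0 -> 0 < (x^T *m P *m x) 0 0.

(** Eliminating the first row and column of a positive definite matrix leaves
    the Schur complement, which is positive definite again: its quadratic
    form at y is that of P at the vector extending y by the minimizing first
    coordinate. A factor of the complement is completed by the first row of P
    divided by the square root of the pivot. *)
Lemma cholesky n (P : 'M[R]_n) : posdef P ->
  exists T, upper_pos T /\ P = T^T *m T.
Proof.
elim: n P => [|n IH] P [Psym Ppos].
  by exists 0; split; [split=> -[]|apply/matrixP => -[]].
pose P0 : 'M[R]_(1 + n) := P.
have Ppos0 (x : 'cV[R]_(1 + n)) : x != 0 -> 0 < (x^T *m P0 *m x) 0 0 := Ppos x.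
pose p := P 0 0; pose r : 'rV[R]_n := ursubmx P0; pose P1 : 'M[R]_n := drsubmx P0.
have Pul : ulsubmx P0 = p%:M.
  rewrite [ulsubmx P0]mx11_scalar; congr (_%:M); rewrite !mxE /p.
  by congr (P _ _); apply: val_inj.
have Pdl : dlsubmx P0 = r^T by rewrite /r trmx_ursub /P0 Psym.
have Pb : P0 = block_mx p%:M r r^T P1 by rewrite -Pul -Pdl submxK.
have P1s : P1^T = P1 by rewrite /P1 trmx_drsub /P0 Psym.
have p0 : 0 < p.
  have := Ppos0 (col_mx 1%:M 0 : 'cV[R]_(1 + n)).
  rewrite Pb tr_col_mx mul_row_block mul_row_col trmx1 trmx0 !mul0mx !addr0.
  rewrite mulmx0 addr0 mul1mx mulmx1 mxE eqxx mulr1n; apply.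
  by rewrite col_mx_eq0 negb_and; apply/orP; left; apply/negP => /eqP/matrixP/(_ 0 0)/eqP; rewrite !mxE oner_eq0.
have [|T1 [[T1u T1p] PT1]] := IH (P1 - p^-1 *: (r^T *m r)).
  split; first by rewrite linearB linearZ /= trmx_mul trmxK P1s.
  move=> y y0.
  pose a := - p^-1 *: (r *m y).
  have := Ppos0 (col_mx a y : 'cV[R]_(1 + n)).
  rewrite Pb tr_col_mx mul_row_block mul_row_col.
  have -> : a^T *m p%:M + y^T *m r^T = 0.
    rewrite /a mul_mx_scalar linearZ /= trmx_mul scalerA mulrN divff ?gt_eqF//.
    by rewrite scaleN1r addNr.
  rewrite mul0mx add0r.
  have -> : a^T *m r + y^T *m P1 = y^T *m (P1 - p^-1 *: (r^T *m r)).
    rewrite /a linearZ /= trmx_mul -scalemxAl mulmxBr -scalemxAr scaleNr mulmxA.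
    by rewrite addrC.
  by apply; rewrite col_mx_eq0 negb_and y0 orbT.
have s0 : Num.sqrt p != 0 by rewrite sqrtr_eq0 -ltNge.
pose T0 : 'M[R]_(1 + n) := block_mx (Num.sqrt p)%:M ((Num.sqrt p)^-1 *: r) 0 T1.
have T0u (i j : 'I_(1 + n)) : (j < i)%N -> T0 i j = 0.
  case: (split_ordP i) => i1 ->; case: (split_ordP j) => j1 ->;
    rewrite ?(block_mxEul, block_mxEur, block_mxEdl, block_mxEdr)/=.
  - by rewrite !ord1.
  - by rewrite !ord1.
  - by rewrite !mxE.
  - by rewrite ltn_add2l; exact: T1u.
have T0p (i : 'I_(1 + n)) : 0 < T0 i i.
  case: (split_ordP i) => i1 ->; rewrite ?(block_mxEul, block_mxEdr)//.
  by rewrite !mxE ord1 eqxx mulr1n sqrtr_gt0.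
have PT0 : P0 = T0^T *m T0.
  rewrite Pb tr_block_mx mulmx_block !trmx0 !mulmx0 !mul0mx !addr0.
  rewrite tr_scalar_mx -scalar_mxM -expr2 sqr_sqrtr ?ltW//.
  rewrite mul_scalar_mx scalerA divff// scale1r mul_mx_scalar linearZ /= scalerA divff//.
  rewrite scale1r -scalemxAl -scalemxAr scalerA -invfM -expr2 sqr_sqrtr ?ltW//.
  by rewrite -PT1 addrC subrK.
by exists T0; split; [split|].
Qed.

Lemma trmx_mul_diag n (x : 'cV[R]_n) : (x^T *m x) 0 0 = \sum_i x i 0 ^+ 2.
Proof. by rewrite mxE; apply: eq_bigr => i _; rewrite mxE expr2. Qed.

Lemma trmx_mul_gt0 n (x : 'cV[R]_n) : x != 0 -> 0 < (x^T *m x) 0 0.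
Proof.
move=> x0; rewrite trmx_mul_diag lt0r sumr_ge0 ?andbT; last by move=> i _; rewrite sqr_ge0.
apply: contra x0 => /eqP /psumr_eq0P h; apply/eqP/matrixP => i j; rewrite ord1 mxE.
by apply/eqP; rewrite -sqrf_eq0 h// => k _; rewrite sqr_ge0.
Qed.

Lemma skew_quad n (S : 'M[R]_n) (x : 'cV[R]_n) : S^T = - S -> x^T *m S *m x = 0.
Proof.
move=> Ss; apply/matrixP => i j; rewrite !ord1 [RHS]mxE.
have : (x^T *m S *m x)^T = - (x^T *m S *m x).
  by rewrite !trmx_mul trmxK Ss mulNmx mulmxN mulmxA.
by move=> /matrixP/(_ 0 0); rewrite mxE [in RHS]mxE => h; lra.
Qed.

(** Since the quadratic form of a skew matrix vanishes, 1 + S is injective;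
    the triangular factor is the Cholesky factor of the Gram matrix of its
    columns. *)
Lemma QR_exists n (S : 'M[R]_n) : S^T = - S -> exists Q T, is_QR (1%:M + S) Q T.
Proof.
move=> Ss; set B := 1%:M + S.
have Bx (x : 'cV[R]_n) : x != 0 -> B *m x != 0.
  move=> x0; apply/eqP => Bx0; have := trmx_mul_gt0 x0.
  have : x^T *m (B *m x) = 0 by rewrite Bx0 mulmx0.
  by rewrite /B mulmxDl mul1mx mulmxDr (mulmxA _ S) skew_quad// addr0 => ->; rewrite mxE ltxx.
have [|T [Tup TT]] := @cholesky n (B^T *m B).
  split; first by rewrite trmx_mul trmxK.
  by move=> x x0; rewrite mulmxA -trmx_mul -mulmxA trmx_mul_gt0// Bx.
have Tu := upper_pos_unit Tup.
exists (B *m invmx T), T; case: Tup => T0 Tp; split => //; first by rewrite mulmxKV.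
rewrite trmx_mul mulmxA -(mulmxA _ _ B) TT trmx_inv mulmxA mulVmx ?unitmx_tr// mul1mx mulmxV//.
Qed.

Lemma QR_orthP n (S : 'M[R]_n) : S^T = - S -> exists T, is_QR (1%:M + S) (QR_orth (1%:M + S)) T.
Proof.
move=> /QR_exists[Q [T QRT]].
by apply: (@xgetPex _ 1%:M [set Q | exists T, is_QR (1%:M + S) Q T]); exists Q, T.
Qed.

Lemma orthogonal_norm n (Q : 'M[R]_n) : Q^T *m Q = 1%:M -> `|Q| <= 1.
Proof.
move=> QQ; apply: mx_norm_leP => // i j.
move/matrixP/(_ j j): QQ; rewrite !mxE eqxx mulr1n => QQ.
rewrite -(@ler_pXn2r _ 2)// ?nnegrE// expr1n -normrX ger0_norm ?sqr_ge0//.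
rewrite -QQ (bigD1 i)//= mxE -expr2 lerDl sumr_ge0// => k _.
by rewrite mxE -expr2 sqr_ge0.
Qed.

(** Back substitution. *)
Lemma upper_inv n (T : 'M[R]_n) : upper_pos T ->
  (forall i j : 'I_n, (j < i)%N -> invmx T i j = 0) /\
  (forall i, T i i * invmx T i i = 1).
Proof.
move=> Tup; have Tu := upper_pos_unit Tup; case: Tup => T0 Tp.
set V := invmx T; have TV : T *m V = 1%:M by rewrite mulmxV.
(* Descending induction on the row, measured by n - i. *)
have V0 : forall m (i j : 'I_n), (n - i < m)%N -> (j < i)%N -> V i j = 0.
  elim=> // m IH i j im ji; move/matrixP/(_ i j): TV; rewrite !mxE.
  rewrite (bigD1 i)//= big1 => [|k ki].
    have -> : (i == j) = false by apply/eqP => e; rewrite e ltnn in ji.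
    by rewrite addr0 => /eqP; rewrite mulf_eq0 (gt_eqF (Tp i))/= => /eqP.
  case: (ltngtP k i) => [ki'|ik|/val_inj e]; last by rewrite e eqxx in ki.
    by rewrite T0// mul0r.
  rewrite [V k j]IH ?mulr0//; last exact: ltn_trans ik.
  rewrite -ltnS; apply: leq_trans im; rewrite ltnS ltn_sub2l//; exact: ltn_ord.
have {}V0 (i j : 'I_n) : (j < i)%N -> V i j = 0 by apply: (V0 (n - i).+1).
split=> // i; move/matrixP/(_ i i): TV; rewrite !mxE eqxx mulr1n => <-.
rewrite (bigD1 i)//= big1 ?addr0// => k ki.
case: (ltngtP k i) => [ki'|ik|/val_inj e]; last by rewrite e eqxx in ki.
  by rewrite T0// mul0r.
by rewrite V0// mulr0.
Qed.

End QR.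


(** * The QR factor near the identity *)

Section NearIdentity.
Variable R : realType.

(** T is upper triangular and the transpose of its inverse is lower
    triangular with the inverse diagonal. Above the diagonal their difference
    is therefore T itself, and on the diagonal it is t - 1 / t, which
    dominates t - 1 because t is positive. *)
Lemma upper_mul_inv_near1 n (T : 'M[R]_n) e : upper_pos T -> 0 <= e ->
  `|T - (invmx T)^T| <= e -> `|T - 1%:M| <= e.
Proof.
move=> Tup e0 Te; have [V0 TV] := upper_inv Tup; case: Tup => T0 Tp.
apply: mx_norm_leP => // i j.
have := le_trans (mx_entry_le _ i j) Te; rewrite !mxE.
case: (ltngtP i j) => [ij|ji|/val_inj <-].
- have -> : (i == j) = false by apply/eqP => h; rewrite h ltnn in ij.
  by rewrite V0.
- have -> : (i == j) = false by apply/eqP => h; rewrite h ltnn in ji.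
  by rewrite T0// sub0r subrr normr0.
- rewrite eqxx mulr1n; apply: le_trans.
  set t := T i i; set u := invmx T i i.
  have t0 : 0 < t by exact: Tp.
  have u0 : 0 < u by rewrite -(pmulr_rgt0 _ t0) [_ * _]TV.
  have tu : t * u = 1 := TV i.
  have : t - 1 = (t - u) * (t / (t + 1)).
    rewrite (_ : t - u = (t - 1) * ((t + 1) / t)); last first.
      by have -> : u = t^-1 by [apply: (mulfI (lt0r_neq0 t0)); rewrite tu divff ?gt_eqF]; field; rewrite gt_eqF.
    by field; rewrite !gt_eqF//; lra.
  move=> ->; rewrite normrM ler_piMr// ger0_norm ?divr_ge0//; try lra.
  by rewrite ler_pdivrMr; lra.
Qed.

(** To first order, multiplication near the identity is addition of the
    displacements. This carries out all group products below: the two factors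
    of theta, and a Newton increment times the current point. *)
Lemma mul_near1 m (A B a b : 'M[R]_m) (k c c' e : R) :
  0 <= e <= 1 -> `|a| <= k * e -> `|b| <= k * e ->
  `|A - 1%:M - a| <= c * e ^+ 2 -> `|B - 1%:M - b| <= c' * e ^+ 2 ->
  `|A *m B - 1%:M - (a + b)| <=
    (m%:R * c * (1 + k + c') + m%:R * (1 + k) * c' + m%:R * k * k) * e ^+ 2.
Proof.
move=> /andP[e0 e1] ak bk Ac Bc.
have ee : e ^+ 2 <= e by rewrite expr2 ler_piMr.
case: m A B a b ak bk Ac Bc => [|m] A B a b ak bk Ac Bc.
  by rewrite !mul0r !add0r mul0r; apply: mx_norm_leP => // -[].
have [e00|e0'] := eqVneq e 0.
  subst e; move: ak bk Ac Bc; rewrite expr0n/= !mulr0 !normr_le0.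
  move=> /eqP-> /eqP->; rewrite !subr0 !subr_eq0 => /eqP-> /eqP->.
  by rewrite mul1mx addr0 subrr.
have e0p : 0 < e by rewrite lt0r e0' e0.
have k0 : 0 <= k by rewrite -(pmulr_lge0 _ e0p); exact: le_trans ak.
have e2p : 0 < e ^+ 2 by rewrite exprn_gt0.
have c0 : 0 <= c by rewrite -(pmulr_lge0 _ e2p); exact: le_trans Ac.
have c'0 : 0 <= c' by rewrite -(pmulr_lge0 _ e2p); exact: le_trans Bc.
have ke : k * e <= k by rewrite ler_piMr.
have c'e : c' * e ^+ 2 <= c' by rewrite ler_piMr// expr_le1.
have -> : A *m B - 1%:M - (a + b) = (A - 1%:M - a) *m B + (1%:M + a) *m (B - 1%:M - b) + a *m b.
  by rewrite !mulmxBl !mulmxBr !mulmxDl !mul1mx mulmx1 ; rewrite !opprD !addrA;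
   apply/matrixP => i j; rewrite !mxE; ring.
have B1 : `|B| <= 1 + k + c'.
  have -> : B = (B - 1%:M - b) + 1%:M + b by apply/matrixP => i j; rewrite !mxE; ring.
  rewrite (le_trans (ler_normD _ _))// (le_trans (lerD (ler_normD _ _) (lexx _)))//.
  by have := norm_scalar_mx m.+1 (1 : R); rewrite normr1; lra.
have a1 : `|1%:M + a| <= 1 + k.
  rewrite (le_trans (ler_normD _ _))//.
  by have := norm_scalar_mx m.+1 (1 : R); rewrite normr1; lra.
rewrite (le_trans (ler_normD _ _))// mulrDl lerD//; last first.
  rewrite (le_trans (mx_normM _ _))// -!mulrA ler_wpM2l//.
  by rewrite (_ : k * _ = (k * e) * (k * e)) ?ler_pM//; ring.
rewrite (le_trans (ler_normD _ _))// mulrDl lerD// (le_trans (mx_normM _ _))// -!mulrA ler_wpM2l//.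
  by rewrite [_ * e ^+ 2]mulrC mulrA ler_pM.
by rewrite ler_pM.
Qed.

Lemma norm_skew_part n (X : 'M[R]_n) : `|X - X^T| <= 2 * `|X|.
Proof. by rewrite (le_trans (ler_normB _ _))// mx_norm_tr mulr_natl mulr2n. Qed.

Lemma trace_skew n (S : 'M[R]_n) : S^T = - S -> \tr S = 0.
Proof. by move=> Ss; have := mxtrace_tr S; rewrite Ss linearN /= => h; lra. Qed.

(** For skew S the triangular factor satisfies T^T T = (1 + S)^T (1 + S) = 1
    - S^2, so that T differs from the transpose of its inverse by O(S^2), and
    hence from the identity by O(S^2). The orthogonal factor (1 + S) T^-1
    then agrees with 1 + S to first order. Its determinant is 1, being 1 or
    -1 and of the sign of det (1 + S) > 0. *)
Lemma QR_orth_near1 n : exists C r : R, [/\ 0 <= C, 0 < r, r <= 1 &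
  forall S : 'M[R]_n, S^T = - S -> `|S| <= r ->
  let Q := QR_orth (1%:M + S) in
  [/\ Q^T *m Q = 1%:M, \det Q = 1 & `|Q - 1%:M - S| <= C * `|S| ^+ 2]].
Proof.
have [D D0 HD] := @det_1D_expansion R n.
pose N : R := n%:R.
have N0 : 0 <= N by rewrite ler0n.
(* Small enough that S acts with norm at most 1/2, and that det (1 + S) is
   within 1/2 of 1. *)
pose r : R := (2 * (N + D + 1))^-1.
have r0 : 0 < r by rewrite invr_gt0 mulr_gt0//; lra.
have rE : r * (2 * (N + D + 1)) = 1 by rewrite mulVf// gt_eqF// -invr_gt0.
have Nr : N * r <= 2^-1 by nra.
have Dr : D * r <= 2^-1 by nra.
have r1 : r <= 1 by nra.
exists (8 * N ^+ 4), r; split=> //; first by rewrite mulr_ge0// exprn_ge0.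
move=> S Ss Sr Q; have [T [QT QQ T0 Tp]] := QR_orthP Ss.
rewrite -/Q in QT QQ.
have Tup : upper_pos T by [].
have Tu := upper_pos_unit Tup.
set V := invmx T.
have BV : (1%:M + S) *m V = Q by rewrite QT mulmxK.
have Q1 := orthogonal_norm QQ.
have NS : N * `|S| <= 2^-1 by rewrite (le_trans _ Nr)// ler_wpM2l.
have V2 : `|V| <= 2.
  have VE : V = Q - S *m V by rewrite -BV mulmxDl mul1mx addrK.
  have : `|V| <= 1 + 2^-1 * `|V|.
    rewrite {1}VE (le_trans (ler_normB _ _))// lerD// (le_trans (mx_normM _ _))//.
    by rewrite ler_wpM2r.
  by lra.
have TT : T^T *m T = 1%:M - S *m S.
  have : (1%:M + S)^T *m (1%:M + S) = T^T *m T.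
    by rewrite QT trmx_mul mulmxA -(mulmxA T^T) QQ mulmx1.
  have -> : (1%:M + S)^T = 1%:M - S.
    by rewrite -Ss; apply/matrixP => i j; rewrite !mxE eq_sym.
  move=> <-; rewrite mulmxDr mulmx1 mulmxBl mul1mx.
  by apply/matrixP => i j; rewrite !mxE; ring.
have VT : V^T *m T^T = 1%:M by rewrite -trmx_mul mulmxV// trmx1.
have TE : T - V^T = - (V^T *m (S *m S)).
  have -> : T = V^T *m (T^T *m T) by rewrite mulmxA VT mul1mx.
  by rewrite TT mulmxBr mulmx1 addrC addKr.
have S2 : `|S *m S| <= N * `|S| ^+ 2 by rewrite (le_trans (mx_normM _ _))// -mulrA.
have e0 : 0 <= 2 * N ^+ 2 * `|S| ^+ 2 by rewrite !mulr_ge0// exprn_ge0.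
have T1 : `|T - 1%:M| <= 2 * N ^+ 2 * `|S| ^+ 2.
  apply: upper_mul_inv_near1 => //.
  rewrite TE normrN (le_trans (mx_normM _ _))// mx_norm_tr -/N.
  have : `|V| * `|S *m S| <= 2 * (N * `|S| ^+ 2) by rewrite ler_pM.
  by move=> h; rewrite -mulrA (le_trans (ler_wpM2l N0 h))//; lra.
have V1 : `|V - 1%:M| <= 4 * N ^+ 3 * `|S| ^+ 2.
  have -> : V - 1%:M = V *m (1%:M - T) by rewrite mulmxBr mulmx1 mulVmx.
  rewrite (le_trans (mx_normM _ _))// -/N distrC.
  have : `|V| * `|T - 1%:M| <= 2 * (2 * N ^+ 2 * `|S| ^+ 2) by rewrite ler_pM.
  by move=> h; rewrite -mulrA (le_trans (ler_wpM2l N0 h))//; lra.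
have dTp := det_upper_pos Tup.
have dB : \det (1%:M + S) = \det Q * \det T by rewrite -det_mulmx -QT.
split=> //.
  have dQ2 : \det Q * \det Q = 1 by rewrite -{1}det_tr -det_mulmx QQ det1.
  have dB0 : 0 < \det (1%:M + S).
    have := HD S (le_trans Sr r1); rewrite (trace_skew Ss) subr0 => h.
    have : `|\det (1%:M + S) - 1| <= 2^-1.
      rewrite (le_trans h)// expr2 mulrA (le_trans _ Dr)//.
      have : D * `|S| <= D * r by rewrite ler_wpM2l.
      by apply: le_trans; rewrite ler_piMr ?mulr_ge0// (le_trans Sr).
    by rewrite ler_norml => /andP[]; lra.
  have dQ0 : 0 < \det Q by rewrite -(pmulr_lgt0 _ dTp) -dB.
  by nra.
have -> : Q - 1%:M - S = (1%:M + S) *m (V - 1%:M).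
  by rewrite mulmxBr mulmx1 BV opprD addrA.
rewrite (le_trans (mx_normM _ _))// -/N.
have B2 : `|1%:M + S| <= 2.
  rewrite (le_trans (ler_normD _ _))//; have := norm_scalar_mx n (1 : R).
  by rewrite normr1; lra.
have : `|1%:M + S| * `|V - 1%:M| <= 2 * (4 * N ^+ 3 * `|S| ^+ 2) by rewrite ler_pM.
by move=> h; rewrite -mulrA (le_trans (ler_wpM2l N0 h))//; lra.
Qed.

End NearIdentity.


(** * The parameterization of SL(n) near the identity *)

Section ThetaNearIdentity.
Variable R : realType.

(** The lower bound is the convexity inequality 1 + x <= exp x; the upper one
    follows from the same inequality at - x. *)
Lemma expR_near1 (x : R) : `|x| <= 2^-1 -> `|expR x - 1 - x| <= 2 * `|x| ^+ 2.
Proof.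
rewrite ler_norml => /andP[x1 x2].
rewrite -normrX [in leRHS]ger0_norm ?sqr_ge0//.
have h1 := expR_ge1Dx x.
rewrite ger0_norm; last by lra.
have h2 := expR_ge1Dx (- x).
have e0 := expR_gt0 x.
have : expR x * expR (- x) = 1 by rewrite expRN divff// gt_eqF.
set a := expR x in h1 e0 *; set b := expR (- x) in h2 *.
move=> ab.
have h3 : a * (1 - x) <= 1 by rewrite -[leRHS]ab ler_wpM2l// ltW.
have h4 : (a - 1 - x - 2 * x ^+ 2) * (1 - x) <= 0.
  rewrite (_ : _ * _ = (a * (1 - x) - 1) - x ^+ 2 * (1 - 2 * x)); last by ring.
  have : 0 <= x ^+ 2 * (1 - 2 * x) by rewrite mulr_ge0 ?sqr_ge0//; lra.
  by lra.
have : a - 1 - x - 2 * x ^+ 2 <= 0.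
  by rewrite -(@pmulr_lle0 _ (1 - x))//; lra.
by lra.
Qed.

(** The two factors of theta are 1 + (Xl - Xl^T) and 1 + (Xd + Xu + Xl^T) to
    first order, and these displacements add up to X. The second factor is
    upper triangular with diagonal entries exp (X i i), so its determinant is
    exp (tr X) = 1. *)
Lemma theta_near1 n : exists C r : R, [/\ 0 <= C, 0 < r, r <= 1 &
  forall X : 'M[R]_n, \tr X = 0 -> `|X| <= r ->
  \det (theta X) = 1 /\ `|theta X - 1%:M - X| <= C * `|X| ^+ 2].
Proof.
have [C [r [C0 r0 r1 HQ]]] := @QR_orth_near1 R n.
pose c : R := 4 * C.
exists (n%:R * c * (1 + 2 + 2) + n%:R * (1 + 2) * 2 + n%:R * 2 * 2), (r / 2).
split; rewrite ?divr_gt0//; first by rewrite !addr_ge0 ?mulr_ge0.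
  by lra.
move=> X X0 Xr; rewrite /theta.
set Xl := strict_lower X; set Xu := strict_upper X.
set S := Xl - Xl^T.
pose Xd : 'M[R]_n := diag_mx (\row_i X i i).
set U := exp_diag X + Xu + Xl^T.
have XlX : `|Xl| <= `|X|.
  by apply: mx_norm_leP => // i j; rewrite mxE; case: ifP => _; rewrite ?normr0 ?mx_entry_le.
have SX : `|S| <= 2 * `|X|.
  by rewrite (le_trans (norm_skew_part _))// ler_wpM2l.
have Ss : S^T = - S by apply/matrixP => i j; rewrite !mxE; ring.
have [QQ dQ Q1] := HQ S Ss ltac:(lra).
have -> : 1%:M + Xl - Xl^T = 1%:M + S by rewrite /S addrA.
have U0 (i j : 'I_n) : (j < i)%N -> U i j = 0.
  move=> ji; rewrite !mxE ltnNge (ltnW ji)/=.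
  have -> : (i == j) = false by apply/eqP => e; rewrite e ltnn in ji.
  by rewrite mulr0n !add0r.
have Uii i : U i i = expR (X i i).
  by rewrite !mxE eqxx mulr1n ltnn !addr0.
have dU : \det U = 1.
  rewrite det_upper//; under eq_bigr do rewrite Uii.
  by rewrite -expR_sum -[X in expR X]/(\tr X) X0 expR0.
split; first by rewrite det_mulmx dQ dU mulr1.
have XE : X = S + (Xd + Xu + Xl^T).
  apply/matrixP => i j; rewrite !mxE.
  case: (ltngtP i j) => [ij|ji|/val_inj <-].
  - have -> : (i == j) = false by apply/eqP => h; rewrite h ltnn in ij.
    by rewrite mulr0n; ring.
  - have -> : (i == j) = false by apply/eqP => h; rewrite h ltnn in ji.
    by rewrite mulr0n; ring.
  - by rewrite eqxx mulr1n; ring.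
rewrite [in X in `|X|]XE.
have X1 : `|X| <= 2^-1 by lra.
apply: mul_near1; rewrite ?normr_ge0//=; first by lra.
- apply: mx_norm_leP => [|i j]; first by rewrite mulr_ge0.
  rewrite !mxE; have Xij := mx_entry_le X i j; have Xji := mx_entry_le X j i; have := normr_ge0 X.
  case: (ltngtP i j) => [ij|ji|/val_inj <-].
  - have -> : (i == j) = false by apply/eqP => h; rewrite h ltnn in ij.
    rewrite mulr0n !add0r; move: (ler_normD (X i j) (X j i)); lra.
  - have -> : (i == j) = false by apply/eqP => h; rewrite h ltnn in ji.
    by rewrite mulr0n !addr0 normr0; lra.
  - by rewrite eqxx mulr1n !addr0; have := mx_entry_le X i i; lra.
- rewrite (le_trans Q1)// (_ : c * _ = C * (2 * `|X|) ^+ 2); last by rewrite /c; ring.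
  by rewrite ler_wpM2l// ler_pXn2r ?nnegrE// mulr_ge0.
- apply: mx_norm_leP => [|i j]; first by rewrite mulr_ge0// exprn_ge0.
  rewrite (_ : (U - 1%:M - (Xd + Xu + Xl^T)) i j = (expR (X i i) - 1 - X i i) *+ (i == j)); last first.
    by rewrite !mxE; case: (i == j); rewrite ?(mulr1n, mulr0n); ring.
  case: eqP => _; last by rewrite mulr0n normr0 mulr_ge0// exprn_ge0.
  rewrite mulr1n (le_trans (expR_near1 _))//.
    by rewrite (le_trans (mx_entry_le _ _ _)).
  by rewrite ler_wpM2l// ler_pXn2r ?nnegrE// mx_entry_le.
Qed.

End ThetaNearIdentity.


(** * The Lie algebras as linear subspaces of matrices *)

Section LieAlgebra.
Variables (R : realType) (n : nat) (G : motion_group).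
Local Notation p := n.+1.

(** The affine vector field z |-> Om z + v, as a matrix of size n + 1: the
    derivative at 1 of a curve of motions. *)
Definition algmx (Om : 'M[R]_p) (v : 'cV[R]_p) : 'M[R]_(p + 1) := block_mx Om v 0 0.

Definition lie_proj_linear (Y : 'M[R]_p) : 'M[R]_p :=
  match G with
  | SE => 2^-1 *: (Y - Y^T)
  | SA => Y - (\tr Y / p%:R)%:M
  end.

(** A linear projection of all matrices onto the Lie algebra. Membership is
    stated through it so that the distance to the Lie algebra can be
    estimated and limits taken. *)
Definition lie_proj (X : 'M[R]_(p + 1)) : 'M[R]_(p + 1) :=
  algmx (lie_proj_linear (ulsubmx X)) (ursubmx X).

Definition lie (X : 'M[R]_(p + 1)) : Prop := lie_proj X = X.

Lemma lie_proj_linear_in Y : lie_algebra G (lie_proj_linear Y).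
Proof.
rewrite /lie_proj_linear; case: G => /=.
  by apply/matrixP => i j; rewrite !mxE; ring.
by rewrite linearB /= mxtrace_scalar -[_ *+ _]mulr_natr divfK ?subrr// pnatr_eq0.
Qed.

Lemma lie_proj_linear_id Y : lie_algebra G Y -> lie_proj_linear Y = Y.
Proof.
rewrite /lie_proj_linear; case: G => /= [->|->].
  by apply/matrixP => i j; rewrite !mxE; lra.
by rewrite mul0r raddf0 subr0.
Qed.

Lemma lieP X : lie X <-> exists Om v, lie_algebra G Om /\ X = algmx Om v.
Proof.
split=> [<-|[Om [v [OmG ->]]]].
  by exists (lie_proj_linear (ulsubmx X)), (ursubmx X); split=> //; exact: lie_proj_linear_in.
by rewrite /lie /lie_proj block_mxKul block_mxKur lie_proj_linear_id.
Qed.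

Lemma lie_algmx Om v : lie_algebra G Om -> lie (algmx Om v).
Proof. by move=> h; apply/lieP; exists Om, v. Qed.

Lemma lie_proj_comb a X Y : lie_proj (a *: X + Y) = a *: lie_proj X + lie_proj Y.
Proof.
rewrite /lie_proj /algmx scale_block_mx add_block_mx !scaler0 !addr0.
have -> : ursubmx (a *: X + Y) = a *: ursubmx X + ursubmx Y by apply/matrixP => i j; rewrite !mxE.
have -> : ulsubmx (a *: X + Y) = a *: ulsubmx X + ulsubmx Y by apply/matrixP => i j; rewrite !mxE.
move: (ulsubmx X) (ulsubmx Y) => A B; congr block_mx; rewrite /lie_proj_linear; case: G.
  by apply/matrixP => i j; rewrite !mxE; ring.
rewrite linearP /= scalerBr; apply/matrixP => i j; rewrite !mxE.
by case: (i == j); rewrite ?(mulr1n, mulr0n); ring.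
Qed.

Lemma lie_projK X : lie (lie_proj X).
Proof. by apply/lieP; exists (lie_proj_linear (ulsubmx X)), (ursubmx X); split=> //; exact: lie_proj_linear_in. Qed.

Lemma lie_projB X Y : lie_proj (X - Y) = lie_proj X - lie_proj Y.
Proof. by rewrite addrC -scaleN1r lie_proj_comb scaleN1r addrC. Qed.

Lemma lie0 : lie 0.
Proof. by have := lie_projB 0 0; rewrite !subrr. Qed.

Lemma lie_projZ a X : lie_proj (a *: X) = a *: lie_proj X.
Proof. by rewrite -[a *: X]addr0 lie_proj_comb (_ : lie_proj 0 = 0) ?addr0//; exact: lie0. Qed.

Lemma lieB X Y : lie X -> lie Y -> lie (X - Y).
Proof. by rewrite /lie lie_projB => -> ->. Qed.
Lemma lieZ a X : lie X -> lie (a *: X).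
Proof. by rewrite /lie lie_projZ => ->. Qed.
Lemma lieD X Y : lie X -> lie Y -> lie (X + Y).
Proof. by move=> ? hY; rewrite -[Y]opprK; apply: lieB => //; rewrite -scaleN1r; exact: lieZ. Qed.

Lemma norm_lie_proj X : `|lie_proj X| <= 2 * `|X|.
Proof.
have X0 := normr_ge0 X.
apply: norm_block_mx; rewrite ?normr0 ?mulr_ge0//; last first.
  by rewrite (le_trans (norm_ursubmx _))//; lra.
have Y0 := norm_ulsubmx X; move: (ulsubmx X) Y0 => Y Y0.
rewrite /lie_proj_linear; case: G.
  rewrite normrZ ger0_norm ?invr_ge0//.
  by have := norm_skew_part Y; lra.
rewrite (le_trans (ler_normB _ _))//.
have : `|(\tr Y / p%:R)%:M : 'M[R]_p| <= `|Y|.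
  rewrite (le_trans (norm_scalar_mx _ _))// normrM normfV (@ger0_norm _ p%:R)//.
  by rewrite ler_pdivrMr ?ltr0n// mulrC norm_mxtrace.
lra.
Qed.

Lemma lie_closed X : (forall e, 0 < e -> exists2 Y, lie Y & `|X - Y| <= e) -> lie X.
Proof.
move=> h; apply/eqP; rewrite /lie -subr_eq0 -normr_le0; apply/ler_addgt0Pr => e e0.
have [Y lY XY] := h (e / 3) ltac:(by rewrite divr_gt0).
rewrite add0r (_ : lie_proj X - X = lie_proj (X - Y) - (X - Y)); last first.
  by rewrite lie_projB lY opprB addrA subrK.
by rewrite (le_trans (ler_normB _ _))//; have := norm_lie_proj (X - Y); lra.
Qed.

(** Half the anticommutator of the linear parts. In the coefficient systems
    it is the second order term of the exponential, polarized. *)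
Definition jord (X Y : 'M[R]_(p + 1)) : 'M[R]_(p + 1) :=
  algmx (2^-1 *: (ulsubmx Y *m ulsubmx X + ulsubmx X *m ulsubmx Y)) 0.

(** The difference is half a commutator in the linear part, which lies in
    so(n) or sl(n), and a translation. This is why symmetrizing the second
    order term changes nothing at a critical point, where the gradient
    vanishes on the Lie algebra. *)
Lemma lie_mul_sub_jord X Y : lie X -> lie Y -> lie (Y *m X - jord X Y).
Proof.
move=> /lieP[A [a [hA ->]]] /lieP[B [b [hB ->]]].
rewrite /jord !block_mxKul mulmx_block !mulmx0 !mul0mx !addr0.
rewrite opp_block_mx add_block_mx !oppr0 !addr0.
apply: lie_algmx; case: G hA hB => /= hA hB.
  have e (C D : 'M[R]_p) : C^T = - C -> D^T = - D -> (D *m C)^T = C *m D.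
    by move=> hC hD; rewrite trmx_mul hC hD mulNmx mulmxN opprK.
  apply/matrixP => i j.
  have /matrixP/(_ i j) := e _ _ hA hB; have /matrixP/(_ i j) := e _ _ hB hA.
  by rewrite !mxE; lra.
have -> : B *m A - 2^-1 *: (B *m A + A *m B) = 2^-1 *: (B *m A - A *m B).
  by apply/matrixP => i j; rewrite !mxE; lra.
by rewrite linearZ linearB /= mxtrace_mulC subrr mulr0.
Qed.

End LieAlgebra.

(** * The groups and their local motions near the identity *)

Section Carrier.
Variables (R : realType) (n : nat) (G : motion_group).
Local Notation p := n.+1.
Implicit Types M K : 'M[R]_(p + 1).

Definition linear_group (A : 'M[R]_p) : Prop :=
  match G with SE => A^T *m A = 1%:M /\ \det A = 1 | SA => \det A = 1 end.

Lemma carrierP M : carrier G M <-> exists A t, linear_group A /\ M = motion A t.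
Proof.
rewrite /linear_group; case: G => /=; split=> -[A [t]].
- by case=> ? ? ?; exists A, t.
- by case=> [[? ?] ?]; exists A, t.
- by case=> ? ?; exists A, t.
- by case=> ? ?; exists A, t.
Qed.

Lemma linear_group_unit A : linear_group A -> A \in unitmx.
Proof.
suff : linear_group A -> \det A = 1 by move=> h /h; rewrite unitmxE unitfE => ->; rewrite oner_neq0.
by rewrite /linear_group; case: G => // -[].
Qed.

Lemma linear_groupM A B : linear_group A -> linear_group B -> linear_group (A *m B).
Proof.
rewrite /linear_group; case: G => [[hA dA] [hB dB]|dA dB]; rewrite ?det_mulmx ?dA ?dB ?mulr1//.
by split=> //; rewrite trmx_mul mulmxA -(mulmxA _ A^T) hA mulmx1.
Qed.

Lemma linear_groupV A : linear_group A -> linear_group (invmx A).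
Proof.
move=> hA; have Au := linear_group_unit hA; move: hA.
rewrite /linear_group; case: G => [[hA dA]|dA]; rewrite ?det_inv ?dA ?invr1//.
have AT : invmx A = A^T by rewrite -[LHS]mul1mx -hA mulmxK.
by split=> //; rewrite {1}AT trmxK mulmxV.
Qed.

Lemma motion_mul (A B : 'M[R]_p) s t : motion A s *m motion B t = motion (A *m B) (A *m t + s).
Proof.
by rewrite /motion mulmx_block !mulmx0 !mul0mx !mulmx1 !addr0 !add0r.
Qed.

Lemma motion1 : motion 1%:M 0 = 1%:M :> 'M[R]_(p + 1).
Proof. by rewrite /motion -scalar_mx_block. Qed.

Lemma carrierM M K : carrier G M -> carrier G K -> carrier G (M *m K).
Proof.
move=> /carrierP[A [s [hA ->]]] /carrierP[B [t [hB ->]]]; apply/carrierP.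
by rewrite motion_mul; do 2 eexists; split; last reflexivity; exact: linear_groupM.
Qed.

Lemma carrier_inv M : carrier G M -> M \in unitmx /\ carrier G (invmx M).
Proof.
move=> /carrierP[A [s [hA ->]]]; have Au := linear_group_unit hA.
have e : motion (invmx A) (- (invmx A *m s)) *m motion A s = 1%:M.
  by rewrite motion_mul mulVmx// subrr motion1.
have [u1 u2] := mulmx1_unit e.
split=> //; have <- : motion (invmx A) (- (invmx A *m s)) = invmx (motion A s).
  by rewrite -[LHS]mulmx1 -(mulmxV u2) mulmxA e mul1mx.
by apply/carrierP; do 2 eexists; split; last reflexivity; exact: linear_groupV.
Qed.

Lemma motion_sub1 (A : 'M[R]_p) t : motion A t - 1%:M = algmx (A - 1%:M) t.
Proof.
by rewrite -motion1 /motion /algmx opp_block_mx add_block_mx !oppr0 !addr0 subrr.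
Qed.

(** The group is tangent to its Lie algebra at the identity. With Y the
    displacement of the linear part, orthogonality reads Y + Y^T = - Y^T Y,
    and a unit determinant gives tr Y = O(Y^2). *)
Lemma carrier_near1 : exists2 C : R, 0 <= C &
  forall K, carrier G K -> `|K - 1%:M| <= 1 ->
  `|K - 1%:M - lie_proj G (K - 1%:M)| <= C * `|K - 1%:M| ^+ 2.
Proof.
have [D D0 HD] := @det_1D_expansion R p.
exists (p%:R + D) => [|K]; first by rewrite addr_ge0.
move=> /carrierP[A [t [hA ->]]]; rewrite motion_sub1 => K1.
set Y := A - 1%:M.
have Yle : `|Y| <= `|algmx Y t|.
  by rewrite -[X in `|X| <= _](block_mxKul Y t (0 : 'rV[R]_p) (0 : 'M[R]_1)) norm_ulsubmx.
apply: (@le_trans _ _ ((p%:R + D) * `|Y| ^+ 2)); last first.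
  by rewrite ler_wpM2l ?addr_ge0// ler_pXn2r ?nnegrE.
rewrite /lie_proj /algmx block_mxKul block_mxKur opp_block_mx add_block_mx !oppr0 !addr0 subrr.
have B0 : 0 <= (p%:R + D) * `|Y| ^+ 2 by rewrite mulr_ge0 ?addr_ge0// exprn_ge0.
apply: norm_block_mx; rewrite ?normr0//.
have AE : A = 1%:M + Y by rewrite addrC subrK.
have Y20 : 0 <= `|Y| ^+ 2 by rewrite exprn_ge0.
have Y1 : `|Y| <= 1 by exact: le_trans K1.
move: hA; rewrite /linear_group /lie_proj_linear; case: G => [[hA _]|dA].
  have -> : Y - 2^-1 *: (Y - Y^T) = - (2^-1 *: (Y^T *m Y)).
    have -> : Y^T *m Y = - (Y + Y^T).
      have YT : Y^T = A^T - 1%:M by apply/matrixP => i j; rewrite !mxE eq_sym.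
      rewrite YT mulmxBl mul1mx {1}/Y mulmxBr hA mulmx1 /Y.
      by apply/matrixP => i j; rewrite !mxE; ring.
    by apply/matrixP => i j; rewrite !mxE; lra.
  rewrite normrN normrZ ger0_norm ?invr_ge0//.
  have := mx_normM Y^T Y; rewrite mx_norm_tr -mulrA -expr2.
  have := mulr_ge0 D0 Y20; have : 0 <= p%:R * `|Y| ^+ 2 by rewrite mulr_ge0.
  by have := normr_ge0 (Y^T *m Y); lra.
rewrite opprB addrCA subrr addr0.
have := HD Y Y1; rewrite -AE dA subrr sub0r normrN => h.
rewrite (le_trans (norm_scalar_mx _ _))// normrM normfV (@ger0_norm _ p%:R)//.
rewrite ler_pdivrMr ?ltr0n// (le_trans h)//.
rewrite -[X in X <= _]mulr1 ler_pM ?mulr_ge0 ?ler1n// ler_wpM2r//.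
by rewrite lerDr.
Qed.

(** The update is a retraction: it stays in the group and agrees to first
    order with the exponential map. Only this first order agreement matters
    for quadratic convergence. *)
Lemma local_motion_near1 : exists C r : R, [/\ 0 <= C, 0 < r, r <= 1 &
  forall (Om : 'M[R]_p) (v : 'cV[R]_p), lie_algebra G Om -> `|algmx Om v| <= r ->
  carrier G (local_motion G Om v) /\
  `|local_motion G Om v - 1%:M - algmx Om v| <= C * `|algmx Om v| ^+ 2].
Proof.
pose th (Om : 'M[R]_p) := match G with SE => QR_orth (1%:M + Om) | SA => theta Om end.
have [C [r [C0 r0 r1 H]]] : exists C r : R, [/\ 0 <= C, 0 < r, r <= 1 &
    forall Om : 'M[R]_p, lie_algebra G Om -> `|Om| <= r ->
    linear_group (th Om) /\ `|th Om - 1%:M - Om| <= C * `|Om| ^+ 2].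
  rewrite /linear_group /th; case: G => /=.
    have [C [r [? ? ? H]]] := @QR_orth_near1 R p; exists C, r; split=> // Om h1 h2.
    by have [] := H _ h1 h2.
  exact: theta_near1.
exists (C + p%:R), r; split=> //; first by rewrite addr_ge0.
move=> Om v OmG Omr.
set e := `|algmx Om v| in Omr *.
have Ome : `|Om| <= e.
  by rewrite -[X in `|X| <= _](block_mxKul Om v (0 : 'rV[R]_p) (0 : 'M[R]_1)) norm_ulsubmx.
have ve : `|v| <= e.
  by rewrite -[X in `|X| <= _](block_mxKur Om v (0 : 'rV[R]_p) (0 : 'M[R]_1)) norm_ursubmx.
have e0 : 0 <= e by exact: normr_ge0.
have e20 : 0 <= e ^+ 2 by rewrite exprn_ge0.
have [h1 h2] := H Om OmG (le_trans Ome Omr).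
split; first by apply/carrierP; do 2 eexists; split; last reflexivity.
rewrite /local_motion motion_sub1 -/(th Om) /algmx opp_block_mx add_block_mx !oppr0 !addr0.
have B0 : 0 <= (C + p%:R) * e ^+ 2 by rewrite mulr_ge0 ?addr_ge0.
apply: norm_block_mx; rewrite ?normr0//.
  rewrite (le_trans h2)// ler_pM// ?exprn_ge0 ?lerDl// ler_pXn2r ?nnegrE//.
rewrite mulmxDl mul1mx addrC addKr -scalemxAl normrZ ger0_norm ?invr_ge0//.
have h3 : `|Om| * `|v| <= e ^+ 2 by rewrite expr2 ler_pM.
have := mx_normM Om v; rewrite -mulrA.
have : p%:R * (`|Om| * `|v|) <= p%:R * e ^+ 2 by rewrite ler_wpM2l.
have : 0 <= C * e ^+ 2 by rewrite mulr_ge0.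
by have := normr_ge0 (Om *m v); lra.
Qed.

End Carrier.


(** * Derivatives and continuity in epsilon-delta form *)

Section EpsilonDelta.
Variable R : realType.

Lemma is_derive_epsP (V W : normedModType R) (f : V -> W) (a v : V) (d : W) :
  is_derive a v f d <->
  forall e, 0 < e -> exists2 r, 0 < r &
    forall s : R, `|s| < r -> `|f (s *: v + a) - f a - s *: d| <= e * `|s|.
Proof.
have key (s e : R) : s != 0 ->
    (`|f (s *: v + a) - f a - s *: d| <= e * `|s|) =
    (`|d - s^-1 *: ((f \o shift a) (s *: v) - f a)| <= e).
  move=> s0; rewrite -ler_pdivrMr ?normr_gt0// mulrC -normfV -normrZ distrC /=.
  by rewrite scalerBr scalerA mulVf// scale1r.
split=> [[df dd] e e0|h].
  have /cvgrPdist_le/(_ e e0) : (fun s => s^-1 *: ((f \o shift a) (s *: v) - f a)) @ 0^' --> d.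
    by rewrite -dd; exact: df.
  move=> /nbhs_ballP[r /= r0 hr]; exists r => // s sr.
  have [->|s0] := eqVneq s 0.
    by rewrite !scale0r add0r subrr subr0 !normr0 mulr0.
  by rewrite key//; apply: hr => //; rewrite /ball /= sub0r normrN.
have hc : (fun s => s^-1 *: ((f \o shift a) (s *: v) - f a)) @ 0^' --> d.
  apply/cvgrPdist_le => e e0; have [r r0 hr] := h e e0.
  apply/nbhs_ballP; exists r => //= s; rewrite /ball /= sub0r normrN => sr s0.
  by rewrite -key//; exact: hr.
apply: DeriveDef; first by apply/cvg_ex; exists d.
exact/cvg_lim.
Qed.

Lemma continuous_epsP (V W : normedModType R) (f : V -> W) (a : V) :
  {for a, continuous f} <->
  forall e, 0 < e -> exists2 r, 0 < r & forall x, `|x - a| < r -> `|f x - f a| <= e.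
Proof.
split=> [/cvgrPdist_le h e e0|h].
  have /nbhs_ballP[r /= r0 hr] := h e e0; exists r => // x xr.
  by rewrite distrC; apply: hr; rewrite -ball_normE /ball_ /= distrC.
apply/cvgrPdist_le => e e0; have [r r0 hr] := h e e0.
apply/nbhs_ballP; exists r => // x; rewrite -ball_normE /ball_ /= distrC => xr.
by rewrite distrC; exact: hr.
Qed.

Lemma lipschitz_continuous_all (V W : normedModType R) (f : V -> W) k :
  (forall x y, `|f x - f y| <= k * `|x - y|) -> continuous f.
Proof.
move=> h a; apply/continuous_epsP => e e0; exists (e / (`|k| + 1)).
  by rewrite divr_gt0// ltr_wpDl.
move=> x; rewrite ltr_pdivlMr ?ltr_wpDl// => xr; rewrite (le_trans (h _ _))//.
rewrite (le_trans _ (ltW xr))// mulrC ler_wpM2l//.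
by rewrite (le_trans (ler_norm k))// lerDl.
Qed.

End EpsilonDelta.

(** * The mean value theorem in several variables *)

Section MeanValue.
Variable R : realType.

Lemma line_derive n (h : 'cV[R]_n -> R) (z e : 'cV[R]_n) (s : R) :
  derivable h (z + s *: e) e ->
  is_derive s (1 : R) (fun t => h (z + t *: e)) ('D_e h (z + s *: e)).
Proof.
move=> /derivableP /is_derive_epsP dh; apply/is_derive_epsP => eps eps0.
have [r r0 hr] := dh eps eps0; exists r => // t tr.
suff -> : z + (t *: (1 : R) + s) *: e = t *: e + (z + s *: e) by exact: hr.
by rewrite scalerDl [t *: 1]mulr1 addrCA.
Qed.

Lemma mean_value_line n (h : 'cV[R]_n -> R) (z e : 'cV[R]_n) (a : R) :
  (forall s, `|s| <= `|a| -> derivable h (z + s *: e) e) ->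
  exists2 c, `|c| <= `|a| & h (z + a *: e) - h z = a * 'D_e h (z + c *: e).
Proof.
move=> dh; pose phi t := h (z + t *: e).
have dphi s : `|s| <= `|a| -> is_derive s (1 : R) phi ('D_e h (z + s *: e)).
  by move=> sa; apply: line_derive; exact: dh.
have z0 : phi 0 = h z by rewrite /phi scale0r addr0.
have itvle (x y : R) s : `|x| <= `|a| -> `|y| <= `|a| -> s \in `[x, y] -> `|s| <= `|a|.
  move=> xa ya; rewrite in_itv/= => /andP[xs sy]; rewrite ler_norml.
  by move: xa ya; rewrite !ler_norml => /andP[? ?] /andP[? ?]; apply/andP; split; lra.
have mvt (x y : R) : `|x| <= `|a| -> `|y| <= `|a| -> x <= y ->
    exists2 c, `|c| <= `|a| & phi y - phi x = 'D_e h (z + c *: e) * (y - x).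
  move=> xa ya xy.
  have [|||c cxy ->] := @MVT_segment R phi (fun s => 'D_e h (z + s *: e)) x y.
  - exact: xy.
  - by move=> s /subset_itv_oo_cc sxy; apply: dphi; exact: itvle sxy.
  - apply: derivable_within_continuous => s sxy.
    by have [] := dphi s (itvle _ _ _ xa ya sxy).
  by exists c => //; exact: itvle cxy.
rewrite -z0 -/(phi a); have [a0|a0] := leP 0 a.
  have [||c ca ->] := mvt 0 a _ _ a0; rewrite ?normr0//.
  by exists c; rewrite // subr0 mulrC.
have [||c ca e1] := mvt a 0 _ _ (ltW a0); rewrite ?normr0//.
by exists c => //; rewrite -opprB e1 sub0r mulrN opprK mulrC.
Qed.

Lemma norm_delta_cV n (i : 'I_n) : `|delta_mx i 0 : 'cV[R]_n| <= 1.
Proof.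
by apply: mx_norm_leP => // k l; rewrite mxE; case: (_ && _); rewrite ?normr1 ?normr0.
Qed.

(** Changing one coordinate at a time reduces the statement to the mean value
    theorem on a line. In the sup norm the intermediate points stay within
    |y| of z, so continuity of the partial derivatives at z is enough to
    control the right-hand side. *)
Lemma mean_value_coord n (h : 'cV[R]_n -> R) (z y : 'cV[R]_n) :
  (forall i x, `|x - z| <= `|y| -> derivable h x (delta_mx i 0)) ->
  exists2 zeta : 'I_n -> 'cV[R]_n, forall i, `|zeta i - z| <= `|y| &
    h (z + y) - h z = \sum_i y i 0 * partial i h (zeta i).
Proof.
move=> dh.
(* The first k coordinates have been moved from z to z + y. *)
pose path k : 'cV[R]_n := \col_j (z j 0 + if (j < k)%N then y j 0 else 0).
have pathS (i : 'I_n) : path i.+1 = path i + y i 0 *: delta_mx i 0.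
  apply/matrixP => j l; rewrite !mxE ord1 eqxx andbT ltnS leq_eqVlt.
  have -> : (j == i) = (j == i :> nat) by [].
  by case: ltngtP => ?; rewrite /= ?mulr1 ?mulr0 ?addr0//=; congr (_ + y _ _); apply: val_inj.
have near_path (i : 'I_n) s : `|s| <= `|y i 0| -> `|path i + s *: delta_mx i 0 - z| <= `|y|.
  move=> sy; apply: mx_norm_leP => // j l; rewrite !mxE ord1 eqxx andbT.
  case: (eqVneq j i) => [->|ji] /=.
    by rewrite ltnn addr0 mulr1 addrAC subrr add0r (le_trans sy) ?mx_entry_le.
  rewrite mulr0 addr0 addrAC subrr add0r; case: ifP => _; first exact: mx_entry_le.
  by rewrite normr0.
have step (i : 'I_n) : exists x : 'cV[R]_n, `|x - z| <= `|y| /\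
    h (path i.+1) - h (path i) = y i 0 * partial i h x.
  have [|c cy e] := @mean_value_line n h (path i) (delta_mx i 0) (y i 0).
    by move=> s sy; apply: dh; exact: near_path.
  by exists (path i + c *: delta_mx i 0); rewrite pathS e; split=> //; exact: near_path.
have [zeta hz] := choice step.
exists zeta => [i|]; first by case: (hz i).
have p0 : path 0%N = z by apply/matrixP => j l; rewrite !mxE ltn0 addr0 ord1.
have pn : path n = z + y by apply/matrixP => j l; rewrite !mxE ltn_ord ord1.
rewrite -pn -[in h z]p0.
rewrite -(telescope_sumr (fun k => h (path k)))// big_mkord.
by apply: eq_bigr => i _; case: (hz i).
Qed.

End MeanValue.


(** * Taylor estimates for functions of class C^k *)

Section Smooth.
Variable R : realType.

Lemma compact_ball_cV n (r : R) : compact [set x : 'cV[R]_n | `|x| <= r].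
Proof.
have -> : [set x : 'cV[R]_n | `|x| <= r] = trmx @` [set x : 'rV[R]_n | `|x| <= r].
  apply/seteqP; split=> x /=.
    by move=> xr; exists x^T; rewrite ?trmxK//= mx_norm_tr.
  by move=> [y yr <-]; rewrite mx_norm_tr.
apply: continuous_compact.
  apply/continuous_subspaceT/(@lipschitz_continuous_all _ _ _ _ 1) => x y.
  by rewrite mul1r -linearB /= mx_norm_tr.
apply: bounded_closed_compact.
  by exists r; split; [exact: num_real|move=> s rs x /= xr; exact/ltW/(le_lt_trans xr)].
apply: (@closed_comp _ R (fun x : 'rV[R]_n => `|x|) [set t | t <= r]).
  by move=> x _; exact: norm_continuous.
exact: closed_le.
Qed.

Lemma continuous_bounded_ball n (h : 'cV[R]_n -> R) r : continuous h ->
  exists2 C, 0 <= C & forall x, `|x| <= r -> `|h x| <= C.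
Proof.
move=> hc; have : compact (h @` [set x | `|x| <= r]).
  by apply: continuous_compact; [exact/continuous_subspaceT|exact: compact_ball_cV].
move=> /compact_bounded[N [_ hN]]; exists (`|N| + 1); first by rewrite addr_ge0.
move=> x xr; apply: (hN (`|N| + 1)); first by rewrite (le_lt_trans (ler_norm _))// ltrDl.
by exists x.
Qed.

Lemma is_Ck_continuous k n (h : 'cV[R]_n -> R) : is_Ck k setT h -> continuous h.
Proof. by case: k => [|k] [hc _] x; exact: hc. Qed.

Lemma is_Ck_partial k n U (h : 'cV[R]_n -> R) i : is_Ck k.+1 U h -> is_Ck k U (partial i h).
Proof. by case=> _ /(_ i) []. Qed.

Lemma is_Ck_derivable k n U (h : 'cV[R]_n -> R) i x : U x ->
  is_Ck k.+1 U h -> derivable h x (delta_mx i 0).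
Proof. by move=> Ux [_ /(_ i) [+ _]]; exact. Qed.

Lemma is_CkW k n U (h : 'cV[R]_n -> R) : is_Ck k.+1 U h -> is_Ck k U h.
Proof.
elim: k h => [|k IH] h [hc hp]; split=> // i; have [hd hk] := hp i.
by split=> //; exact: IH.
Qed.

Lemma bounded_family (I : finType) n (F : I -> 'cV[R]_n -> R) r : (forall i, continuous (F i)) ->
  exists2 C, 0 <= C & forall i x, `|x| <= r -> `|F i x| <= C.
Proof.
move=> Fc; have hC i : exists C, 0 <= C /\ forall x, `|x| <= r -> `|F i x| <= C.
  by have [C ? ?] := continuous_bounded_ball r (Fc i); exists C.
have [C HC] := choice hC.
exists (\sum_i C i) => [|i x xr]; first by apply: sumr_ge0 => i _; case: (HC i).
rewrite (bigD1 i)//= (@le_trans _ _ (C i))//; first by case: (HC i) => _; exact.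
by rewrite lerDl sumr_ge0// => j _; case: (HC j).
Qed.

Lemma C1_lipschitz n (h : 'cV[R]_n -> R) r : is_Ck 1 setT h ->
  exists2 C, 0 <= C & forall z y, `|z| <= r -> `|y| <= r -> `|h (z + y) - h z| <= C * `|y|.
Proof.
move=> h1; have [C C0 HC] := @bounded_family 'I_n n (fun i => partial i h) (2 * r)
  (fun i => is_Ck_continuous (is_Ck_partial i h1)).
exists (n%:R * C) => [|z y zr yr]; first by rewrite mulr_ge0.
have [|zeta zy ->] := @mean_value_coord R n h z y.
  by move=> i x _; exact: is_Ck_derivable h1.
rewrite -mulrA norm_sum_ord_le// => i; rewrite normrM mulrC ler_pM ?mx_entry_le//.
apply: HC; have -> : zeta i = (zeta i - z) + z by rewrite subrK.
by rewrite (le_trans (ler_normD _ _))//; have := zy i; lra.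
Qed.

Lemma lipschitz_family (I : finType) n (F : I -> 'cV[R]_n -> R) r : (forall i, is_Ck 1 setT (F i)) ->
  exists2 C, 0 <= C & forall i z y, `|z| <= r -> `|y| <= r -> `|F i (z + y) - F i z| <= C * `|y|.
Proof.
move=> Fc; have hC i : exists C, 0 <= C /\ forall z y, `|z| <= r -> `|y| <= r -> `|F i (z + y) - F i z| <= C * `|y|.
  by have [C ? ?] := C1_lipschitz r (Fc i); exists C.
have [C HC] := choice hC.
exists (\sum_i C i) => [|i z y zr yr]; first by apply: sumr_ge0 => i _; case: (HC i).
rewrite (bigD1 i)//= (@le_trans _ _ (C i * `|y|))//; first by case: (HC i) => _; exact.
by rewrite ler_wpM2r// lerDl sumr_ge0// => j _; case: (HC j).
Qed.

Lemma C2_taylor n (h : 'cV[R]_n -> R) r : is_Ck 2 setT h ->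
  exists2 C, 0 <= C & forall z y, `|z| <= r -> `|y| <= r ->
    `|h (z + y) - h z - \sum_i y i 0 * partial i h z| <= C * `|y| ^+ 2.
Proof.
move=> h2; have [C C0 HC] := @lipschitz_family 'I_n n (fun i => partial i h) r
  (fun i => is_Ck_partial i h2).
exists (n%:R * C) => [|z y zr yr]; first by rewrite mulr_ge0.
have [|zeta zy ->] := @mean_value_coord R n h z y.
  by move=> i x _; exact: is_Ck_derivable h2.
rewrite -sumrB -mulrA norm_sum_ord_le// => i; rewrite -mulrBr normrM expr2 mulrCA.
rewrite ler_pM ?mx_entry_le// -[zeta i](subrKC z).
by rewrite (le_trans (HC i z (zeta i - z) zr (le_trans (zy i) yr)))// ler_wpM2l.
Qed.

Lemma taylor_family (I : finType) n (F : I -> 'cV[R]_n -> R) r : (forall i, is_Ck 2 setT (F i)) ->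
  exists2 C, 0 <= C & forall i z y, `|z| <= r -> `|y| <= r ->
    `|F i (z + y) - F i z - \sum_k y k 0 * partial k (F i) z| <= C * `|y| ^+ 2.
Proof.
move=> Fc; have hC i : exists C, 0 <= C /\ forall z y, `|z| <= r -> `|y| <= r ->
    `|F i (z + y) - F i z - \sum_k y k 0 * partial k (F i) z| <= C * `|y| ^+ 2.
  by have [C ? ?] := C2_taylor r (Fc i); exists C.
have [C HC] := choice hC.
exists (\sum_i C i) => [|i z y zr yr]; first by apply: sumr_ge0 => i _; case: (HC i).
rewrite [in leRHS](bigD1 i)//= (@le_trans _ _ (C i * `|y| ^+ 2))//; first by case: (HC i) => _; exact.
by rewrite ler_wpM2r ?exprn_ge0// lerDl sumr_ge0// => j _; case: (HC j).
Qed.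

(** The mean value theorem applied twice: first along e_i to the increment of
    h in the direction e_k, then along e_k to the partial derivative so
    obtained. *)
Lemma second_difference n (h : 'cV[R]_n -> R) (z : 'cV[R]_n) (i k : 'I_n) s :
  is_Ck 2 setT h ->
  exists2 w, `|w - z| <= 2 * `|s| &
    h (z + s *: delta_mx i 0 + s *: delta_mx k 0) - h (z + s *: delta_mx i 0)
      - (h (z + s *: delta_mx k 0) - h z) = s * s * partial k (partial i h) w.
Proof.
move=> h2; set a : 'cV[R]_n := delta_mx i 0; set b : 'cV[R]_n := delta_mx k 0.
have dh x : derivable h x a by exact: is_Ck_derivable h2.
pose h1 x := h (x + s *: b) - h x.
have dh1 x : is_derive x a h1 (partial i h (x + s *: b) - partial i h x).
  apply/is_derive_epsP => e e0.
  have dhE y : exists2 r, 0 < r & forall t : R, `|t| < r ->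
      `|h (t *: a + y) - h y - t *: 'D_a h y| <= e / 2 * `|t|.
    by have /derivableP/is_derive_epsP := dh y; apply; rewrite divr_gt0.
  have [r1 r10 H1] := dhE x; have [r2 r20 H2] := dhE (x + s *: b).
  exists (Num.min r1 r2) => [|t]; first by rewrite lt_min r10.
  rewrite lt_min => /andP[/H1 h1' /H2 h2'].
  have -> : h1 (t *: a + x) - h1 x - t *: (partial i h (x + s *: b) - partial i h x) =
    (h (t *: a + (x + s *: b)) - h (x + s *: b) - t *: 'D_a h (x + s *: b)) -
    (h (t *: a + x) - h x - t *: 'D_a h x).
    rewrite /h1 /partial -/a addrA scalerBr.
    rewrite -[t *: 'D_a h (x + s *: b)]/(t * 'D_a h (x + s *: b)) -[t *: 'D_a h x]/(t * 'D_a h x).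
    by move: ('D_a h _) ('D_a h _) => u1 u2; move: (h _) (h _) (h _) (h _) => *; ring.
  by rewrite (le_trans (ler_normB _ _))//; lra.
have [|c cs e1] := @mean_value_line R n h1 z a s; first by move=> t _; case: (dh1 (z + t *: a)).
rewrite -/(h1 (z + s *: a)) -/(h1 z) e1 (@derive_val _ _ _ _ _ _ _ (dh1 _)).
have [|c' cs' e2] := @mean_value_line R n (partial i h) (z + c *: a) b s.
  by move=> t _; exact: is_Ck_derivable (is_Ck_partial i h2).
exists (z + c *: a + c' *: b); last by rewrite e2 mulrA.
rewrite -[z + _ + _]addrA addrAC subrr add0r (le_trans (ler_normD _ _))// !normrZ.
have na := norm_delta_cV R i; have nb := norm_delta_cV R k.
have : `|c| * `|a| <= `|s| * 1 by rewrite ler_pM.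
have : `|c'| * `|b| <= `|s| * 1 by rewrite ler_pM.
lra.
Qed.

(** The second difference is symmetric in the two directions; dividing it by
    s^2 and letting s tend to 0 gives both mixed derivatives. *)
Lemma partialC n (h : 'cV[R]_n -> R) (i k : 'I_n) z :
  is_Ck 2 setT h -> partial i (partial k h) z = partial k (partial i h) z.
Proof.
move=> h2.
have c1 : continuous (partial i (partial k h)) := is_Ck_continuous (is_Ck_partial i (is_Ck_partial k h2)).
have c2 : continuous (partial k (partial i h)) := is_Ck_continuous (is_Ck_partial k (is_Ck_partial i h2)).
have d1 s := second_difference z i k s h2.
have d2 s := second_difference z k i s h2.
move: (partial i (partial k h)) (partial k (partial i h)) c1 c2 d1 d2 => P Q c1 c2 d1 d2.
apply/eqP; rewrite -subr_eq0 -normr_le0; apply/ler_addgt0Pr => e e0; rewrite add0r.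
have /continuous_epsP/(_ (e / 2))[|r1 r10 H1] := c1 z; first by rewrite divr_gt0.
have /continuous_epsP/(_ (e / 2))[|r2 r20 H2] := c2 z; first by rewrite divr_gt0.
pose s := Num.min r1 r2 / 4.
have m0 : 0 < Num.min r1 r2 by rewrite lt_min r10.
have s0 : 0 < s by rewrite divr_gt0.
have ss : 2 * `|s| < Num.min r1 r2 by rewrite gtr0_norm// /s; lra.
have [w1 w1z e1] := d1 s; have [w2 w2z e2] := d2 s.
have QP : Q w1 = P w2.
  apply: (@mulfI _ (s * s)); first by rewrite mulf_neq0 ?gt_eqF.
  rewrite -e1 -e2 (addrAC z).
  by move: (h _) (h _) (h _) (h _) => *; ring.
have := le_lt_trans w2z ss; rewrite lt_min => /andP[/H1 h1 _].
have := le_lt_trans w1z ss; rewrite lt_min => /andP[_ /H2].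
rewrite QP; move: (P w2) (P z) (Q z) h1 => a b c h1 h3.
have -> : b - c = (a - c) - (a - b) by ring.
by rewrite (le_trans (ler_normB _ _))//; lra.
Qed.

End Smooth.


(** * The cost function of a bounded functional and its differentials *)

Section Functional.
Variable R : realType.

(** All that is used of the expectation: it is linear on continuous functions
    and controlled by the supremum over one ball. Both the weighted integral
    and the weighted sample mean are of this kind, so that the two cost
    functions are treated at once. *)
Definition bounded_functional m (E : ('cV[R]_m -> R) -> R) : Prop :=
  (forall (h1 h2 : 'cV[R]_m -> R) (a : R), continuous h1 -> continuous h2 ->
     E (fun x => h1 x + a * h2 x) = E h1 + a * E h2) /\
  exists r C : R, 0 <= C /\ forall h b, continuous h ->
     (forall x, `|x| <= r -> `|h x| <= b) -> `|E h| <= C * b.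

Lemma continuous_sumR (V : topologicalType) (I : Type) (s : seq I) (P : pred I) (F : I -> V -> R) :
  (forall i, continuous (F i)) -> continuous (fun x => \sum_(i <- s | P i) F i x).
Proof.
move=> Fc; elim: s => [|i s IH].
  rewrite (_ : (fun _ => _) = (fun=> 0)); first exact: cst_continuous.
  by apply/funext => x; rewrite big_nil.
rewrite (_ : (fun x => \sum_(j <- i :: s | P j) F j x) =
  (fun x => (if P i then F i x else 0) + \sum_(j <- s | P j) F j x)); last first.
  by apply/funext => x; rewrite big_cons; case: (P i); rewrite ?add0r.
move=> x; apply: (@continuousD R R^o V _ _ x); last exact: IH.
by case: (P i); [exact: Fc|exact: cst_continuous].
Qed.

Lemma continuousMR (V : topologicalType) (F H : V -> R) :
  continuous F -> continuous H -> continuous (fun x => F x * H x).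
Proof. by move=> Fc Hc x; apply: (@continuousM R V F H x); [exact: Fc|exact: Hc]. Qed.

Lemma continuousBR (V : topologicalType) (F H : V -> R) :
  continuous F -> continuous H -> continuous (fun x => F x - H x).
Proof. by move=> Fc Hc x; apply: (@continuousB R R^o V F H x); [exact: Fc|exact: Hc]. Qed.

Section Linear.
Variables (m : nat) (E : ('cV[R]_m -> R) -> R).
Hypothesis E_bf : bounded_functional E.
Implicit Types h : 'cV[R]_m -> R.

Lemma functional0 : E (fun=> 0) = 0.
Proof.
have [lin _] := E_bf; have := lin (fun=> 0) (fun=> 0) (-1) (@cst_continuous _ _ _) (@cst_continuous _ _ _).
rewrite (_ : (fun=> 0 + -1 * 0) = (fun=> 0)) => [->|]; first by rewrite mulN1r subrr.
by apply/funext => x; rewrite mulr0 addr0.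
Qed.

Lemma functionalZ a h : continuous h -> E (fun x => a * h x) = a * E h.
Proof.
move=> hc; have [lin _] := E_bf.
have := lin (fun=> 0) h a (@cst_continuous _ _ _) hc; rewrite functional0 add0r => <-.
by congr E; apply/funext => x; rewrite add0r.
Qed.

Lemma functionalD h1 h2 : continuous h1 -> continuous h2 -> E (fun x => h1 x + h2 x) = E h1 + E h2.
Proof.
move=> c1 c2; have [lin _] := E_bf.
rewrite -[E h2]mul1r -lin//; congr E; apply/funext => x; by rewrite mul1r.
Qed.

Lemma functionalB h1 h2 : continuous h1 -> continuous h2 -> E (fun x => h1 x - h2 x) = E h1 - E h2.
Proof.
move=> c1 c2; have [lin _] := E_bf.
rewrite -[E h2]mul1r -mulNr -lin//; congr E; apply/funext => x; by rewrite mulN1r.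
Qed.

Lemma functional_sum (I : Type) (s : seq I) (P : pred I) (F : I -> 'cV[R]_m -> R) :
  (forall i, continuous (F i)) -> E (fun x => \sum_(i <- s | P i) F i x) = \sum_(i <- s | P i) E (F i).
Proof.
move=> Fc; elim: s => [|i s IH].
  rewrite big_nil -[RHS]functional0; congr E; apply/funext => x; by rewrite big_nil.
rewrite big_cons (_ : (fun x => _) = (fun x => (if P i then F i x else 0) + \sum_(j <- s | P j) F j x)); last first.
  by apply/funext => x; rewrite big_cons; case: (P i); rewrite ?add0r.
rewrite functionalD; last 2 first.
  - by case: (P i); [exact: Fc|exact: cst_continuous].
  - exact: continuous_sumR.
by rewrite IH; case: (P i) => //; rewrite functional0 add0r.
Qed.

End Linear.

Section Act.
Variable m : nat.
Implicit Types (M X : 'M[R]_(m + 1)) (x : 'cV[R]_m).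

Lemma actD M X x : act (M + X) x = act M x + act X x.
Proof.
rewrite /act /linear_part /translation_part.
have -> : ulsubmx (M + X) = ulsubmx M + ulsubmx X by apply/matrixP => i j; rewrite !mxE.
have -> : ursubmx (M + X) = ursubmx M + ursubmx X by apply/matrixP => i j; rewrite !mxE.
by rewrite mulmxDl addrACA.
Qed.

Lemma actZ a X x : act (a *: X) x = a *: act X x.
Proof.
rewrite /act /linear_part /translation_part.
have -> : ulsubmx (a *: X) = a *: ulsubmx X by apply/matrixP => i j; rewrite !mxE.
have -> : ursubmx (a *: X) = a *: ursubmx X by apply/matrixP => i j; rewrite !mxE.
by rewrite scalerDr scalemxAl.
Qed.

Lemma norm_act X x r : `|x| <= r -> `|act X x| <= (m%:R * r + 1) * `|X|.
Proof.
move=> xr; rewrite (le_trans (ler_normD _ _))// mulrDl mul1r lerD//.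
  rewrite (le_trans (mx_normM _ _))// -!mulrA ler_wpM2l// mulrC ler_pM//.
  exact: norm_ulsubmx.
exact: norm_ursubmx.
Qed.

Lemma act_continuous X : continuous (act X).
Proof.
apply: (@lipschitz_continuous_all _ _ _ _ (m%:R * `|linear_part X|)) => x y.
rewrite (_ : act X x - act X y = linear_part X *m (x - y)) ?mx_normM//.
by rewrite mulmxBr /act opprD addrACA subrr addr0.
Qed.

Lemma act_coord_continuous X i : continuous (fun x => act X x i 0).
Proof.
move=> x; apply: (@continuous_comp _ _ _ (act X) (fun y : 'cV[R]_m => y i 0)).
  exact: act_continuous.
exact: coord_continuous.
Qed.

Lemma comp_act_continuous (h : 'cV[R]_m -> R) X : continuous h -> continuous (fun x => h (act X x)).
Proof. by move=> hc x; apply: (@continuous_comp _ _ _ (act X) h); [exact: act_continuous|exact: hc]. Qed.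

End Act.

Section CostExpansion.
Variables (m : nat) (f : 'cV[R]_m -> R) (E : ('cV[R]_m -> R) -> R).
Hypotheses (f_C3 : is_Ck 3 setT f) (E_bf : bounded_functional E).
Implicit Types M X Y Z L : 'M[R]_(m + 1).

Definition cost M : R := E (fun x => f (act M x)).
(** The candidates for the first and second differentials of the cost at M,
    in arbitrary matrix directions. The expansions below show that they are
    the differentials, uniformly enough that no derivative has to be
    exchanged with the expectation. *)
Definition dcost M X : R := E (fun x => \sum_i partial i f (act M x) * act X x i 0).
Definition d2cost M X Y : R :=
  E (fun x => \sum_i \sum_k partial k (partial i f) (act M x) * act X x k 0 * act Y x i 0).

Let f_c := is_Ck_continuous f_C3.
Let pf_c i := is_Ck_continuous (is_Ck_partial i f_C3).
Let ppf_c i k := is_Ck_continuous (is_Ck_partial k (is_Ck_partial i f_C3)).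

Lemma dcost_integrand_continuous M X : continuous (fun x => \sum_i partial i f (act M x) * act X x i 0).
Proof.
apply: continuous_sumR => i; apply: continuousMR; last exact: act_coord_continuous.
exact: comp_act_continuous.
Qed.

Lemma d2cost_term_continuous M X Y i k :
  continuous (fun x => partial k (partial i f) (act M x) * act X x k 0 * act Y x i 0).
Proof.
apply: continuousMR; last exact: act_coord_continuous.
apply: continuousMR; last exact: act_coord_continuous.
exact: comp_act_continuous.
Qed.

Lemma d2cost_integrand_continuous M X Y :
  continuous (fun x => \sum_i \sum_k partial k (partial i f) (act M x) * act X x k 0 * act Y x i 0).
Proof.
apply: continuous_sumR => i; apply: continuous_sumR => k; exact: d2cost_term_continuous.
Qed.

Lemma dcost_linear a M X Y : dcost M (a *: X + Y) = a * dcost M X + dcost M Y.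
Proof.
rewrite /dcost -(functionalZ E_bf)//; last exact: dcost_integrand_continuous.
rewrite -(functionalD E_bf); last 2 first.
- by apply: continuousMR; [exact: cst_continuous|exact: dcost_integrand_continuous].
- exact: dcost_integrand_continuous.
congr E; apply/funext => x; rewrite mulr_sumr -big_split; apply: eq_bigr => i _.
rewrite /= actD actZ !mxE; move: (partial _ _ _) => d; ring.
Qed.

Lemma d2cost_linearl a M X Y Z : d2cost M (a *: X + Y) Z = a * d2cost M X Z + d2cost M Y Z.
Proof.
rewrite /d2cost -(functionalZ E_bf)//; last exact: d2cost_integrand_continuous.
rewrite -(functionalD E_bf); last 2 first.
- by apply: continuousMR; [exact: cst_continuous|exact: d2cost_integrand_continuous].
- exact: d2cost_integrand_continuous.
congr E; apply/funext => x; rewrite mulr_sumr -big_split; apply: eq_bigr => i _.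
rewrite mulr_sumr -big_split; apply: eq_bigr => k _.
rewrite /= actD actZ !mxE; move: (partial _ _ _) => d; ring.
Qed.

Lemma d2cost_linearr a M X Y Z : d2cost M Z (a *: X + Y) = a * d2cost M Z X + d2cost M Z Y.
Proof.
rewrite /d2cost -(functionalZ E_bf)//; last exact: d2cost_integrand_continuous.
rewrite -(functionalD E_bf); last 2 first.
- by apply: continuousMR; [exact: cst_continuous|exact: d2cost_integrand_continuous].
- exact: d2cost_integrand_continuous.
congr E; apply/funext => x; rewrite mulr_sumr -big_split; apply: eq_bigr => i _.
rewrite mulr_sumr -big_split; apply: eq_bigr => k _.
rewrite /= actD actZ !mxE; move: (partial _ _ _) => d; ring.
Qed.

Lemma act_bounds L : exists r C c rho : R, [/\ 0 <= C, 0 <= c, 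
  forall h b, continuous h -> (forall x, `|x| <= r -> `|h x| <= b) -> `|E h| <= C * b,
  forall X x, `|x| <= r -> `|act X x| <= c * `|X| &
  forall X x, `|x| <= r -> `|X| <= 1 -> `|act L x| <= rho /\ `|act X x| <= rho].
Proof.
have [_ [r [C [C0 HC]]]] := E_bf.
have Kr : 0 <= m%:R * Num.max r 0 + 1 by rewrite addr_ge0// mulr_ge0// le_max lexx orbT.
have aX X x : `|x| <= r -> `|act X x| <= (m%:R * Num.max r 0 + 1) * `|X|.
  by move=> xr; apply: norm_act; rewrite le_max xr.
exists r, C, (m%:R * Num.max r 0 + 1), ((m%:R * Num.max r 0 + 1) * (`|L| + 1)).
split=> // X x xr X1; split; rewrite (le_trans (aX _ _ xr))// ler_wpM2l//.
  by rewrite lerDl.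
by rewrite (le_trans X1)// lerDr.
Qed.

(** The pointwise Taylor estimates are uniform over the ball that controls
    the expectation, as act M maps it into a bounded set; they pass through
    the expectation by boundedness. *)
Lemma cost_expansion L : exists2 C, 0 <= C & forall X, `|X| <= 1 ->
  `|cost (L + X) - cost L - dcost L X| <= C * `|X| ^+ 2.
Proof.
have [r [C [c [rho [C0 c0 HC Hc Hrho]]]]] := act_bounds L.
have [T T0 HT] := C2_taylor rho (is_CkW f_C3).
exists (C * (T * c ^+ 2)) => [|X X1]; first by rewrite !mulr_ge0// exprn_ge0.
rewrite /cost /dcost -(functionalB E_bf); [|exact: comp_act_continuous..].
rewrite -(functionalB E_bf); last 2 first.
- by apply: continuousBR; exact: comp_act_continuous.
- exact: dcost_integrand_continuous.
rewrite (_ : _ * `|X| ^+ 2 = C * (T * (c * `|X|) ^+ 2)); last by ring.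
apply: HC => [|x xr].
  apply: continuousBR; last exact: dcost_integrand_continuous.
  by apply: continuousBR; exact: comp_act_continuous.
have [h1 h2] := Hrho X x xr X1.
have -> : \sum_i partial i f (act L x) * act X x i 0 = \sum_i act X x i 0 * partial i f (act L x).
  by apply: eq_bigr => i _; rewrite mulrC.
rewrite actD (le_trans (HT _ _ h1 h2))// ler_wpM2l//.
by rewrite ler_pXn2r ?nnegrE// ?mulr_ge0// Hc.
Qed.

Lemma dcost_expansion L : exists2 C, 0 <= C & forall X Y, `|X| <= 1 ->
  `|dcost (L + X) Y - dcost L Y - d2cost L X Y| <= C * `|X| ^+ 2 * `|Y|.
Proof.
have [r [C [c [rho [C0 c0 HC Hc Hrho]]]]] := act_bounds L.
have [T T0 HT] := taylor_family rho (fun i => is_Ck_partial i f_C3).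
exists (C * (m%:R * (T * c ^+ 2 * c))) => [|X Y X1]; first by rewrite !mulr_ge0// exprn_ge0.
rewrite /dcost /d2cost -(functionalB E_bf); [|exact: dcost_integrand_continuous..].
have cB : continuous (fun x => \sum_i partial i f (act (L + X) x) * act Y x i 0 -
   \sum_i partial i f (act L x) * act Y x i 0).
  by apply: continuousBR; exact: dcost_integrand_continuous.
rewrite -(functionalB E_bf)//; last exact: d2cost_integrand_continuous.
rewrite (_ : _ * `|X| ^+ 2 * `|Y| = C * (m%:R * (T * (c * `|X|) ^+ 2 * (c * `|Y|)))); last by ring.
apply: HC => [|x xr].
  by apply: continuousBR; [exact: cB|exact: d2cost_integrand_continuous].
have [h1 h2] := Hrho X x xr X1.
rewrite -!sumrB norm_sum_ord_le// => i.
have -> : \sum_k partial k (partial i f) (act L x) * act X x k 0 * act Y x i 0 =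
   (\sum_k act X x k 0 * partial k (partial i f) (act L x)) * act Y x i 0.
  by rewrite mulr_suml; apply: eq_bigr => k _; ring.
rewrite -!mulrBl normrM ler_pM//; last by rewrite (le_trans (mx_entry_le _ _ _))// Hc.
rewrite actD (le_trans (HT i _ _ h1 h2))// ler_wpM2l//.
by rewrite ler_pXn2r ?nnegrE// ?mulr_ge0// Hc.
Qed.

Lemma d2cost_lipschitz L : exists2 C, 0 <= C & forall X Y Z, `|X| <= 1 ->
  `|d2cost (L + X) Y Z - d2cost L Y Z| <= C * `|X| * `|Y| * `|Z|.
Proof.
have [r [C [c [rho [C0 c0 HC Hc Hrho]]]]] := act_bounds L.
have [T T0 HT] := lipschitz_family rho
  (fun ik : 'I_m * 'I_m => is_Ck_partial ik.2 (is_Ck_partial ik.1 f_C3)).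
exists (C * (m%:R * (m%:R * (T * c * c * c)))) => [|X Y Z X1]; first by rewrite !mulr_ge0.
rewrite /d2cost -(functionalB E_bf); [|exact: d2cost_integrand_continuous..].
rewrite (_ : _ * `|X| * `|Y| * `|Z| = C * (m%:R * (m%:R * (T * (c * `|X|) * (c * `|Y|) * (c * `|Z|))))); last by ring.
apply: HC => [|x xr].
  by apply: continuousBR; exact: d2cost_integrand_continuous.
have [h1 h2] := Hrho X x xr X1.
rewrite -!sumrB norm_sum_ord_le// => i; rewrite -sumrB norm_sum_ord_le// => k.
rewrite -!mulrBl !normrM ler_pM//; last by rewrite (le_trans (mx_entry_le _ _ _))// Hc.
rewrite ler_pM//; last by rewrite (le_trans (mx_entry_le _ _ _))// Hc.
by rewrite actD (le_trans (HT (i, k) _ _ h1 h2))// ler_wpM2l// Hc.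
Qed.

Lemma dcost_bounded L : exists2 C, 0 <= C & forall X, `|dcost L X| <= C * `|X|.
Proof.
have [r [C [c [rho [C0 c0 HC Hc Hrho]]]]] := act_bounds L.
have [T T0 HT] := bounded_family rho pf_c.
exists (C * (m%:R * (T * c))) => [|X]; first by rewrite !mulr_ge0.
rewrite (_ : _ * `|X| = C * (m%:R * (T * (c * `|X|)))); last by ring.
apply: HC => [|x xr]; first exact: dcost_integrand_continuous.
rewrite norm_sum_ord_le// => i; rewrite normrM ler_pM//.
  by apply: HT; have [] := Hrho 0 x xr; rewrite ?normr0.
by rewrite (le_trans (mx_entry_le _ _ _))// Hc.
Qed.

Lemma d2cost_bounded L : exists2 C, 0 <= C & forall X Y, `|d2cost L X Y| <= C * `|X| * `|Y|.
Proof.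
have [r [C [c [rho [C0 c0 HC Hc Hrho]]]]] := act_bounds L.
have [T T0 HT] := bounded_family rho (fun ik : 'I_m * 'I_m => @ppf_c ik.1 ik.2).
exists (C * (m%:R * (m%:R * (T * c * c)))) => [|X Y]; first by rewrite !mulr_ge0.
rewrite (_ : _ * `|X| * _ = C * (m%:R * (m%:R * (T * (c * `|X|) * (c * `|Y|))))); last by ring.
apply: HC => [|x xr]; first exact: d2cost_integrand_continuous.
rewrite norm_sum_ord_le// => i; rewrite norm_sum_ord_le// => k; rewrite !normrM ler_pM//.
  rewrite ler_pM//; last by rewrite (le_trans (mx_entry_le _ _ _))// Hc.
  by apply: (HT (i, k)); have [] := Hrho 0 x xr; rewrite ?normr0.
by rewrite (le_trans (mx_entry_le _ _ _))// Hc.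
Qed.

End CostExpansion.
End Functional.


(** * Integration against a compactly supported weight is a bounded functional *)

Section Integral.
Variable R : realType.

Definition supported n (r : R) (k : 'cV[R]_n -> R) : Prop :=
  continuous k /\ forall x, r < `|x| -> k x = 0.

Lemma supported_comb n r (k1 k2 : 'cV[R]_n -> R) a : supported r k1 -> supported r k2 ->
  supported r (fun x => k1 x + a * k2 x).
Proof.
move=> [c1 s1] [c2 s2]; split=> [x|x xr]; last by rewrite s1// s2// mulr0 addr0.
by apply: (@continuousD R R^o _ _ (fun x => a * k2 x) x); [exact: c1|apply: continuousMR => //; exact: cst_continuous].
Qed.

Lemma norm_col_mx m n (x : 'cV[R]_m) (y : 'cV[R]_n) e :
  `|x| <= e -> `|y| <= e -> `|col_mx x y| <= e.
Proof.
move=> xe ye; apply: mx_norm_leP => [|i j]; first exact: le_trans xe.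
by case: (split_ordP i) => k ->; rewrite ?col_mxEu ?col_mxEd (le_trans (mx_entry_le _ _ _)).
Qed.

Lemma norm_col_mxr m n (x : 'cV[R]_m) (y : 'cV[R]_n) : `|y| <= `|col_mx x y|.
Proof.
by apply: mx_norm_leP => // i j; rewrite -(col_mxEd x) mx_entry_le.
Qed.

Lemma norm_col_mxl m n (x : 'cV[R]_m) (y : 'cV[R]_n) : `|x| <= `|col_mx x y|.
Proof.
by apply: mx_norm_leP => // i j; rewrite -(col_mxEu x y) mx_entry_le.
Qed.

Definition slice n (k : 'cV[R]_(1 + n) -> R) (s : R) : 'cV[R]_n -> R :=
  fun y => k (col_mx (s%:M : 'cV[R]_1) y).

Lemma supported_slice n r (k : 'cV[R]_(1 + n) -> R) s : supported r k -> supported r (slice k s).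
Proof.
move=> [kc ks]; split=> [y|y yr]; last first.
  by apply: ks; exact: lt_le_trans (norm_col_mxr _ _).
apply: (@continuous_comp _ _ _ (col_mx (s%:M : 'cV[R]_1)) k); last exact: kc.
apply: (@lipschitz_continuous_all _ _ _ _ 1) => a b.
by rewrite opp_col_mx add_col_mx subrr mul1r norm_col_mx// normr0.
Qed.

Lemma norm_scalar11 (s : R) : `|s%:M : 'cV[R]_1| = `|s|.
Proof.
apply/le_anti; rewrite norm_scalar_mx/=.
by have := mx_entry_le (s%:M : 'cV[R]_1) 0 0; rewrite mxE eqxx mulr1n.
Qed.

Lemma slice_out n r (k : 'cV[R]_(1 + n) -> R) s : supported r k -> r < `|s| -> slice k s = fun=> 0.
Proof.
move=> [_ ks] rs; apply/funext => y; apply: ks; apply: lt_le_trans (norm_col_mxl _ _).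
by rewrite norm_scalar11.
Qed.

(** Continuity is uniform along the compact ball that carries the support. *)
Lemma slice_unif n r (k : 'cV[R]_(1 + n) -> R) s0 e : supported r k -> 0 < e ->
  \forall s \near s0, forall y, `|slice k s y - slice k s0 y| <= e.
Proof.
move=> kS e0; have [kc ks] := kS.
have /compact_near_coveringP cov := @compact_ball_cV R n r.
have : \forall s \near s0, [set y : 'cV[R]_n | `|y| <= r] `<=`
    (fun y => `|slice k s y - slice k s0 y| <= e).
  apply: (cov R (nbhs s0) (fun s y => `|slice k s y - slice k s0 y| <= e)) => y0 _.
  have /continuous_epsP/(_ (e / 2))[|d d0 hd] := kc (col_mx (s0%:M : 'cV[R]_1) y0).
    by rewrite divr_gt0.
  exists (ball y0 d, ball s0 d) => /=.
    by split; apply: nbhsx_ballx.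
  move=> [y s] /= []; rewrite -!ball_normE /ball_/= => yd sd.
  have close s' : `|s0 - s'| < d -> `|slice k s' y - slice k s0 y0| <= e / 2.
    move=> sd'; apply: hd; rewrite opp_col_mx add_col_mx.
    have dm : 0 < d by [].
    rewrite (@le_lt_trans _ _ (Num.max `|s0 - s'| `|y0 - y|)) ?gt_max ?sd'//.
    apply: norm_col_mx; last by rewrite distrC le_max lexx orbT.
    have -> : s'%:M - s0%:M = (s' - s0)%:M :> 'cV[R]_1 by rewrite raddfB.
    by rewrite norm_scalar11 distrC le_max lexx.
  have h1 := close s sd; have := close s0; rewrite subrr normr0 => /(_ d0) h2.
  have -> : slice k s y - slice k s0 y = (slice k s y - slice k s0 y0) - (slice k s0 y - slice k s0 y0).
    by move: (slice k s y) (slice k s0 y) (slice k s0 y0) => *; ring.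
  by rewrite (le_trans (ler_normB _ _))//; lra.
apply: filterS => s hs y; have [yr|yr] := leP `|y| r; first exact: hs.
by have [_ s1] := supported_slice s kS; have [_ s2] := supported_slice s0 kS;
  rewrite s1// s2// subrr normr0 ltW.
Qed.

Lemma integral_supported (J : R -> R) (r b : R) : 0 <= r -> continuous J ->
  (forall s, r < `|s| -> J s = 0) ->
  (@lebesgue_measure R).-integrable setT (EFin \o J) /\
  (0 <= b -> (forall s, `|J s| <= b) -> `|\int[lebesgue_measure]_(s in [set: R]) J s| <= 2 * r * b).
Proof.
move=> r0 Jc J0; set mu := @lebesgue_measure R.
pose D : set R := `[- r, r]%classic.
have JD : J \_ D = J.
  apply/funext => s; rewrite patchE; case: ifPn => //; rewrite notin_setE /D/= in_itv/= => sr.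
  by rewrite J0// ltNge ler_norml; apply/negP.
have iD : mu.-integrable D (EFin \o J).
  by apply: continuous_compact_integrable; [exact: segment_compact|exact: continuous_subspaceT].
have mD : measurable (D : set (measurableTypeR R)) by exact: measurable_itv.
split.
  by have := iffLR (@integrable_mkcond _ (measurableTypeR R) R mu D (EFin \o J) mD) iD; rewrite restrict_EFin JD.
move=> b0 Jb; rewrite -JD -Rintegral_mkcond.
rewrite (le_trans (le_normr_Rintegral mD iD))//.
apply: (@le_trans _ _ (\int[mu]_(x in D) b)).
  apply: le_Rintegral => //; first exact: (integrable_norm iD).
  by apply: continuous_compact_integrable; [exact: segment_compact|exact/continuous_subspaceT/cst_continuous].
rewrite Rintegral_cst//.
apply: (@le_trans _ _ (b * fine (@lebesgue_measure R `[- r, r]%classic))); first exact: lexx.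
rewrite lebesgue_measure_itv /= lte_fin.
case: ifPn => [_|_] /=; first by rewrite opprK mulrC ler_wpM2r//; lra.
by rewrite mulr0 !mulr_ge0.
Qed.

(** By induction on the dimension: the inner integral is a continuous
    function of the outer variable, because the slices vary uniformly, and it
    is supported in the same interval, so that the outer Lebesgue integral is
    finite and linear. *)
Lemma integral_Rn_supported n (r : R) : 0 <= r ->
  (forall (k1 k2 : 'cV[R]_n -> R) a, supported r k1 -> supported r k2 ->
     integral_Rn (fun x => k1 x + a * k2 x) = integral_Rn k1 + a * integral_Rn k2) /\
  (forall (k : 'cV[R]_n -> R) b, supported r k -> 0 <= b -> (forall x, `|k x| <= b) ->
     `|integral_Rn k| <= (2 * r) ^+ n * b).
Proof.
move=> r0; elim: n => [|n [lin bnd]].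
  by split=> [//|k b _ b0 kb]; rewrite expr0 mul1r; exact: kb.
have int0 : @integral_Rn R n (fun=> 0) = 0.
  move: lin => /(_ (fun=> 0) (fun=> 0) (-1)).
  rewrite (_ : (fun=> 0 + -1 * 0) = (fun=> 0)); last by apply/funext => x; rewrite mulr0 addr0.
  have s0 : @supported n r (fun=> 0) by split=> //; exact: cst_continuous.
  by move=> -> //; rewrite mulN1r subrr.
pose J (k : 'cV[R]_n.+1 -> R) s := integral_Rn (slice k s).
have Jc (k : 'cV[R]_n.+1 -> R) : supported r k -> continuous (J k).
  move=> ks s0; apply/cvgrPdist_le => e e0.
  pose e' := e / ((2 * r) ^+ n + 1).
  have pos : 0 <= (2 * r) ^+ n by rewrite exprn_ge0// mulr_ge0.
  have e'0 : 0 < e' by rewrite divr_gt0// ltr_wpDl.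
  have := slice_unif s0 ks e'0; apply: filterS => s hs.
  have -> : J k s0 - J k s = integral_Rn (fun y => slice k s0 y + (-1) * slice k s y).
    by rewrite lin ?mulN1r//; exact: supported_slice.
  rewrite (le_trans (bnd _ e' _ _ _))// ?ltW//.
    by apply: supported_comb; exact: supported_slice.
    by move=> y; rewrite mulN1r distrC.
  by rewrite /e' mulrCA gtr_pMr// ltr_pdivrMr ?ltr_wpDl// mul1r ltrDl.
have J0 (k : 'cV[R]_n.+1 -> R) s : supported r k -> r < `|s| -> J k s = 0.
  by move=> ks rs; rewrite /J (slice_out ks rs).
split=> [k1 k2 a s1 s2|k b ks b0 kb].
  have [i1 _] := integral_supported 0 r0 (Jc _ s1) (fun s => @J0 _ s s1).
  have [i2 _] := integral_supported 0 r0 (Jc _ s2) (fun s => @J0 _ s s2).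
  have i2' : (@lebesgue_measure R).-integrable setT (EFin \o (fun s => a * J k2 s)).
    have [||//] := @integral_supported (fun s => a * J k2 s) r 0 r0.
      by apply: continuousMR; [exact: cst_continuous|exact: Jc].
    by move=> s rs; rewrite J0// mulr0.
  rewrite /= -(RintegralZl a measurableT i2) -(RintegralD measurableT i1 i2').
  apply: eq_Rintegral => s _.
  by rewrite -lin//; exact: supported_slice.
have [_] := @integral_supported (J k) r ((2 * r) ^+ n * b) r0 (Jc _ ks) (fun s => @J0 _ s ks).
move=> h; rewrite exprS -mulrA; apply: h; first by rewrite mulr_ge0// exprn_ge0// mulr_ge0.
move=> s; apply: bnd => //; first exact: supported_slice.
by move=> y; exact: kb.
Qed.

Lemma expect_int_bounded m (g : 'cV[R]_m -> R) : continuous g -> compactly_supported g ->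
  bounded_functional (expect_int g).
Proof.
move=> gc gs.
have [r r0 gr] : exists2 r, 0 <= r & forall x, r < `|x| -> g x = 0.
  have /compact_bounded[N [_ hN]] := gs; exists (`|N| + 1) => [|x xr]; first by rewrite addr_ge0.
  apply/eqP; apply: contraTT xr => gx; rewrite -leNgt.
  apply: (hN (`|N| + 1)); first by rewrite (le_lt_trans (ler_norm _))// ltrDl.
  exact: subset_closure.
have sup h : continuous h -> supported r (fun x => g x * h x).
  by move=> hc; split=> [|x xr]; [exact: continuousMR|rewrite gr ?mul0r].
have [lin bnd] := @integral_Rn_supported m r r0.
split=> [h1 h2 a c1 c2|].
  rewrite /expect_int -lin; [|exact: sup..]; congr integral_Rn; apply/funext => x; ring.
have [B B0 gB] := continuous_bounded_ball r gc.
exists r, ((2 * r) ^+ m * B); split=> [|h b hc hb].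
  by rewrite mulr_ge0// exprn_ge0// mulr_ge0.
have b0 : 0 <= b by apply: (le_trans (normr_ge0 (h 0))); apply: hb; rewrite normr0.
rewrite -mulrA; apply: bnd; [exact: sup|exact: mulr_ge0|] => x.
have [xr|xr] := leP `|x| r; last by rewrite gr// mul0r normr0 mulr_ge0.
by rewrite normrM ler_pM// ?gB ?hb.
Qed.

Lemma expect_sample_bounded m N (g : 'cV[R]_m -> R) (xs : 'I_N -> 'cV[R]_m) :
  bounded_functional (expect_sample g xs).
Proof.
split=> [h1 h2 a _ _|].
  rewrite /expect_sample mulrCA -mulrDr; congr (_ * _).
  by rewrite mulr_sumr -big_split; apply: eq_bigr => i _ /=; ring.
exists (\sum_r `|xs r|), (N%:R^-1 * \sum_r `|g (xs r)|); split=> [|h b _ hb].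
  by rewrite mulr_ge0 ?invr_ge0// sumr_ge0.
rewrite normrM ger0_norm ?invr_ge0// -mulrA ler_wpM2l ?invr_ge0//.
rewrite (le_trans (ler_norm_sum _ _ _))// mulr_suml ler_sum// => i _.
rewrite normrM ler_wpM2l// hb// (bigD1 i)//= lerDl sumr_ge0//.
Qed.

End Integral.


(** * The linear systems as conditions on a residual matrix *)

Section Residual.
Variables (R : realType) (n : nat).
Local Notation p := n.+1.
Variables (a : 'I_p -> R) (b : 'I_p -> 'I_p -> R) (c : 'I_p -> 'I_p -> 'I_p -> R)
  (d : 'I_p -> 'I_p -> 'I_p -> 'I_p -> R) (e : 'I_p -> 'I_p -> R).
Variables (O : 'M[R]_p) (v : 'cV[R]_p).

(** The coefficients of Y = (Y_ij, y_i) in the left-hand side of the Newton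
    equation for the increment (O, v), tested against Y. *)
Definition residual_linear (i j : 'I_p) : R :=
  2^-1 * (\sum_k b i k * O j k) + 2^-1 * (\sum_k b k j * O k i)
  + \sum_k \sum_l d j l k i * O k l + \sum_k c j k i * v k 0 + b i j.

Definition residual_translation (i : 'I_p) : R :=
  \sum_k \sum_l c l k i * O k l + \sum_k e i k * v k 0 + a i.

Lemma eq_iff_eq_sub (x y z t : R) : x - y = z - t -> (x = y <-> z = t).
Proof.
move=> h; split=> /eqP; first by rewrite -subr_eq0 h subr_eq0 => /eqP.
by rewrite -subr_eq0 -h subr_eq0 => /eqP.
Qed.

(** For skew O only the entries below the diagonal are independent; each
    collects the coefficients of both of its occurrences. *)
Lemma skew_sum (X : 'I_p -> 'I_p -> R) : O^T = - O ->
  \sum_k \sum_l X k l * O k l = \sum_(k < p) \sum_(l < p | (l < k)%N) (X k l - X l k) * O k l.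
Proof.
move=> /matrixP Os.
have Okl k l : O k l = - O l k by have := Os l k; rewrite !mxE.
have Okk k : O k k = 0 by have := Okl k k; lra.
transitivity (\sum_(k < p) \sum_(l < p | (l < k)%N) X k l * O k l +
  \sum_(k < p) \sum_(l < p | (k < l)%N) X k l * O k l).
  rewrite -big_split; apply: eq_bigr => k _ /=.
  rewrite (bigD1 k)//= Okk mulr0 add0r (bigID (fun l : 'I_p => (l < k)%N))/=.
  congr (_ + _); apply: eq_bigl => l.
    by case: eqVneq => [->|//]; rewrite ltnn.
  by rewrite -leqNgt [RHS]ltn_neqAle eq_sym.
rewrite [X in _ + X](exchange_big_dep predT) //= -big_split; apply: eq_bigr => k _ /=.
rewrite -big_split; apply: eq_bigr => l _ /=.
by rewrite (Okl l k); ring.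
Qed.

Lemma skew_sum_col (B : 'I_p -> R) (j : 'I_p) : O^T = - O ->
  \sum_(k < p | (j < k)%N) B k * O k j - \sum_(k < p | (k < j)%N) B k * O j k = \sum_k B k * O k j.
Proof.
move=> /matrixP Os.
have Okl k l : O k l = - O l k by have := Os l k; rewrite !mxE.
have Okk k : O k k = 0 by have := Okl k k; lra.
rewrite [RHS](bigD1 j)//= Okk mulr0 add0r [RHS](bigID (fun k : 'I_p => (j < k)%N))/=.
congr (_ + _); first by apply: eq_bigl => k; case: eqVneq => [->|//]; rewrite ltnn.
rewrite -sumrN; apply: eq_big => [k|k _]; last by rewrite (Okl k j); ring.
by rewrite -leqNgt [LHS]ltn_neqAle.
Qed.

(** The unknowns below the diagonal determine a skew matrix, and the equation
    for i < j is the difference of the residuals at (j, i) and (i, j). *)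
Lemma SE_systemP : O^T = - O -> SE_system a b c d e O v <->
  (forall i, residual_translation i = 0) /\ (forall i j, residual_linear i j = residual_linear j i).
Proof.
move=> Os.
have trans i : (\sum_(k < p) \sum_(l < p | (l < k)%N) (c l k i - c k l i) * O k l
    + \sum_(k < p) e i k * v k 0 = - a i) <-> residual_translation i = 0.
  by rewrite /residual_translation (skew_sum (fun k l => c l k i))//; split=> h; lra.
have Okl k l : O k l = - O l k by have /matrixP/(_ l k) := Os; rewrite !mxE.
have lin (i j : 'I_p) : (2^-1 * (\sum_(k < p | (j < k)%N) (b i k + b k i) * O k j)
    - 2^-1 * (\sum_(k < p | (k < j)%N) (b i k + b k i) * O j k)
    - 2^-1 * (\sum_(k < p | (i < k)%N) (b j k + b k j) * O k i)
    + 2^-1 * (\sum_(k < p | (k < i)%N) (b j k + b k j) * O i k)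
    + \sum_(k < p) \sum_(l < p | (l < k)%N)
        (d j k l i - d j l k i + d i l k j - d i k l j) * O k l
    - \sum_(k < p) (c j k i - c i k j) * v k 0
    = b i j - b j i) <-> residual_linear i j = residual_linear j i.
  have h1 := skew_sum_col (fun k => b i k + b k i) j Os.
  have h2 := skew_sum_col (fun k => b j k + b k j) i Os.
  have h3 : \sum_(k < p) \sum_(l < p | (l < k)%N)
        (d j k l i - d j l k i + d i l k j - d i k l j) * O k l =
      \sum_k \sum_l d i l k j * O k l - \sum_k \sum_l d j l k i * O k l.
    have := skew_sum (fun k l => d i l k j - d j l k i) Os => /esym h.
    transitivity (\sum_k \sum_l (d i l k j - d j l k i) * O k l).
      rewrite -h; apply: eq_bigr => k _; apply: eq_bigr => l _; ring.
    rewrite -sumrB; apply: eq_bigr => k _; rewrite -sumrB; apply: eq_bigr => l _; ring.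
  have h4 : \sum_(k < p) (c j k i - c i k j) * v k 0 =
     \sum_k c j k i * v k 0 - \sum_k c i k j * v k 0.
    by rewrite -sumrB; apply: eq_bigr => k _; ring.
  have h5 : \sum_k (b i k + b k i) * O k j = - \sum_k b i k * O j k + \sum_k b k i * O k j.
    by rewrite -sumrN -big_split; apply: eq_bigr => k _ /=; rewrite (Okl j k); ring.
  have h6 : \sum_k (b j k + b k j) * O k i = - \sum_k b j k * O i k + \sum_k b k j * O k i.
    by rewrite -sumrN -big_split; apply: eq_bigr => k _ /=; rewrite (Okl i k); ring.
  rewrite h3 h4 /residual_linear; rewrite h5 in h1; rewrite h6 in h2.
  by split=> h; lra.
split=> [[h1 h2]|[h1 h2]].
  split=> [i|i j]; first by apply/trans; exact: h1.
  case: (ltngtP i j) => [ij|ji|/val_inj ->//]; first by apply/lin; exact: h2.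
  by apply/esym/lin; exact: h2.
split=> [i|i j ij]; first by apply/trans; exact: h1.
by apply/lin; exact: h2.
Qed.

(** The systems leave out the corner unknown, which the trace condition
    determines. *)
Lemma sum_not_corner (X : 'I_p -> 'I_p -> R) (o : 'I_p) :
  \sum_(k < p) \sum_(l < p | (k, l) != (o, o)) X k l * O k l = \sum_k \sum_l X k l * O k l - X o o * O o o.
Proof.
apply/eqP; rewrite eq_sym subr_eq eq_sym; apply/eqP.
rewrite (bigD1 o)//= [RHS](bigD1 o)//= addrAC; congr (_ + _).
  rewrite [RHS](bigD1 o)//= addrC; congr (_ + _); apply: eq_bigl => l.
  by rewrite xpair_eqE eqxx.
by apply: eq_bigr => k ko; apply: eq_bigl => l; rewrite xpair_eqE (negbTE ko).
Qed.

(** A matrix is orthogonal to sl(n) exactly when it is scalar. The equations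
    off the diagonal and those for i = j different from n say that the
    residual is scalar; the diagonal equation left out follows from the
    others. *)
Lemma SA_systemP : (forall i j k, c i j k = c i k j) -> (forall i j k l, d i j k l = d j i k l) -> \tr O = 0 -> SA_system a b c d e O v <->
  (forall i, residual_translation i = 0) /\
  (forall i j, residual_linear i j = (if i == j then p%:R^-1 * \sum_m residual_linear m m else 0)).
Proof.
move=> csym dsym Otr; pose o : 'I_p := ord_max.
have S0 : \sum_(k < p | k != o) O k k = - O o o.
  by move: Otr; rewrite /mxtrace (bigD1 o)//= => h; lra.
have skip (B : 'I_p -> R) (Q : 'I_p -> R) : \sum_(k < p | k != o) B k * Q k = \sum_k B k * Q k - B o * Q o.
  by rewrite [in RHS](bigD1 o)//=; ring.
have trans i : (\sum_(k < p) \sum_(l < p | k != l) c l k i * O k l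
        + \sum_(k < p | k != o) (c k k i - c o o i) * O k k
        + \sum_(k < p) e i k * v k 0 = - a i) <-> residual_translation i = 0.
  have -> : \sum_(k < p | k != o) (c k k i - c o o i) * O k k = \sum_k c k k i * O k k.
    transitivity (\sum_(k < p | k != o) c k k i * O k k - c o o i * \sum_(k < p | k != o) O k k).
      by rewrite mulr_sumr -sumrB; apply: eq_bigr => k _; ring.
    by rewrite S0 skip; ring.
  have h : \sum_k \sum_l c l k i * O k l =
     \sum_(k < p) \sum_(l < p | k != l) c l k i * O k l + \sum_k c k k i * O k k.
    rewrite -big_split; apply: eq_bigr => k _ /=; rewrite (bigD1 k)//= addrC; congr (_ + _).
    by apply: eq_bigl => l; rewrite eq_sym.
  by rewrite /residual_translation h; split=> H; lra.
have off i j : i != o -> j != o -> (2^-1 * (\sum_(k < p) b i k * O j k)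
        + 2^-1 * (\sum_(k < p) b k j * O k i)
        + \sum_(k < p) \sum_(l < p | (k, l) != (o, o)) d j l k i * O k l
        - d j o o i * \sum_(k < p | k != o) O k k
        + \sum_(k < p) c j k i * v k 0
        = - b i j) <-> residual_linear i j = 0.
  move=> _ _; rewrite (sum_not_corner (fun k l => d j l k i)) S0 /residual_linear.
  by split=> h; lra.
have row j : (2^-1 * (\sum_(k < p) b o k * O j k)
        + 2^-1 * (\sum_(k < p | k != o) b k j * O k o)
        + \sum_(k < p) \sum_(l < p | (k, l) != (o, o)) d j l k o * O k l
        - (d j o o o + 2^-1 * b o j) * \sum_(k < p | k != o) O k k
        + \sum_(k < p) c j k o * v k 0
        = - b o j) <-> residual_linear o j = 0.
  rewrite (sum_not_corner (fun k l => d j l k o)) S0 /residual_linear (skip (fun k => b k j) (fun k => O k o)).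
  by split=> h; lra.
have col i : (2^-1 * (\sum_(k < p | k != o) b i k * O o k)
        + 2^-1 * (\sum_(k < p) b k o * O k i)
        + \sum_(k < p) \sum_(l < p | (k, l) != (o, o)) d o l k i * O k l
        - (d o o o i + 2^-1 * b i o) * \sum_(k < p | k != o) O k k
        + \sum_(k < p) c o k i * v k 0
        = - b i o) <-> residual_linear i o = 0.
  rewrite (sum_not_corner (fun k l => d o l k i)) S0 /residual_linear (skip (fun k => b i k) (fun k => O o k)).
  by split=> h; lra.
have diag i : (2^-1 * (\sum_(k < p) b i k * O i k)
        + 2^-1 * (\sum_(k < p) b k i * O k i)
        + \sum_(k < p) \sum_(l < p | (k, l) != (o, o))
            (d i l k i - p%:R^-1 * (b k l + \sum_(m < p) d l m k m)) * O k l
        - (d i o o i - p%:R^-1 * (b o o + \sum_(m < p) d o m o m))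
            * \sum_(k < p | k != o) O k k
        + \sum_(k < p) (c i k i - p%:R^-1 * \sum_(l < p) c l l k) * v k 0
        = - b i i + p%:R^-1 * \sum_(k < p) b k k) <->
   residual_linear i i = p%:R^-1 * \sum_m residual_linear m m.
  rewrite (sum_not_corner (fun k l => d i l k i - p%:R^-1 * (b k l + \sum_(m < p) d l m k m))) S0.
  have -> : \sum_m residual_linear m m = \sum_k \sum_l (b k l + \sum_m d l m k m) * O k l
      + \sum_k (\sum_l c l l k) * v k 0 + \sum_k b k k.
    rewrite /residual_linear !big_split /= -!mulr_sumr; congr (_ + _ + _).
      have -> : \sum_i0 \sum_k b k i0 * O k i0 = \sum_i0 \sum_k b i0 k * O i0 k.
        by rewrite exchange_big.
      have -> : \sum_m \sum_k \sum_l d m l k m * O k l = \sum_k \sum_l (\sum_m d l m k m) * O k l.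
        rewrite exchange_big /=; apply: eq_bigr => k _; rewrite exchange_big /=; apply: eq_bigr => l _.
        by rewrite mulr_suml; apply: eq_bigr => m _; rewrite dsym.
      rewrite -mulrDl -[2^-1]div1r -splitr mul1r -big_split; apply: eq_bigr => k _ /=.
      by rewrite -big_split; apply: eq_bigr => l _ /=; rewrite mulrDl.
    rewrite exchange_big /=; apply: eq_bigr => k _; rewrite mulr_suml.
    by apply: eq_bigr => l _; rewrite csym.
  have -> : \sum_k \sum_l (d i l k i - p%:R^-1 * (b k l + \sum_m d l m k m)) * O k l =
     \sum_k \sum_l d i l k i * O k l - p%:R^-1 * \sum_k \sum_l (b k l + \sum_m d l m k m) * O k l.
    rewrite mulr_sumr -sumrB; apply: eq_bigr => k _.
    by rewrite mulr_sumr -sumrB; apply: eq_bigr => l _; ring.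
  have -> : \sum_k (c i k i - p%:R^-1 * \sum_l c l l k) * v k 0 =
     \sum_k c i k i * v k 0 - p%:R^-1 * \sum_k (\sum_l c l l k) * v k 0.
    by rewrite mulr_sumr -sumrB; apply: eq_bigr => k _; ring.
  rewrite /residual_linear.
  by apply: eq_iff_eq_sub; ring.
(* With all other diagonal residuals equal to the mean S / p of the
   residuals, the remaining one is S - (p - 1) S / p. *)
have corner : (forall i, i != o -> residual_linear i i = p%:R^-1 * \sum_m residual_linear m m) ->
    residual_linear o o = p%:R^-1 * \sum_m residual_linear m m.
  move=> h; set S := \sum_m _ in h *.
  have : S = residual_linear o o + \sum_(m < p | m != o) p%:R^-1 * S.
    by rewrite {1}/S (bigD1 o)//=; congr (_ + _); apply: eq_bigr => m mo; exact: h.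
  rewrite sumr_const.
  have -> : #|[pred m : 'I_p | m != o]| = n.
    by have := cardC1 o; rewrite card_ord.
  have pE : p%:R = n%:R + 1 :> R by rewrite -natr1.
  have p0 : p%:R != 0 :> R by rewrite pnatr_eq0.
  have : p%:R * p%:R^-1 = 1 :> R by rewrite divff.
  rewrite {1}pE -[(_ * S) *+ _]mulr_natl.
  move: (p%:R^-1) (n%:R) => q N hN hS.
  have -> : residual_linear o o = S - N * (q * S) by lra.
  have : (N + 1) * q * S = S by rewrite hN mul1r.
  lra.
split=> [[h1 h2 h3 h4 h5]|[h1 h2]].
  split=> [i|i j]; first by apply/trans; exact: h1.
  have hd k : k != o -> residual_linear k k = p%:R^-1 * \sum_m residual_linear m m.
    by move=> ko; apply/diag; apply: h5.
  case: eqVneq => [<-|ij].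
    by case: (eqVneq i o) => [->|io]; [exact: corner|exact: hd].
  case: (eqVneq i o) => [e1|io].
    by rewrite e1; apply/row; apply: h3; apply: contra ij => /eqP ->; rewrite e1.
  case: (eqVneq j o) => [e1|jo].
    by rewrite e1; apply/col; exact: h4.
  by apply/off => //; exact: h2.
split.
- by move=> i; apply/trans; exact: h1.
- by move=> i j io jo ij; apply/off => //; rewrite h2 (negbTE ij).
- by move=> j jo; apply/row; rewrite h2 eq_sym (negbTE jo).
- by move=> i io; apply/col; rewrite h2 (negbTE io).
- by move=> i j <- io; apply/diag; rewrite h2 eqxx.
Qed.

End Residual.


(** * The Newton form and its coefficients *)

Section NewtonForm.
Variables (R : realType) (n : nat) (f : 'cV[R]_n.+1 -> R) (E : ('cV[R]_n.+1 -> R) -> R).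
Local Notation p := n.+1.
Hypotheses (f_C3 : is_Ck 3 setT f) (E_bf : bounded_functional E).
Implicit Types (M X Y : 'M[R]_(p + 1)).

(** The symmetrized second differential of the cost along the directions X M
    and Y M. At a critical point it is the Hessian; near it, the error of
    taking it for the Hessian is of first order in the distance, which a
    Newton step tolerates. *)
Definition newton_form M X Y : R :=
  d2cost f E M (X *m M) (Y *m M) + dcost f E M (jord X Y *m M).

Lemma act_mul (A : 'M[R]_p) t X x :
  act (X *m motion A t) x = linear_part X *m act (motion A t) x + translation_part X.
Proof.
rewrite -{1}[X]submxK /motion mulmx_block !mulmx0 !addr0 mulmx1.
rewrite /act /linear_part /translation_part !block_mxKul !block_mxKur.
by rewrite mulmxDr mulmxA addrA.
Qed.

Lemma act_algmx (A : 'M[R]_p) t (O : 'M[R]_p) v x :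
  act (algmx O v *m motion A t) x = O *m act (motion A t) x + v.
Proof. by rewrite act_mul /linear_part /translation_part block_mxKul block_mxKur. Qed.

(** With w = O z + v and u = O' z, each side is a sum of the terms H (w, u +
    v'), D (u + v') and the two halves of the anticommutator; it remains to
    reorder the sums. *)
Lemma newton_integrand (H : 'I_p -> 'I_p -> R) (D : 'I_p -> R) (z : 'cV[R]_p)
    (O O' : 'M[R]_p) (v v' : 'cV[R]_p) :
  \sum_i \sum_k H k i * (O *m z + v) k 0 * (O' *m z + v') i 0
  + \sum_i D i * ((2^-1 *: (O' *m O + O *m O')) *m z) i 0
  + \sum_i D i * (O' *m z + v') i 0 =
  \sum_i \sum_j O' i j *
    (2^-1 * (\sum_k (z k 0 * D i) * O j k) + 2^-1 * (\sum_k (z j 0 * D k) * O k i)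
     + \sum_k \sum_l (z j 0 * z l 0 * H k i) * O k l + \sum_k (z j 0 * H k i) * v k 0 + z j 0 * D i)
  + \sum_i v' i 0 * (\sum_k \sum_l (z l 0 * H k i) * O k l + \sum_k H k i * v k 0 + D i).
Proof.
pose w := O *m z + v; pose u := O' *m z.
pose X i := \sum_k H k i * w k 0 + D i.
have wE k : w k 0 = \sum_l O k l * z l 0 + v k 0 by rewrite !mxE.
have uE i : u i 0 = \sum_j O' i j * z j 0 by rewrite mxE.
have XE i : \sum_k \sum_l (z l 0 * H k i) * O k l + \sum_k H k i * v k 0 + D i = X i.
  rewrite /X -big_split; congr (_ + _); apply: eq_bigr => k _ /=.
  rewrite wE mulrDr mulr_sumr; congr (_ + _); apply: eq_bigr => l _; ring.
have rE i j : 2^-1 * (\sum_k (z k 0 * D i) * O j k) + 2^-1 * (\sum_k (z j 0 * D k) * O k i)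
     + \sum_k \sum_l (z j 0 * z l 0 * H k i) * O k l + \sum_k (z j 0 * H k i) * v k 0 + z j 0 * D i
   = 2^-1 * D i * (O *m z) j 0 + 2^-1 * z j 0 * (\sum_k D k * O k i) + z j 0 * X i.
  rewrite -XE !mulrDr -!addrA; congr (_ + (_ + _)).
  - by rewrite mxE !mulr_sumr; apply: eq_bigr => k _; ring.
  - by rewrite !mulr_sumr; apply: eq_bigr => k _; ring.
  - rewrite !mulr_sumr; congr (_ + (_ + _)); apply: eq_bigr => k _; last by ring.
    by rewrite mulr_sumr; apply: eq_bigr => l _; ring.
under [X in _ = X + _]eq_bigr => i _ do under eq_bigr => j _ do rewrite rE.
under [X in _ = _ + X]eq_bigr => i _ do rewrite XE.
have e1 : \sum_i \sum_k H k i * (O *m z + v) k 0 * (O' *m z + v') i 0 + \sum_i D i * (O' *m z + v') i 0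
   = \sum_i X i * (u i 0 + v' i 0).
  rewrite -big_split; apply: eq_bigr => i _ /=; rewrite /X mulrDl mulr_suml.
  by rewrite [(O' *m z + v') i 0]mxE.
have e2 : \sum_i D i * ((2^-1 *: (O' *m O + O *m O')) *m z) i 0 =
   \sum_i (2^-1 * D i * (O' *m (O *m z)) i 0) + \sum_i 2^-1 * D i * (O *m u) i 0.
  rewrite -big_split; apply: eq_bigr => i _ /=.
  by rewrite -scalemxAl mulmxDl -!mulmxA [X in D i * X]mxE [X in _ * (_ * X)]mxE -/u; ring.
have e3 : \sum_i 2^-1 * D i * (O *m u) i 0 = \sum_i u i 0 * (2^-1 * \sum_k D k * O k i).
  under eq_bigr => i _ do rewrite mxE mulr_sumr.
  rewrite exchange_big; apply: eq_bigr => i _ /=; rewrite !mulr_sumr.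
  by apply: eq_bigr => k _; ring.
rewrite addrAC e1 e2 e3 -!big_split; apply: eq_bigr => i _ /=.
transitivity (\sum_j O' i j * z j 0 * (X i + 2^-1 * \sum_k D k * O k i)
   + 2^-1 * D i * (\sum_j O' i j * (O *m z) j 0) + v' i 0 * X i).
  by rewrite -mulr_suml -uE [(O' *m (O *m z)) i 0]mxE; ring.
congr (_ + _); rewrite [X in _ + X = _]mulr_sumr -big_split; apply: eq_bigr => j _ /=; ring.
Qed.

Let pf_c i := is_Ck_continuous (is_Ck_partial i f_C3).
Let ppf_c i k := is_Ck_continuous (is_Ck_partial k (is_Ck_partial i f_C3)).

(** Integrating the pointwise identity turns the coefficients of the
    increment into the moments alpha, ..., epsilon. The order of
    differentiation in epsilon is the opposite of the one produced here,
    whence the symmetry of second derivatives. *)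
Lemma newton_formE (A : 'M[R]_p) t (O O' : 'M[R]_p) (v v' : 'cV[R]_p) :
  let M := motion A t in
  newton_form M (algmx O v) (algmx O' v') + dcost f E M (algmx O' v' *m M) =
  \sum_i \sum_j O' i j *
    residual_linear (beta f E M) (gamma f E M) (delta f E M) O v i j
  + \sum_i v' i 0 *
    residual_translation (alpha f E M) (gamma f E M) (epsilon f E M) O v i.
Proof.
move=> M.
pose D i (x : 'cV[R]_p) := partial i f (act M x).
pose H k i (x : 'cV[R]_p) := partial k (partial i f) (act M x).
pose z i (x : 'cV[R]_p) := act M x i 0.
have cD i : continuous (D i) by apply: comp_act_continuous; exact: pf_c.
have cH k i : continuous (H k i) by apply: comp_act_continuous; exact: ppf_c.
have cz i : continuous (z i) by exact: act_coord_continuous.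
have cM (h1 h2 : 'cV[R]_p -> R) : continuous h1 -> continuous h2 -> continuous (fun x => h1 x * h2 x).
  exact: continuousMR.
have cA (h1 h2 : 'cV[R]_p -> R) : continuous h1 -> continuous h2 -> continuous (fun x => h1 x + h2 x).
  by move=> c1 c2 x; apply: (@continuousD R R^o _ h1 h2 x); [exact: c1|exact: c2].
have cC (h : 'cV[R]_p -> R) c : continuous h -> continuous (fun x => h x * c).
  by move=> c1; apply: (cM) => //; exact: cst_continuous.
have cC' (h : 'cV[R]_p -> R) c : continuous h -> continuous (fun x => c * h x).
  by move=> c1; apply: (cM) => //; exact: cst_continuous.
have EZr (h : 'cV[R]_p -> R) c : continuous h -> E (fun x => h x * c) = E h * c.
  move=> hc; rewrite mulrC -(functionalZ E_bf)//; congr E; apply/funext => x; exact: mulrC.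
have ED := functionalD E_bf.
have EZ := functionalZ E_bf.
have ES (F : 'I_p -> 'cV[R]_p -> R) : (forall i, continuous (F i)) ->
    E (fun x => \sum_i F i x) = \sum_i E (F i).
  by move=> h; rewrite (functional_sum E_bf).
have czH j l k i : continuous (fun x => z j x * z l x * H k i x) by apply: (cM) => //; exact: cM.
pose r i j x := 2^-1 * (\sum_k (z k x * D i x) * O j k) + 2^-1 * (\sum_k (z j x * D k x) * O k i)
     + \sum_k \sum_l (z j x * z l x * H k i x) * O k l + \sum_k (z j x * H k i x) * v k 0 + z j x * D i x.
pose s i x := \sum_k \sum_l (z l x * H k i x) * O k l + \sum_k H k i x * v k 0 + D i x.
have c1 i j : continuous (fun x => \sum_k (z k x * D i x) * O j k).
  by apply: continuous_sumR => k; apply: (cC); exact: cM.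
have c2 i j : continuous (fun x => \sum_k (z j x * D k x) * O k i).
  by apply: continuous_sumR => k; apply: (cC); exact: cM.
have c3 i j : continuous (fun x => \sum_k \sum_l (z j x * z l x * H k i x) * O k l).
  by apply: continuous_sumR => k; apply: continuous_sumR => l; apply: (cC); exact: czH.
have c4 i j : continuous (fun x => \sum_k (z j x * H k i x) * v k 0).
  by apply: continuous_sumR => k; apply: (cC); exact: cM.
have c5 i j : continuous (fun x => z j x * D i x) by exact: cM.
have c6 i : continuous (fun x => \sum_k \sum_l (z l x * H k i x) * O k l).
  by apply: continuous_sumR => k; apply: continuous_sumR => l; apply: (cC); exact: cM.
have c7 i : continuous (fun x => \sum_k H k i x * v k 0).
  by apply: continuous_sumR => k; exact: cC.
have cr i j : continuous (r i j).
  by apply: (cA _ _ _ (c5 _ _)); apply: (cA _ _ _ (c4 _ _)); apply: (cA _ _ _ (c3 _ _)); apply: (cA); apply: (cC').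
have cs i : continuous (s i) by apply: (cA _ _ _ (cD _)); exact: cA.
have Er i j : E (r i j) = residual_linear (beta f E M) (gamma f E M) (delta f E M) O v i j.
  rewrite /r ED; [|by apply: (cA _ _ _ (c4 _ _)); apply: (cA _ _ _ (c3 _ _)); apply: (cA); apply: (cC')|exact: c5].
  rewrite ED; [|by apply: (cA _ _ _ (c3 _ _)); apply: (cA); apply: (cC')|exact: c4].
  rewrite ED; [|by apply: (cA); apply: (cC')|exact: c3].
  rewrite ED; [|exact: cC'|exact: cC'].
  rewrite EZ// EZ// /residual_linear; congr (_ * _ + _ * _ + _ + _ + _).
  - by rewrite ES => [|k]; [apply: eq_bigr => k _; rewrite EZr//; exact: cM|apply: (cC); exact: cM].
  - by rewrite ES => [|k]; [apply: eq_bigr => k _; rewrite EZr//; exact: cM|apply: (cC); exact: cM].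
  - rewrite ES => [|k]; last by apply: continuous_sumR => l; apply: (cC); exact: czH.
    apply: eq_bigr => k _; rewrite ES => [|l]; last by apply: (cC); exact: czH.
    by apply: eq_bigr => l _; rewrite EZr//; exact: czH.
  - by rewrite ES => [|k]; [apply: eq_bigr => k _; rewrite EZr//; exact: cM|apply: (cC); exact: cM].
have Es i : E (s i) = residual_translation (alpha f E M) (gamma f E M) (epsilon f E M) O v i.
  rewrite /s ED; [|exact: cA|exact: cD].
  rewrite ED// /residual_translation; congr (_ + _ + _).
  - rewrite ES => [|k]; last by apply: continuous_sumR => l; apply: (cC); exact: cM.
    apply: eq_bigr => k _; rewrite ES => [|l]; last by apply: (cC); exact: cM.
    by apply: eq_bigr => l _; rewrite EZr//; exact: cM.
  - rewrite ES => [|k]; last exact: cC.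
    have epsE k : epsilon f E M i k = E (fun x => H k i x).
      by apply: (f_equal E); apply/funext => x; exact: (partialC i k (act M x) (is_CkW f_C3)).
    by apply: eq_bigr => k _; rewrite (EZr _ _ (cH k i)) epsE.
have R1 : E (fun x => \sum_i \sum_j O' i j * r i j x) = \sum_i \sum_j O' i j *
    residual_linear (beta f E M) (gamma f E M) (delta f E M) O v i j.
  rewrite ES => [|i]; last by apply: continuous_sumR => j; apply: (cC'); exact: cr.
  apply: eq_bigr => i _; rewrite ES => [|j]; last by apply: (cC'); exact: cr.
  by apply: eq_bigr => j _; rewrite (EZ _ _ (cr i j)) Er.
have R2 : E (fun x => \sum_i v' i 0 * s i x) = \sum_i v' i 0 *
    residual_translation (alpha f E M) (gamma f E M) (epsilon f E M) O v i.
  rewrite ES => [|i]; last by apply: (cC'); exact: cs.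
  by apply: eq_bigr => i _; rewrite (EZ _ _ (cs i)) Es.
rewrite -R1 -R2.
rewrite -ED; last 2 first.
- by apply: continuous_sumR => i; apply: continuous_sumR => j; apply: (cC'); exact: cr.
- by apply: continuous_sumR => i; apply: (cC'); exact: cs.
rewrite /newton_form /d2cost /dcost -ED; last 2 first.
- exact: d2cost_integrand_continuous.
- exact: dcost_integrand_continuous.
rewrite -ED; last 2 first.
- by apply: (cA); [exact: d2cost_integrand_continuous|exact: dcost_integrand_continuous].
- exact: dcost_integrand_continuous.
congr E; apply/funext => x.
have aM o w : act (algmx o w *m M) x = o *m act M x + w := act_algmx A t o w x.
rewrite /jord !aM !block_mxKul addr0.
exact: (newton_integrand (fun k i => H k i x) (fun i => D i x)).
Qed.

End NewtonForm.


(** * The linear systems as the Newton equation *)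

Section NewtonSystem.
Variables (R : realType) (n : nat) (G : motion_group).
Variables (f : 'cV[R]_n.+1 -> R) (E : ('cV[R]_n.+1 -> R) -> R).
Local Notation p := n.+1.
Hypotheses (f_C3 : is_Ck 3 setT f) (E_bf : bounded_functional E).

Lemma sum_delta_mx (X : 'I_p -> 'I_p -> R) i j :
  \sum_k \sum_l (delta_mx i j : 'M[R]_p) k l * X k l = X i j.
Proof.
rewrite (bigD1 i)//= (bigD1 j)//= mxE !eqxx mul1r.
rewrite big1 => [|l lj]; last by rewrite mxE (negbTE lj) andbF mul0r.
rewrite addr0 big1 ?addr0// => k ki; rewrite big1// => l _.
by rewrite mxE (negbTE ki) mul0r.
Qed.

Lemma sum_mx_sub (A B : 'M[R]_p) (X : 'I_p -> 'I_p -> R) :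
  \sum_k \sum_l (A - B) k l * X k l = \sum_k \sum_l A k l * X k l - \sum_k \sum_l B k l * X k l.
Proof.
by rewrite -sumrB; apply: eq_bigr => k _; rewrite -sumrB; apply: eq_bigr => l _; rewrite !mxE mulrBl.
Qed.

Lemma sum_scalar_mx (a : R) (X : 'I_p -> 'I_p -> R) :
  \sum_k \sum_l (a%:M : 'M[R]_p) k l * X k l = a * \sum_k X k k.
Proof.
rewrite mulr_sumr; apply: eq_bigr => k _; rewrite (bigD1 k)//= mxE eqxx mulr1n.
by rewrite big1 ?addr0// => l lk; rewrite mxE eq_sym (negbTE lk) mulr0n mul0r.
Qed.

Definition newton_equation M (X : 'M[R]_(p + 1)) : Prop :=
  forall Y, lie G Y -> newton_form f E M X Y + dcost f E M (Y *m M) = 0.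

(** The tested matrices E_ij - E_ji, respectively E_ij and E_ii - 1/n,
    together with the translations e_i span the Lie algebra, so that the
    equations of the system amount to the Newton equation on all of it. *)
Lemma newton_systemP M O v : carrier G M ->
  newton_system G f E M O v <-> lie_algebra G O /\ newton_equation M (algmx O v).
Proof.
move=> /carrierP[A [t [_ ->]]]; set M' := motion A t.
set rho := residual_linear (beta f E M') (gamma f E M') (delta f E M') O v.
set tau := residual_translation (alpha f E M') (gamma f E M') (epsilon f E M') O v.
have form O' v' : newton_form f E M' (algmx O v) (algmx O' v') + dcost f E M' (algmx O' v' *m M') =
    \sum_i \sum_j O' i j * rho i j + \sum_i v' i 0 * tau i.
  exact: newton_formE.
have csym i j k : gamma f E M' i j k = gamma f E M' i k j.
  apply: (f_equal E); apply/funext => x.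
  by apply: (f_equal (fun y => act M' x i 0 * y)); exact: (partialC j k (act M' x) (is_CkW f_C3)).
have dsym i j k l : delta f E M' i j k l = delta f E M' j i k l.
  apply: (f_equal E); apply/funext => x.
  by apply: (f_equal (fun y => y * partial k (partial l f) (act M' x))); exact: mulrC.
have eqv : newton_equation M' (algmx O v) <->
    forall (O' : 'M[R]_p) (v' : 'cV[R]_p), lie_algebra G O' -> \sum_i \sum_j O' i j * rho i j + \sum_i v' i 0 * tau i = 0.
  split=> [h O' v' hO'|h Y /lieP[ O' [v' [hO' ->]]]].
    by rewrite -form; apply: h; exact: lie_algmx.
  by rewrite form; exact: h.
have SEP := @SE_systemP R n (alpha f E M') (beta f E M') (gamma f E M') (delta f E M') (epsilon f E M') O v.
have SAP := @SA_systemP R n (alpha f E M') (beta f E M') (gamma f E M') (delta f E M') (epsilon f E M') O v csym dsym.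
rewrite -/rho -/tau in SEP SAP.
rewrite eqv /newton_system; cbv zeta; clear eqv form.
move: SEP SAP; move: (SE_system _ _ _ _ _ _ _) (SA_system _ _ _ _ _ _ _) => SEs SAs.
move: rho tau; clear => rho tau SEP SAP.
have transl i : (forall (O' : 'M[R]_p) (v' : 'cV[R]_p), lie_algebra G O' -> \sum_i \sum_j O' i j * rho i j + \sum_i v' i 0 * tau i = 0) ->
    tau i = 0.
  move=> /(_ 0 (delta_mx i 0)) => <-; last by case: (G) => /=; rewrite ?trmx0 ?oppr0 ?mxtrace0.
  rewrite big1 => [|k _]; last by rewrite big1// => l _; rewrite mxE mul0r.
  rewrite add0r (bigD1 i)//= mxE !eqxx mul1r big1 ?addr0// => k ki.
  by rewrite mxE (negbTE ki) mul0r.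
have test O' : (forall (O' : 'M[R]_p) (v' : 'cV[R]_p), lie_algebra G O' -> \sum_i \sum_j O' i j * rho i j + \sum_i v' i 0 * tau i = 0) ->
    lie_algebra G O' -> \sum_i \sum_j O' i j * rho i j = 0.
  move=> Z hO'; have := Z O' 0 hO'; rewrite [X in _ + X]big1 ?addr0// => k _.
  by rewrite mxE mul0r.
split=> [[hO sys]|[hO Z]]; split=> //.
  move: hO sys; case: (G) => /= hO.
    move=> /(SEP hO)[h1 h2] O' v' hO'.
    rewrite [X in _ + X]big1 ?addr0 => [|i _]; last by rewrite h1 mulr0.
    set T := \sum_i _; have : T = - T; last by lra.
    rewrite {1}/T exchange_big /= /T -sumrN; apply: eq_bigr => i _.
    rewrite -sumrN; apply: eq_bigr => j _.
    have -> : O' j i = - O' i j by have /matrixP/(_ i j) := hO'; rewrite !mxE.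
    by rewrite mulNr h2.
  move=> /(SAP hO)[h1 h2] O' v' hO'.
  rewrite [X in _ + X]big1 ?addr0 => [|i _]; last by rewrite h1 mulr0.
  set c := p%:R^-1 * \sum_m rho m m in h2.
  transitivity (\tr O' * c); last by rewrite hO' mul0r.
  rewrite mulr_suml; apply: eq_bigr => i _; rewrite (bigD1 i)//= h2 eqxx.
  by rewrite big1 ?addr0// => j ji; rewrite h2 eq_sym (negbTE ji) mulr0.
move: hO transl test Z; case: (G) => /= hO transl test Z.
  apply/(SEP hO); split=> [i|i j]; first exact: transl.
  have := test (delta_mx i j - delta_mx j i) Z.
  rewrite sum_mx_sub !sum_delta_mx => h; apply/eqP; rewrite -subr_eq0; apply/eqP/h.
  by rewrite linearB /= !trmx_delta opprB.
apply/(SAP hO); split=> [i|i j]; first exact: transl.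
case: eqVneq => [<-|ij].
  have := test (delta_mx i i - (p%:R^-1)%:M) Z.
  rewrite sum_mx_sub sum_delta_mx sum_scalar_mx => h; apply/eqP; rewrite -subr_eq0; apply/eqP/h.
  rewrite linearB /= mxtrace_scalar -[_ *+ _]mulr_natr mulVf ?pnatr_eq0//.
  apply/eqP; rewrite subr_eq0; apply/eqP; rewrite /mxtrace (bigD1 i)//= mxE !eqxx big1 ?addr0// => k ki.
  by rewrite mxE (negbTE ki).
have := test (delta_mx i j) Z; rewrite sum_delta_mx; apply.
rewrite /mxtrace big1// => k _; rewrite mxE; case: eqVneq => [->|//].
by rewrite (negbTE ij).
Qed.

End NewtonSystem.


(** * Uniform invertibility near an invertible matrix *)

Section NearUnit.
Variable R : realType.

(** From w = (w H' - w (H' - H)) H^-1, the perturbation is absorbed into the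
    left-hand side when H' is close to H. Stated for several rows w at once,
    so that it applies to matrices. *)
Lemma unitmx_near d (H : 'M[R]_d) : H \in unitmx ->
  exists C r : R, [/\ 0 <= C, 0 < r & forall H' : 'M[R]_d, `|H' - H| <= r ->
    H' \in unitmx /\ forall k (w : 'M[R]_(k, d)), `|w| <= C * `|w *m H'|].
Proof.
move=> Hu; set V := invmx H; pose N : R := d%:R; have N0 : 0 <= N by rewrite ler0n.
have V0 := normr_ge0 V.
(* Then |w (H' - H) V| <= |w| / 2. *)
pose r := (2 * (N * N * `|V| + 1))^-1.
have P0 : 0 <= N * N * `|V| by rewrite !mulr_ge0.
have r0 : 0 < r by rewrite invr_gt0 mulr_gt0//; lra.
have rE : r * (2 * (N * N * `|V| + 1)) = 1 by rewrite mulVf// gt_eqF// mulr_gt0//; lra.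
exists (2 * N * `|V|), r; split=> //; first by rewrite !mulr_ge0.
move=> H' HH.
have bound k (w : 'M[R]_(k, d)) : `|w| <= 2 * N * `|V| * `|w *m H'|.
  have wE : w = (w *m H' - w *m (H' - H)) *m V by rewrite mulmxBr opprB addrCA subrr addr0 mulmxK.
  have h1 : `|w| <= N * (`|w *m H'| + N * `|w| * `|H' - H|) * `|V|.
    rewrite {1}wE (le_trans (mx_normM _ _))// ler_wpM2r// ler_wpM2l//.
    by rewrite (le_trans (ler_normB _ _))// lerD2l mx_normM.
  have w0 := normr_ge0 w.
  have h2 : N * N * `|V| * `|w| * `|H' - H| <= N * N * `|V| * `|w| * r.
    by rewrite ler_wpM2l// mulr_ge0.
  have h3 : N * N * `|V| * r <= 2^-1 by nra.
  have h4 : N * N * `|V| * r * `|w| <= 2^-1 * `|w| by rewrite ler_wpM2r.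
  lra.
split; last exact: bound.
rewrite -row_free_unit -kermx_eq0 -normr_le0.
have := bound _ (kermx H'); rewrite mulmx_ker.
by rewrite normr0 mulr0.
Qed.

Lemma finite_pos_min (I : finType) (r : I -> R) : (forall i, 0 < r i) ->
  exists2 m, 0 < m & forall i, m <= r i.
Proof.
move=> r0; exists (\big[Num.min/1]_i r i); first by apply/bigmin_gtP; split.
by move=> i; apply: bigmin_le_cond.
Qed.

(** Gathers finitely many smallness conditions on a step into one choice. *)
Lemma exists_small (K m : R) : 0 <= K -> 0 < m -> exists s, [/\ 0 < s, s < 1, s < m & s * K < m].
Proof.
move=> K0 m0; pose t := 1 + K + m; have t0 : 0 < t by rewrite /t; lra.
exists (m / t); split.
- by rewrite divr_gt0.
- by rewrite ltr_pdivrMr// /t; lra.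
- by rewrite ltr_pdivrMr// ltr_pMr// /t; lra.
- by rewrite mulrAC ltr_pdivrMr// ltr_pM2l// /t; lra.
Qed.

End NearUnit.

(** * The gradient and the Newton form near a critical point *)

Section Expansions.
Variables (R : realType) (n : nat) (G : motion_group).
Variables (f : 'cV[R]_n.+1 -> R) (E : ('cV[R]_n.+1 -> R) -> R).
Local Notation p := n.+1.
Hypotheses (f_C3 : is_Ck 3 setT f) (E_bf : bounded_functional E).
Implicit Types (L M X Y : 'M[R]_(p + 1)).

Local Notation N := ((p + 1)%:R : R).
Local Notation dc := (dcost f E).
Local Notation d2c := (d2cost f E).

Lemma dcostD M X Y : dc M (X + Y) = dc M X + dc M Y.
Proof. by have := dcost_linear f_C3 E_bf 1 M X Y; rewrite scale1r mul1r. Qed.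
Lemma dcost0 M : dc M 0 = 0.
Proof. by have := dcost_linear f_C3 E_bf (-1) M 0 0; rewrite scaler0 addr0 mulN1r addNr. Qed.
Lemma dcostZ a M X : dc M (a *: X) = a * dc M X.
Proof. by have := dcost_linear f_C3 E_bf a M X 0; rewrite addr0 dcost0 addr0. Qed.
Lemma dcostB M X Y : dc M (X - Y) = dc M X - dc M Y.
Proof. by rewrite dcostD -scaleN1r dcostZ mulN1r. Qed.
Lemma d2costDl M X Y Z : d2c M (X + Y) Z = d2c M X Z + d2c M Y Z.
Proof. by have := d2cost_linearl f_C3 E_bf 1 M X Y Z; rewrite scale1r mul1r. Qed.
Lemma d2costDr M X Y Z : d2c M Z (X + Y) = d2c M Z X + d2c M Z Y.
Proof. by have := d2cost_linearr f_C3 E_bf 1 M X Y Z; rewrite scale1r mul1r. Qed.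

Lemma jord_linear a X Y Z : jord (a *: X + Y) Z = a *: jord X Z + jord Y Z.
Proof.
rewrite /jord /algmx scale_block_mx add_block_mx !scaler0 !addr0.
have -> : ulsubmx (a *: X + Y) = a *: ulsubmx X + ulsubmx Y by apply/matrixP => i j; rewrite !mxE.
congr block_mx; rewrite mulmxDr mulmxDl -scalemxAr -scalemxAl.
move: (_ *m ulsubmx X) (_ *m ulsubmx Y) (ulsubmx X *m _) (ulsubmx Y *m _) => A B C D.
by apply/matrixP => i j; rewrite !mxE; ring.
Qed.

Lemma jordC X Y : jord X Y = jord Y X.
Proof. by rewrite /jord addrC. Qed.

Lemma norm_jord X Y : `|jord X Y| <= N * `|X| * `|Y|.
Proof.
have B0 : 0 <= N * `|X| * `|Y| by rewrite !mulr_ge0.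
apply: norm_block_mx; rewrite ?normr0// normrZ ger0_norm ?invr_ge0//.
have h1 : `|ulsubmx Y *m ulsubmx X| <= N * `|X| * `|Y|.
  rewrite (le_trans (mx_normM _ _))// -!mulrA ler_pM ?mulr_ge0//.
    by rewrite ler_nat leq_addr.
  by rewrite mulrC ler_pM// norm_ulsubmx.
have h2 : `|ulsubmx X *m ulsubmx Y| <= N * `|X| * `|Y|.
  rewrite (le_trans (mx_normM _ _))// -!mulrA ler_pM ?mulr_ge0//.
    by rewrite ler_nat leq_addr.
  by rewrite ler_pM// norm_ulsubmx.
have := ler_normD (ulsubmx Y *m ulsubmx X) (ulsubmx X *m ulsubmx Y); lra.
Qed.

Lemma newton_form_linearl a M X Y Z :
  newton_form f E M (a *: X + Y) Z = a * newton_form f E M X Z + newton_form f E M Y Z.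
Proof.
have e1 : (a *: X + Y) *m M = a *: (X *m M) + Y *m M by rewrite mulmxDl scalemxAl.
have e2 : jord (a *: X + Y) Z *m M = a *: (jord X Z *m M) + jord Y Z *m M.
  by rewrite jord_linear mulmxDl scalemxAl.
rewrite /newton_form e1 e2 (d2cost_linearl f_C3 E_bf) (dcost_linear f_C3 E_bf).
by rewrite mulrDr addrACA.
Qed.

Lemma newton_form_linearr a M X Y Z :
  newton_form f E M Z (a *: X + Y) = a * newton_form f E M Z X + newton_form f E M Z Y.
Proof.
have e1 : (a *: X + Y) *m M = a *: (X *m M) + Y *m M by rewrite mulmxDl scalemxAl.
have e2 : jord Z (a *: X + Y) *m M = a *: (jord Z X *m M) + jord Z Y *m M.
  by rewrite jordC jord_linear mulmxDl scalemxAl (jordC X) (jordC Y).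
rewrite /newton_form e1 e2 (d2cost_linearr f_C3 E_bf) (dcost_linear f_C3 E_bf).
by rewrite mulrDr addrACA.
Qed.

Lemma newton_form_bounded L : exists2 C, 0 <= C & forall X Y,
  `|newton_form f E L X Y| <= C * `|X| * `|Y|.
Proof.
have [C1 C10 H1] := dcost_bounded f_C3 E_bf L.
have [C2 C20 H2] := d2cost_bounded f_C3 E_bf L.
have N0 : 0 <= N by rewrite ler0n.
have l0 := normr_ge0 L.
exists (C2 * (N * `|L|) * (N * `|L|) + C1 * (N * N * `|L|)) => [|X Y].
  by rewrite addr_ge0// !mulr_ge0.
rewrite /newton_form (le_trans (ler_normD _ _))// !mulrDl lerD//.
  rewrite (le_trans (H2 _ _))// (_ : C2 * _ * _ * `|X| * `|Y| = C2 * (N * `|X| * `|L|) * (N * `|Y| * `|L|)); last by ring.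
  by rewrite ler_pM ?mulr_ge0// ?ler_wpM2l// mx_normM.
rewrite (le_trans (H1 _))// (_ : C1 * _ * `|X| * `|Y| = C1 * (N * (N * `|X| * `|Y|) * `|L|)); last by ring.
rewrite ler_wpM2l// (le_trans (mx_normM _ _))// ler_wpM2r// ler_wpM2l//.
exact: norm_jord.
Qed.

(** Replacing M by L in one slot at a time. *)
Lemma newton_form_lipschitz L : exists2 C, 0 <= C & forall M X Y, `|M - L| <= 1 ->
  `|newton_form f E M X Y - newton_form f E L X Y| <= C * `|M - L| * `|X| * `|Y|.
Proof.
have [C1 C10 H1] := dcost_bounded f_C3 E_bf L.
have [C2 C20 H2] := d2cost_bounded f_C3 E_bf L.
have [C3 C30 H3] := dcost_expansion f_C3 E_bf L.
have [C4 C40 H4] := d2cost_lipschitz f_C3 E_bf L.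
have N0 : 0 <= N by rewrite ler0n.
pose l := `|L| + 1; have l0 : 0 <= l by rewrite addr_ge0.
have Ll : `|L| <= l by rewrite lerDl.
exists (C4 * (N * l) * (N * l) + C2 * N * (N * l) + C2 * (N * l) * N
   + (C2 + C3) * (N * N * l) + C1 * (N * N)) => [|M X Y Ml].
  by rewrite !addr_ge0 ?mulr_ge0// addr_ge0.
set D := M - L in Ml *; have ME : M = L + D by rewrite addrC subrK.
have Mle : `|M| <= l by rewrite ME (le_trans (ler_normD _ _))// lerD2l.
set e := `|D| in Ml *; have e0 : 0 <= e by exact: normr_ge0.
set J := jord X Y; set a := `|X|; set b := `|Y|.
have a0 : 0 <= a by exact: normr_ge0.
have b0 : 0 <= b by exact: normr_ge0.
have XM : `|X *m M| <= N * a * l by rewrite (le_trans (mx_normM _ _))// ler_wpM2l ?mulr_ge0.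
have YM : `|Y *m M| <= N * b * l by rewrite (le_trans (mx_normM _ _))// ler_wpM2l ?mulr_ge0.
have XL : `|X *m L| <= N * a * l by rewrite (le_trans (mx_normM _ _))// ler_wpM2l ?mulr_ge0.
have XD : `|X *m D| <= N * a * e by exact: mx_normM.
have YD : `|Y *m D| <= N * b * e by exact: mx_normM.
have Jab : `|J| <= N * a * b by exact: norm_jord.
have JM : `|J *m M| <= N * (N * a * b) * l.
  by rewrite (le_trans (mx_normM _ _))// ler_pM ?mulr_ge0// ler_wpM2l.
have JD : `|J *m D| <= N * (N * a * b) * e.
  by rewrite (le_trans (mx_normM _ _))// ler_wpM2r// ler_wpM2l.
have -> : newton_form f E M X Y - newton_form f E L X Y =
  (d2c M (X *m M) (Y *m M) - d2c L (X *m M) (Y *m M)) + d2c L (X *m D) (Y *m M) + d2c L (X *m L) (Y *m D)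
  + (dc M (J *m M) - dc L (J *m M)) + dc L (J *m D).
  have e1 : d2c L (X *m M) (Y *m M) = d2c L (X *m D) (Y *m M) + d2c L (X *m L) (Y *m D) + d2c L (X *m L) (Y *m L).
    have XE : X *m M = X *m L + X *m D by rewrite {1}ME mulmxDr.
    have YE : Y *m M = Y *m L + Y *m D by rewrite {1}ME mulmxDr.
    rewrite XE d2costDl addrC -addrA; congr (_ + _).
    by rewrite YE d2costDr addrC.
  have e2 : dc L (J *m M) = dc L (J *m D) + dc L (J *m L) by rewrite ME mulmxDr dcostD addrC.
  rewrite /newton_form -/J e1 e2.
  move: (d2c M _ _) (d2c L (X *m D) _) (d2c L (X *m L) (Y *m D)) (d2c L (X *m L) (Y *m L)) (dc M _) (dc L (J *m D)) (dc L (J *m L)) => *.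
  ring.
rewrite !(mulrDl _ _ e) !(mulrDl _ _ a) !(mulrDl _ _ b).
rewrite (le_trans (ler_normD _ _))// lerD//; last first.
  rewrite (le_trans (H1 _))// (_ : _ * a * b = C1 * (N * (N * a * b) * e)) ?ler_wpM2l//; ring.
rewrite (le_trans (ler_normD _ _))// lerD//; last first.
  have -> : dc M (J *m M) - dc L (J *m M) = (dc M (J *m M) - dc L (J *m M) - d2c L D (J *m M)) + d2c L D (J *m M).
    by rewrite subrK.
  have h3 := H3 D (J *m M) Ml; rewrite -ME -/e in h3.
  have h2 := H2 D (J *m M); rewrite -/e in h2.
  rewrite (le_trans (ler_normD _ _))//.
  rewrite (_ : _ * a * b = C3 * e * (N * (N * a * b) * l) + C2 * e * (N * (N * a * b) * l)); last by ring.
  rewrite lerD//; last by rewrite (le_trans h2)// ler_wpM2l ?mulr_ge0.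
  rewrite (le_trans h3)// ler_pM ?mulr_ge0 ?exprn_ge0// ler_wpM2l//.
  by rewrite expr2 ler_piMr.
rewrite (le_trans (ler_normD _ _))// lerD//; last first.
  rewrite (le_trans (H2 _ _))// (_ : _ * a * b = C2 * (N * a * l) * (N * b * e)); last by ring.
  by rewrite ler_pM ?mulr_ge0// ler_wpM2l.
rewrite (le_trans (ler_normD _ _))// lerD//; last first.
  rewrite (le_trans (H2 _ _))// (_ : _ * a * b = C2 * (N * a * e) * (N * b * l)); last by ring.
  by rewrite ler_pM ?mulr_ge0// ler_wpM2l.
have h4 := H4 D (X *m M) (Y *m M) Ml; rewrite -ME -/e in h4.
rewrite (le_trans h4)// (_ : _ * a * b = C4 * e * (N * a * l) * (N * b * l)); last by ring.
by rewrite ler_pM ?mulr_ge0// ler_wpM2l ?mulr_ge0.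
Qed.

Definition critical L : Prop := forall Y, lie G Y -> dc L (Y *m L) = 0.

(** Write M = (1 + xi + O(e^2)) L, with xi in the Lie algebra and e = |M -
    L|. Expanding the gradient tested against Y at M, the zeroth order term
    vanishes by criticality; the first order term is the second differential
    plus the gradient at L along Y xi, and the latter may be symmetrized
    because it differs by the gradient along an element of the Lie algebra. *)
Lemma gradient_expansion L : carrier G L -> critical L -> exists C r : R, [/\ 0 <= C, 0 < r, r <= 1 &
  forall M, carrier G M -> `|M - L| <= r ->
  let K1 := M *m invmx L - 1%:M in let xi := lie_proj G K1 in
  [/\ `|xi| <= C * `|M - L|, `|K1 - xi| <= C * `|M - L| ^+ 2 &
   forall Y, lie G Y -> `|dc M (Y *m M) - newton_form f E L xi Y| <= C * `|M - L| ^+ 2 * `|Y|]].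
Proof.
move=> LG crit; have [Lu LiG] := carrier_inv LG.
have [C1 C10 H1] := @carrier_near1 R n G.
have [C2 C20 H2] := dcost_expansion f_C3 E_bf L.
have [C3 C30 H3] := dcost_bounded f_C3 E_bf L.
have [C4 C40 H4] := d2cost_bounded f_C3 E_bf L.
have N0 : 0 <= N by rewrite ler0n.
pose l := `|L| + 1; have l0 : 0 <= l by rewrite addr_ge0.
have Ll : `|L| <= l by rewrite lerDl.
pose k := N * `|invmx L|; have k0 : 0 <= k by rewrite mulr_ge0.
pose c := C1 * k ^+ 2; have c0 : 0 <= c by rewrite mulr_ge0// exprn_ge0.
pose B1 := C3 * (N * N * l * c); pose B2 := C4 * (N * l * c) * (N * l).
pose B3 := C4 * N; pose B4 := C2 * (N * l).
have B10 : 0 <= B1 by rewrite !mulr_ge0.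
have B20 : 0 <= B2 by rewrite !mulr_ge0.
have B30 : 0 <= B3 by rewrite !mulr_ge0.
have B40 : 0 <= B4 by rewrite !mulr_ge0.
exists (2 * k + c + (B1 + B2 + B3 + B4)), (k + 1)^-1.
have k1 : 0 < k + 1 by rewrite ltr_wpDl.
split; rewrite ?invr_gt0//; first by rewrite !addr_ge0// mulr_ge0.
  by rewrite invf_le1// lerDr.
move=> M MG Mr K1 xi.
set D := M - L in Mr *; set e := `|D| in Mr *.
have e0 : 0 <= e by exact: normr_ge0.
have e1 : e <= 1 by rewrite (le_trans Mr)// invf_le1// lerDr.
have e20 : 0 <= e ^+ 2 by rewrite exprn_ge0.
have K1E : K1 = D *m invmx L by rewrite /D mulmxBl mulmxV.
have K1k : `|K1| <= k * e by rewrite K1E (le_trans (mx_normM _ _))// /k mulrAC.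
have K11 : `|K1| <= 1.
  rewrite (le_trans K1k)// (@le_trans _ _ ((k + 1) * (k + 1)^-1))//; last by rewrite divff// gt_eqF.
  by rewrite ler_pM// lerDl.
set q := K1 - xi.
have qe : `|q| <= c * e ^+ 2.
  rewrite (le_trans (H1 (M *m invmx L) _ K11))//; first exact: carrierM.
  rewrite /c -mulrA -exprMn ler_wpM2l// ler_pXn2r ?nnegrE// mulr_ge0//.
have xik : `|xi| <= 2 * k * e.
  by rewrite (le_trans (norm_lie_proj _ _))// -mulrA ler_wpM2l.
have c2k : 0 <= 2 * k by rewrite mulr_ge0.
have BB : 0 <= B1 + B2 + B3 + B4 by rewrite !addr_ge0.
split.
- by rewrite (le_trans xik)// ler_wpM2r//; lra.
- by rewrite (le_trans qe)// ler_wpM2r//; lra.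
move=> Y YG; set b := `|Y|; have b0 : 0 <= b by exact: normr_ge0.
have xiG : lie G xi by exact: lie_projK.
have ME : M = L + D by rewrite addrC subrK.
have Mle : `|M| <= l by rewrite ME (le_trans (ler_normD _ _))// lerD2l.
have DE : D = K1 *m L by rewrite K1E mulmxKV.
have K1q : K1 = xi + q by rewrite addrC subrK.
have dE : dc L (Y *m M) = dc L (jord xi Y *m L) + dc L (Y *m q *m L).
  rewrite ME mulmxDr dcostD (crit _ YG) add0r DE mulmxA K1q mulmxDr mulmxDl dcostD.
  congr (_ + _); rewrite -[Y *m xi](subrK (jord xi Y)) mulmxDl dcostD.
  by rewrite crit ?add0r//; exact: lie_mul_sub_jord.
have d2E : d2c L D (Y *m M) = d2c L (xi *m L) (Y *m L) + d2c L (q *m L) (Y *m L) + d2c L D (Y *m D).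
  rewrite [in Y *m M]ME mulmxDr d2costDr; congr (_ + _).
  by rewrite DE K1q mulmxDl d2costDl.
have -> : dc M (Y *m M) - newton_form f E L xi Y =
   (dc M (Y *m M) - dc L (Y *m M) - d2c L D (Y *m M)) + d2c L D (Y *m D)
   + d2c L (q *m L) (Y *m L) + dc L (Y *m q *m L).
  rewrite d2E dE /newton_form.
  move: (dc M _) (dc L _) (dc L _) (d2c L _ _) (d2c L _ _) (d2c L _ _) => *; ring.
have qL : `|q *m L| <= N * (c * e ^+ 2) * l.
  by rewrite (le_trans (mx_normM _ _))// ler_pM ?mulr_ge0// ler_wpM2l.
have YL : `|Y *m L| <= N * b * l by rewrite (le_trans (mx_normM _ _))// ler_wpM2l ?mulr_ge0.
have YM : `|Y *m M| <= N * b * l by rewrite (le_trans (mx_normM _ _))// ler_wpM2l ?mulr_ge0.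
have YD : `|Y *m D| <= N * b * e by exact: mx_normM.
have YqL : `|Y *m q *m L| <= N * b * (N * (c * e ^+ 2) * l).
  by rewrite -mulmxA (le_trans (mx_normM _ _))// ler_wpM2l ?mulr_ge0.
have h1 : `|dc L (Y *m q *m L)| <= B1 * e ^+ 2 * b.
  rewrite (le_trans (H3 _))// (_ : _ * b = C3 * (N * b * (N * (c * e ^+ 2) * l))) ?ler_wpM2l//.
  by rewrite /B1; ring.
have h2 : `|d2c L (q *m L) (Y *m L)| <= B2 * e ^+ 2 * b.
  rewrite (le_trans (H4 _ _))// (_ : _ * b = C4 * (N * (c * e ^+ 2) * l) * (N * b * l)); last by rewrite /B2; ring.
  by rewrite ler_pM ?mulr_ge0// ler_wpM2l.
have h3 : `|d2c L D (Y *m D)| <= B3 * e ^+ 2 * b.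
  rewrite (le_trans (H4 _ _))// (_ : _ * b = C4 * e * (N * b * e)); last by rewrite /B3; ring.
  by rewrite ler_wpM2l ?mulr_ge0.
have h4 : `|dc M (Y *m M) - dc L (Y *m M) - d2c L D (Y *m M)| <= B4 * e ^+ 2 * b.
  have := H2 D (Y *m M) e1; rewrite -ME -/e => h; rewrite (le_trans h)//.
  rewrite (_ : B4 * _ * b = C2 * e ^+ 2 * (N * b * l)); last by rewrite /B4; ring.
  by rewrite ler_wpM2l ?mulr_ge0.
apply: (@le_trans _ _ ((B4 + B3 + B2 + B1) * e ^+ 2 * b)); last first.
  by rewrite ler_wpM2r// ler_wpM2r//; lra.
rewrite !mulrDl.
rewrite (le_trans (ler_normD _ _))// lerD// (le_trans (ler_normD _ _))// lerD//.
by rewrite (le_trans (ler_normD _ _))// lerD.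
Qed.

End Expansions.


(** * The differential of a chart *)

Section ChartVelocity.
Variables (R : realType) (n d : nat) (phi : 'cV[R]_d -> 'M[R]_(n.+1 + 1)) (U : set 'cV[R]_d).
Local Notation p := n.+1.
Hypotheses (U_open : open U) (phi_C : forall k i j, is_Ck k U (fun u => phi u i j)).

Definition velocity (j : 'I_d) (u : 'cV[R]_d) : 'M[R]_(p + 1) :=
  \matrix_(a, b) partial j (fun w => phi w a b) u.

Lemma open_ball_in u : U u -> exists2 r, 0 < r & forall w, `|w - u| < r -> U w.
Proof.
move=> Uu; have /nbhs_ballP[r /= r0 hr] : nbhs u U by apply: open_nbhs_nbhs.
by exists r => // w wr; apply: hr; rewrite -ball_normE /ball_/= distrC.
Qed.

Lemma velocity_is_derive j u : U u -> is_derive u (delta_mx j 0) phi (velocity j u).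
Proof.
move=> Uu; apply/is_derive_epsP => e e0.
have entry (ab : 'I_(p + 1) * 'I_(p + 1)) : exists r, 0 < r /\ forall s : R, `|s| < r ->
    `|phi (s *: delta_mx j 0 + u) ab.1 ab.2 - phi u ab.1 ab.2 - s *: velocity j u ab.1 ab.2| <= e * `|s|.
  have dd : derivable (fun w => phi w ab.1 ab.2) u (delta_mx j 0) := is_Ck_derivable Uu (phi_C 1 ab.1 ab.2).
  have /derivableP/is_derive_epsP/(_ e e0)[r r0 hr] := dd.
  by exists r; split=> // s sr; rewrite mxE; exact: hr.
have [r hr] := choice entry.
have [m m0 mr] := finite_pos_min (fun i => (hr i).1).
exists m => // s sm; apply: mx_norm_leP => [|a b]; first by rewrite mulr_ge0// ltW.
have := (hr (a, b)).2 s (lt_le_trans sm (mr _)).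
by rewrite !mxE.
Qed.

Lemma velocity_continuous u e : U u -> 0 < e ->
  exists2 r, 0 < r & forall w j, `|w - u| < r -> `|velocity j w - velocity j u| <= e.
Proof.
move=> Uu e0.
have entry (jab : 'I_d * ('I_(p + 1) * 'I_(p + 1))) : exists r, 0 < r /\ forall w, `|w - u| < r ->
    `|velocity jab.1 w jab.2.1 jab.2.2 - velocity jab.1 u jab.2.1 jab.2.2| <= e.
  have [cc _] := is_Ck_partial jab.1 (phi_C 1 jab.2.1 jab.2.2).
  have /continuous_epsP/(_ e e0)[r r0 hr] := cc u Uu.
  by exists r; split=> // w wr; rewrite !mxE; exact: hr.
have [r hr] := choice entry.
have [m m0 mr] := finite_pos_min (fun i => (hr i).1).
exists m => // w j wm; apply: mx_norm_leP => [|a b]; first by rewrite ltW.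
have := (hr (j, (a, b))).2 w (lt_le_trans wm (mr _)).
by rewrite !mxE.
Qed.

(** Continuity of the partial derivatives gives differentiability in the
    strong sense, entry by entry. *)
Lemma velocity_frechet u e : U u -> 0 < e ->
  exists2 r, 0 < r & forall y, `|y| < r ->
    `|phi (u + y) - phi u - \sum_j y j 0 *: velocity j u| <= e * `|y|.
Proof.
move=> Uu e0; have [r1 r10 h1] := open_ball_in Uu.
pose e' := e / (d%:R + 1); have d1 : 0 < d%:R + 1 :> R by rewrite ltr_wpDl.
have e'0 : 0 < e' by rewrite divr_gt0.
have [r2 r20 h2] := velocity_continuous Uu e'0.
exists (Num.min r1 r2) => [|y]; first by rewrite lt_min r10.
rewrite lt_min => /andP[y1 y2]; apply: mx_norm_leP => [|a b]; first by rewrite mulr_ge0// ltW.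
have [|zeta hz e1] := @mean_value_coord R d (fun w => phi w a b) u y.
  move=> i x xy; apply: (@is_Ck_derivable R 0 d U _ _ _ _ (phi_C 1 a b)).
  by apply: h1; exact: le_lt_trans y1.
rewrite !mxE e1 summxE -sumrB.
rewrite (@le_trans _ _ (d%:R * (e' * `|y|)))//.
  apply: norm_sum_ord_le => i; rewrite !mxE -mulrBr normrM mulrC ler_pM ?mx_entry_le//.
  have := le_trans (mx_entry_le _ a b) (h2 (zeta i) i (le_lt_trans (hz i) y2)).
  by rewrite !mxE.
rewrite mulrA ler_wpM2r// /e' mulrCA ger_pMr// ler_pdivrMr// mul1r lerDl//.
Qed.

Lemma velocity_directional u w : U u -> 'D_w phi u = \sum_j w j 0 *: velocity j u.
Proof.
move=> Uu; suff [_ ->//] : is_derive u w phi (\sum_j w j 0 *: velocity j u).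
apply/is_derive_epsP => e e0.
pose e' := e / (`|w| + 1); have w1 : 0 < `|w| + 1 by rewrite ltr_wpDl.
have [|r r0 hr] := @velocity_frechet u e' Uu; first by rewrite divr_gt0.
exists (r / (`|w| + 1)) => [|s]; first by rewrite divr_gt0.
rewrite ltr_pdivlMr// => sr.
have sw : `|s *: w| < r by rewrite normrZ (le_lt_trans _ sr)// ler_wpM2l// lerDl.
have := hr _ sw; rewrite (addrC u).
have -> : \sum_j (s *: w) j 0 *: velocity j u = s *: \sum_j w j 0 *: velocity j u.
  by rewrite scaler_sumr; apply: eq_bigr => j _; rewrite mxE scalerA.
move=> h; rewrite (le_trans h)// normrZ.
rewrite (_ : e' * _ = e * `|s| * (`|w| / (`|w| + 1))); last by rewrite /e'; ring.
by rewrite ler_piMr ?mulr_ge0 ?(ltW e0)// ler_pdivrMr// mul1r lerDl.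
Qed.

End ChartVelocity.


(** * Linear combinations of independent matrices *)

Section RangeClosed.
Variable R : realType.

Lemma norm_mxvec m n (M : 'M[R]_(m, n)) : `|mxvec M| = `|M|.
Proof.
apply/le_anti/andP; split; apply: mx_norm_leP => // i j.
  by rewrite ord1; case/mxvec_indexP: j => a b; rewrite mxvecE mx_entry_le.
by rewrite -mxvecE mx_entry_le.
Qed.

Variables (d m n : nat) (P : 'I_d -> 'M[R]_(m, n)).
Hypothesis P_inj : forall w : 'cV[R]_d, \sum_j w j 0 *: P j = 0 -> w = 0.

Let Pm : 'M[R]_(d, m * n) := \matrix_(j, k) mxvec (P j) 0 k.

Let PmE (w : 'cV[R]_d) : w^T *m Pm = mxvec (\sum_j w j 0 *: P j).
Proof.
rewrite linear_sum; apply/matrixP => i k; rewrite ord1 mxE summxE; apply: eq_bigr => j _.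
by rewrite linearZ !mxE.
Qed.

Let Pm_free : row_free Pm.
Proof.
rewrite -kermx_eq0; apply/eqP/row_matrixP => i; rewrite row0.
apply: trmx_inj; rewrite trmx0; apply: P_inj.
apply: (can_inj mxvecK); rewrite -PmE trmxK -row_mul mulmx_ker row0.
by rewrite linear0.
Qed.

Lemma combination_bounded_below : exists2 C, 0 < C & forall w : 'cV[R]_d,
  `|w| <= C * `|\sum_j w j 0 *: P j|.
Proof.
exists ((m * n)%:R * `|pinvmx Pm| + 1) => [|w]; first by rewrite ltr_wpDl.
have wE : w^T = w^T *m Pm *m pinvmx Pm by rewrite -mulmxA mulmxVp// mulmx1.
rewrite -mx_norm_tr {1}wE PmE (le_trans (mx_normM _ _))// norm_mxvec.
by rewrite mulrDl mul1r mulrAC lerDl.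
Qed.

(** The range is the fixed space of the linear map Q, obtained from a right
    inverse of the coordinate matrix, hence it contains its limits. *)
Lemma combination_closed X : (forall e, 0 < e -> exists w : 'cV[R]_d, `|X - \sum_j w j 0 *: P j| <= e) ->
  exists w : 'cV[R]_d, X = \sum_j w j 0 *: P j.
Proof.
move=> h; pose Q := pinvmx Pm *m Pm.
have QE (w : 'cV[R]_d) : mxvec (\sum_j w j 0 *: P j) *m Q = mxvec (\sum_j w j 0 *: P j).
  by rewrite -PmE mulmxA -(mulmxA _ Pm) mulmxVp// mulmx1.
have XQ : mxvec X *m Q = mxvec X.
  apply/eqP; rewrite -subr_eq0 -normr_le0; apply/ler_addgt0Pr => e e0.
  pose c := (m * n)%:R * `|Q| + 1; have c0 : 0 < c by rewrite ltr_wpDl.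
  have [|w hw] := h (e / c); first by rewrite divr_gt0.
  set Y := \sum_j _ in hw; rewrite add0r.
  have -> : mxvec X *m Q - mxvec X = mxvec (X - Y) *m Q - mxvec (X - Y).
    by rewrite linearB /= mulmxBl QE opprB addrA subrK.
  rewrite (le_trans (ler_normB _ _))// norm_mxvec.
  rewrite (@le_trans _ _ (c * `|X - Y|))//.
    rewrite /c mulrDl mul1r lerD2r (le_trans (mx_normM _ _))// norm_mxvec.
    by rewrite mulrAC.
  by rewrite mulrC -ler_pdivlMr.
exists (mxvec X *m pinvmx Pm)^T; apply: (can_inj mxvecK).
by rewrite -PmE trmxK -mulmxA.
Qed.

End RangeClosed.

(** * Charts of the group and the Hessian at a critical point *)

Section Chart.
Variables (R : realType) (n : nat) (G : motion_group).
Variables (f : 'cV[R]_n.+1 -> R) (E : ('cV[R]_n.+1 -> R) -> R).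
Local Notation p := n.+1.
Local Notation N := ((p + 1)%:R : R).
Hypotheses (f_C3 : is_Ck 3 setT f) (E_bf : bounded_functional E).
Variables (d : nat) (phi : 'cV[R]_d -> 'M[R]_(p + 1)) (U : set 'cV[R]_d) (L : 'M[R]_(p + 1)).
Hypotheses (U_open : open U) (U0 : U 0) (phi0 : phi 0 = L).
Hypothesis phi_C : forall k i j, is_Ck k U (fun u => phi u i j).
Hypothesis phi_imm : forall u w, U u -> 'D_w phi u = 0 -> w = 0.
Hypothesis phi_open : open_in G (phi @` U).
Hypothesis phi_homeo : exists psi : 'M[R]_(p + 1) -> 'cV[R]_d,
           {in U, cancel phi psi} /\ {within phi @` U, continuous psi}.

Local Notation vel := (velocity phi).

Lemma chart_in_carrier u : U u -> carrier G (phi u).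
Proof.
move=> Uu; have [W _ WE] := phi_open.
by have : (phi @` U) (phi u) by [exists u]; rewrite WE => -[].
Qed.

Lemma near_line u (w : 'cV[R]_d) : U u -> exists2 r, 0 < r & forall s : R, `|s| < r -> U (s *: w + u).
Proof.
move=> Uu; have [r r0 hr] := open_ball_in U_open Uu.
exists (r / (`|w| + 1)) => [|s]; first by rewrite divr_gt0// ltr_wpDl.
rewrite ltr_pdivlMr ?ltr_wpDl// => sr; apply: hr; rewrite addrK normrZ (le_lt_trans _ sr)//.
by rewrite ler_wpM2l// lerDl.
Qed.

(** The quotients phi (u + s e_j) phi (u)^-1 are elements of the group close
    to the identity, which is tangent to the Lie algebra; dividing by s, the
    velocity is a limit of elements of the Lie algebra. *)
Lemma velocity_tangent j u : U u -> lie G (vel j u *m invmx (phi u)).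
Proof.
move=> Uu; have [Mu MV] := carrier_inv (chart_in_carrier Uu).
set M := phi u in Mu MV *; set V := invmx M; set v := vel j u.
have [C C0 HC] := @carrier_near1 R n G.
apply: lie_closed => e e0.
have N0 : 0 <= N by rewrite ler0n.
pose k := N * `|V|; have k0 : 0 <= k by rewrite mulr_ge0.
pose e1 := e / (2 * (k + 1)).
have k1 : 0 < k + 1 by rewrite ltr_wpDl.
have e10 : 0 < e1 by rewrite divr_gt0// mulr_gt0.
have /is_derive_epsP/(_ _ e10)[r1 r10 h1] := velocity_is_derive phi_C j Uu.
have [r2 r20 h2] := near_line (delta_mx j 0) Uu.
pose B := k * (e1 + `|v|); have B0 : 0 <= B by rewrite mulr_ge0// addr_ge0// ltW.
have T0 : 0 <= 2 * C * B ^+ 2 / e by apply: divr_ge0; [apply: mulr_ge0; [exact: mulr_ge0|exact: exprn_ge0]|exact: ltW].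
(* For s <= 1 / D the quotient is within 1 of the identity, and the second
   order error C (B s)^2 is at most s e / 2. *)
pose D := 1 + B + 2 * C * B ^+ 2 / e.
have D0 : 0 < D.
  by rewrite /D; lra.
pose s := Num.min (Num.min r1 r2 / 2) D^-1.
have m0 : 0 < Num.min r1 r2 by rewrite lt_min r10.
have s0 : 0 < s by rewrite lt_min divr_gt0// invr_gt0.
have sm : s < Num.min r1 r2.
  by apply: (@le_lt_trans _ _ (Num.min r1 r2 / 2)); [rewrite ge_min lexx|lra].
have sabs : `|s| = s by rewrite gtr0_norm.
move: (sm); rewrite lt_min => /andP[sr1 sr2].
have sD : s * D <= 1 by rewrite -ler_pdivlMr// div1r ge_min lexx orbT.
set M' := phi (s *: delta_mx j 0 + u).
have M'G : carrier G M' by apply: chart_in_carrier; apply: h2; rewrite sabs.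
have hs : `|M' - M - s *: v| <= e1 * s by have := h1 s; rewrite sabs; apply.
pose K := M' *m V.
have KE : K - 1%:M = (M' - M) *m V by rewrite mulmxBl mulmxV.
have KG : carrier G K by exact: carrierM.
have MM : `|M' - M| <= (e1 + `|v|) * s.
  rewrite -[M' - M](subrK (s *: v)) (le_trans (ler_normD _ _))// mulrDl lerD//.
  by rewrite normrZ sabs mulrC.
have KB : `|K - 1%:M| <= B * s.
  by rewrite KE (le_trans (mx_normM _ _))// mulrAC -/k /B -mulrA ler_wpM2l.
have Bs1 : B * s <= 1.
  apply: (@le_trans _ _ (s * D)); last exact: sD.
  by rewrite mulrC ler_wpM2l ?(ltW s0)// /D; lra.
have Kp := HC K KG (le_trans KB Bs1).
exists (s^-1 *: lie_proj G (K - 1%:M)); first by apply: lieZ; exact: lie_projK.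
rewrite -(ler_pM2l s0) -{1}sabs -normrZ scalerBr scalerA divff ?gt_eqF// scale1r.
have -> : s *: (v *m V) - lie_proj G (K - 1%:M) =
   (K - 1%:M - lie_proj G (K - 1%:M)) - (M' - M - s *: v) *m V.
  rewrite mulmxBl -KE -scalemxAl; move: (K - 1%:M) (lie_proj _ _) (s *: _) => a b c.
  by apply/matrixP => i l; rewrite !mxE; ring.
rewrite (le_trans (ler_normB _ _))//.
have t1 : `|(M' - M - s *: v) *m V| <= s * (e / 2).
  rewrite (le_trans (mx_normM _ _))// mulrAC -/k.
  apply: (@le_trans _ _ (k * (e1 * s))); first by rewrite ler_wpM2l.
  rewrite (_ : k * (e1 * s) = s * (e / 2) * (k / (k + 1))); last by rewrite /e1; field; rewrite gt_eqF.
  by rewrite ler_piMr ?mulr_ge0 ?divr_ge0 ?(ltW s0) ?(ltW e0)// ler_pdivrMr// mul1r lerDl.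
have t2 : `|K - 1%:M - lie_proj G (K - 1%:M)| <= s * (e / 2).
  rewrite (le_trans Kp)// (@le_trans _ _ (C * (B * s) ^+ 2))//.
    by rewrite ler_wpM2l// ler_pXn2r ?nnegrE// mulr_ge0// ltW.
  have : s * (2 * C * B ^+ 2 / e) <= 1.
    apply: (le_trans _ sD); rewrite ler_wpM2l ?(ltW s0)// /D lerDr; lra.
  have -> : s * (2 * C * B ^+ 2 / e) = (C * (B * s) ^+ 2) / (s * (e / 2)).
    by field; rewrite !gt_eqF.
  by rewrite ler_pdivrMr ?mul1r// mulr_gt0// divr_gt0.
lra.
Qed.

Lemma chart_L_carrier : carrier G L.
Proof. by rewrite -phi0; exact: chart_in_carrier. Qed.

Lemma velocity_free (w : 'cV[R]_d) : \sum_j w j 0 *: vel j 0 = 0 -> w = 0.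
Proof. by rewrite -(velocity_directional U_open phi_C _ U0); exact: phi_imm. Qed.

(** This is where phi being a homeomorphism onto an open subset of the group
    is used. *)
Lemma chart_inverse_near r : 0 < r -> exists2 r', 0 < r' & forall M, carrier G M -> `|M - L| < r' ->
  exists u, [/\ U u, phi u = M & `|u| < r].
Proof.
move=> r0; have [psi [phiK psi_c]] := phi_homeo.
have [W Wo WE] := phi_open.
have Limg : (phi @` U) L by exists 0.
have psiL : psi L = 0 by rewrite -phi0 phiK// inE.
have := (subspace_continuousP _ _).1 psi_c L Limg => /cvgrPdist_lt/(_ r r0).
move=> /nbhs_ballP[r1 /= r10 h1].
have /nbhs_ballP[r2 /= r20 h2] : nbhs L W.
  by apply: open_nbhs_nbhs; split=> //; move: Limg; rewrite WE => -[].
exists (Num.min r1 r2) => [|M MG]; first by rewrite lt_min r10.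
rewrite lt_min => /andP[M1 M2].
have [u Uu uM] : (phi @` U) M.
  by rewrite WE; split=> //; apply: h2; rewrite -ball_normE /ball_/= distrC.
exists u; split=> //.
have -> : u = psi M by rewrite -uM phiK// inE.
have : `|psi L - psi M| < r.
  by apply: (h1 M); [rewrite -ball_normE /ball_/= distrC|exists u].
by rewrite psiL sub0r normrN.
Qed.

(** The differential of the chart is onto, so that its dimension is that of
    the group. For X in the Lie algebra, the curve s |-> local_motion (s X) L
    stays in the group, hence lifts to a curve u (s) in the chart. As the
    differential is injective, |u (s)| = O(s); therefore the differential at
    u (s) / s tends to X L, and the range of a linear map is closed. *)
Lemma chart_span X : lie G X -> exists w : 'cV[R]_d, X *m L = \sum_j w j 0 *: vel j 0.
Proof.
move=> XG; apply: (combination_closed velocity_free) => e e0.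
have [C0 C00 HC0] := combination_bounded_below velocity_free.
have [C1 [r1 [C10 r10 _ H1]]] := @local_motion_near1 R n G.
have N0 : 0 <= N by rewrite ler0n.
(* The curve is L + s X L up to s^2 T, and stays within s B of L for s <= 1. *)
pose T := N * (C1 * `|X| ^+ 2) * `|L|.
have T0 : 0 <= T by apply: mulr_ge0 => //; apply: mulr_ge0 => //; apply: mulr_ge0 => //; exact: exprn_ge0.
pose B := N * `|X| * `|L| + T; have B0 : 0 <= B by rewrite addr_ge0// !mulr_ge0.
(* The first bound makes the remainder absorbable in |u| <= C0 |P|; the
   second makes it at most half of s e once |u| <= 2 C0 B s. *)
pose e2 := Num.min (2 * C0)^-1 (e / 2 / (2 * C0 * B + 1)).
have CB0 : 0 <= 2 * C0 * B by rewrite !mulr_ge0// ltW.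
have CB1 : 0 < 2 * C0 * B + 1 by lra.
have e20 : 0 < e2.
  by rewrite lt_min invr_gt0 mulr_gt0//= !divr_gt0.
have [r2 r20 H2] := velocity_frechet U_open phi_C U0 e20.
have [r3 r30 H3] := chart_inverse_near r20.
pose m := Num.min (Num.min r1 r3) (e / 2).
have m0 : 0 < m by rewrite !lt_min r10 r30 divr_gt0.
have [|s [s0 s1 sm sK]] := @exists_small R (`|X| + B + T) m _ m0; first by rewrite !addr_ge0.
have sX : s * `|X| < m by apply: le_lt_trans sK; rewrite ler_wpM2l ?(ltW s0)//; lra.
have sB : s * B < m by apply: le_lt_trans sK; rewrite ler_wpM2l ?(ltW s0)//; have := normr_ge0 X; lra.
have sT : s * T < m by apply: le_lt_trans sK; rewrite ler_wpM2l ?(ltW s0)//; have := normr_ge0 X; lra.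
have mr1 : m <= r1 by rewrite !ge_min lexx.
have mr3 : m <= r3 by rewrite !ge_min lexx !orbT.
have me : m <= e / 2 by rewrite !ge_min lexx !orbT.
have sabs : `|s| = s by rewrite gtr0_norm.
have [ O [ v [ OG XE]]] := (lieP G X).1 XG.
have sOG : lie_algebra G (s *: O).
  case: (G) OG => /= OG; first by rewrite linearZ /= OG scalerN.
  by rewrite linearZ /= OG mulr0.
have sXE : algmx (s *: O) (s *: v) = s *: X by rewrite XE /algmx scale_block_mx !scaler0.
have nsX : `|s *: X| = s * `|X| by rewrite normrZ sabs.
have [cG cE] : carrier G (local_motion G (s *: O) (s *: v)) /\
   `|local_motion G (s *: O) (s *: v) - 1%:M - s *: X| <= C1 * (s * `|X|) ^+ 2.
  by have := H1 _ (s *: v) sOG; rewrite sXE nsX; apply; exact: ltW (lt_le_trans sX mr1).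
set A := local_motion G (s *: O) (s *: v) in cG cE.
have AL : `|A *m L - L - s *: (X *m L)| <= s * (s * T).
  have -> : A *m L - L - s *: (X *m L) = (A - 1%:M - s *: X) *m L by rewrite !mulmxBl mul1mx scalemxAl.
  rewrite (le_trans (mx_normM _ _))// (_ : s * (s * T) = N * (C1 * (s * `|X|) ^+ 2) * `|L|); last by rewrite /T; ring.
  by rewrite ler_wpM2r// ler_wpM2l.
have ALB : `|A *m L - L| <= s * B.
  rewrite -[A *m L - L](subrK (s *: (X *m L))) (le_trans (ler_normD _ _))// /B mulrDr addrC lerD//.
    by rewrite normrZ sabs ler_wpM2l ?(ltW s0)// mx_normM.
  by rewrite (le_trans AL)// ler_piMl ?(ltW s1)// mulr_ge0// ltW.
have [u [Uu uE ur]] : exists u, [/\ U u, phi u = A *m L & `|u| < r2].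
  by apply: H3; [exact: (carrierM cG chart_L_carrier)|apply: le_lt_trans ALB (lt_le_trans sB mr3)].
have hu := H2 u ur; rewrite add0r phi0 uE in hu.
set P := \sum_j _ in hu.
have uP : `|u| <= C0 * `|P| by exact: HC0.
have e2C : e2 * C0 <= 2^-1.
  have -> : 2^-1 = (2 * C0)^-1 * C0 by field; rewrite gt_eqF.
  by rewrite ler_wpM2r ?(ltW C00)// ge_min lexx.
have PB : `|P| <= s * B + e2 * `|u|.
  have -> : P = (A *m L - L) - (A *m L - L - P) by rewrite opprB addrCA subrr addr0.
  by rewrite (le_trans (ler_normB _ _))// lerD.
have uB : `|u| <= 2 * C0 * B * s.
  have h1 : `|u| <= C0 * (s * B) + e2 * C0 * `|u|.
    apply: (le_trans uP); rewrite (_ : _ + _ = C0 * (s * B + e2 * `|u|)); last by ring.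
    by rewrite ler_wpM2l// ltW.
  have h2 : e2 * C0 * `|u| <= 2^-1 * `|u| by rewrite ler_wpM2r.
  have -> : 2 * C0 * B * s = 2 * (C0 * (s * B)) by ring.
  lra.
have e2u : e2 * `|u| <= s * (e / 2).
  apply: (@le_trans _ _ ((e / 2 / (2 * C0 * B + 1)) * (2 * C0 * B * s))).
    rewrite ler_pM ?(ltW e20)//; first by rewrite ge_min lexx orbT.
  rewrite (_ : _ * (2 * C0 * B * s) = s * (e / 2) * (2 * C0 * B / (2 * C0 * B + 1))); last by field; rewrite gt_eqF.
  rewrite ler_piMr//; first by rewrite mulr_ge0 ?divr_ge0 ?(ltW s0) ?(ltW e0).
  by rewrite ler_pdivrMr//; lra.
exists (s^-1 *: u).
have -> : \sum_j (s^-1 *: u) j 0 *: vel j 0 = s^-1 *: P.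
  by rewrite scaler_sumr; apply: eq_bigr => j _; rewrite mxE scalerA.
rewrite -(ler_pM2l s0) -{1}sabs -normrZ scalerBr scalerA divff ?gt_eqF// scale1r.
have -> : s *: (X *m L) - P = (A *m L - L - P) - (A *m L - L - s *: (X *m L)).
  by move: (A *m L - L) (s *: _) P {hu uP PB} => a b c; apply/matrixP => i j; rewrite !mxE; ring.
rewrite (le_trans (ler_normB _ _))//.
have : s * (s * T) <= s * (e / 2) by rewrite ler_wpM2l ?(ltW s0)// (le_trans (ltW sT)).
lra.
Qed.

Lemma cost_chart_derive j u : U u ->
  is_derive u (delta_mx j 0) (cost f E \o phi) (dcost f E (phi u) (vel j u)).
Proof.
move=> Uu; apply/is_derive_epsP => e e0.
have [C1 C10 H1] := cost_expansion f_C3 E_bf (phi u).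
have [C2 C20 H2] := dcost_bounded f_C3 E_bf (phi u).
pose v := vel j u; pose k := `|v| + 1; have k0 : 0 < k by rewrite ltr_wpDl.
pose e1 := Num.min 1 (e / (2 * (C2 + 1))).
have C21 : 0 < C2 + 1 by rewrite ltr_wpDl.
have e10 : 0 < e1 by rewrite lt_min ltr01 divr_gt0// mulr_gt0.
have /is_derive_epsP/(_ _ e10)[r1 r10 h1] := velocity_is_derive phi_C j Uu.
have [t [t0 _ t1 tK]] : exists t, [/\ 0 < t, t < 1, t < Num.min 1 (e / 2) & t * (k + C1 * k ^+ 2) < Num.min 1 (e / 2)].
  by apply: exists_small; rewrite ?addr_ge0 ?mulr_ge0// ?exprn_ge0// ?(ltW k0)// lt_min ltr01 divr_gt0.
have Ck0 : 0 <= C1 * k ^+ 2 by rewrite mulr_ge0// exprn_ge0// ltW.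
exists (Num.min r1 t) => [|s]; first by rewrite lt_min r10.
rewrite lt_min => /andP[sr st] /=.
set M := phi u; set M' := phi _.
have hs : `|M' - M - s *: v| <= e1 * `|s| by exact: h1.
have DM : `|M' - M| <= k * `|s|.
  rewrite -[M' - M](subrK (s *: v)) (le_trans (ler_normD _ _))// mulrDl addrC lerD//.
    by rewrite normrZ mulrC.
  by rewrite (le_trans hs)// ler_wpM2r// ge_min lexx.
have s0 := normr_ge0 s.
have sk : `|s| * (k + C1 * k ^+ 2) < Num.min 1 (e / 2).
  by apply: le_lt_trans tK; rewrite ler_wpM2r ?(ltW st)// addr_ge0// ltW.
move: sk; rewrite lt_min => /andP[sk1 sk2].
have sk1' : k * `|s| <= 1.
  apply: le_trans (ltW sk1); rewrite mulrC ler_wpM2l//; lra.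
have MM' : phi u + (M' - M) = M' by rewrite addrC subrK.
have h := H1 (M' - M) (le_trans DM sk1'); rewrite MM' in h.
have -> : cost f E M' - cost f E M - s *: dcost f E M v =
  (cost f E M' - cost f E M - dcost f E M (M' - M)) + dcost f E M (M' - M - s *: v).
  rewrite (dcostB f_C3 E_bf _ (M' - M)) (dcostZ f_C3 E_bf).
  rewrite -[s *: _]/(s * _).
  by move: (cost _ _ _) (cost _ _ _) (dcost _ _ _ _) (dcost _ _ _ _) => *; ring.
rewrite (le_trans (ler_normD _ _))//.
have t1' : C1 * `|M' - M| ^+ 2 <= e / 2 * `|s|.
  apply: (@le_trans _ _ (C1 * (k * `|s|) ^+ 2)).
    by rewrite ler_wpM2l// ler_pXn2r ?nnegrE// mulr_ge0// ltW.
  rewrite (_ : C1 * _ = (`|s| * (C1 * k ^+ 2)) * `|s|); last by ring.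
  rewrite ler_wpM2r// (le_trans _ (ltW sk2))// ler_wpM2l//.
  by rewrite lerDr ltW.
have t2' : C2 * `|M' - M - s *: v| <= e / 2 * `|s|.
  apply: (@le_trans _ _ (C2 * (e1 * `|s|))); first by rewrite ler_wpM2l.
  rewrite mulrA ler_wpM2r//.
  apply: (@le_trans _ _ (C2 * (e / (2 * (C2 + 1))))).
    by rewrite ler_wpM2l// ge_min lexx orbT.
  rewrite (_ : C2 * _ = e / 2 * (C2 / (C2 + 1))); last by field; rewrite gt_eqF.
  by rewrite ler_piMr ?divr_ge0 ?(ltW e0)// ler_pdivrMr//; lra.
apply: (le_trans (lerD (le_trans h t1') (le_trans (H2 _) t2'))).
by rewrite -mulrDl -splitr.
Qed.

(** The coordinate directions of the chart, translated to the Lie algebra. *)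
Definition chart_frame (j : 'I_d) : 'M[R]_(p + 1) := vel j 0 *m invmx L.
Local Notation eta := chart_frame.

Lemma chart_frame_lie j : lie G (eta j).
Proof. by rewrite /chart_frame -phi0; exact: velocity_tangent. Qed.

Lemma chart_frameK j : eta j *m L = vel j 0.
Proof. by rewrite /chart_frame mulmxKV//; case: (carrier_inv chart_L_carrier). Qed.

Lemma chart_frame_span X : lie G X -> exists w : 'cV[R]_d, X = \sum_j w j 0 *: eta j.
Proof.
move=> /chart_span[w XE]; exists w; have [Lu _] := carrier_inv chart_L_carrier.
rewrite -[X](mulmxK Lu) XE mulmx_suml; apply: eq_bigr => j _.
by rewrite scalemxAl.
Qed.

Lemma partial_cost_chart j u : U u ->
  partial j (cost f E \o phi) u = dcost f E (phi u) (vel j u).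
Proof. by move=> Uu; have [_] := cost_chart_derive j Uu. Qed.

Lemma chart_critical : gradient (cost f E \o phi) 0 = 0 -> critical G f E L.
Proof.
move=> grad Y /chart_span[w ->].
rewrite (big_morph _ (dcostD f_C3 E_bf L) (dcost0 f_C3 E_bf L)) big1// => j _.
rewrite (dcostZ f_C3 E_bf) -phi0 -partial_cost_chart//.
by have /matrixP/(_ j 0) := grad; rewrite !mxE => ->; rewrite mulr0.
Qed.

Lemma chart_line_lipschitz i : exists k r : R, [/\ 0 <= k, 0 < r & forall s : R, `|s| < r ->
  `|phi (s *: delta_mx i 0 + 0) - L| <= k * `|s|].
Proof.
have /is_derive_epsP/(_ 1 ltr01)[r r0 hr] := velocity_is_derive phi_C i U0.
exists (`|vel i 0| + 1), r; split=> //.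
move=> s sr; have := hr s sr; rewrite phi0 => h.
rewrite -[_ - L](subrK (s *: vel i 0)) (le_trans (ler_normD _ _))// mulrDl addrC lerD//.
by rewrite normrZ mulrC.
Qed.

(** The difference of the two frames is bounded by its product with phi (u),
    which is uniformly invertible near L; that product tends to 0 with the
    velocities. *)
Lemma chart_frame_continuous i j e : 0 < e -> exists2 r, 0 < r & forall s : R, `|s| < r ->
  U (s *: delta_mx i 0 + 0) /\
  `|vel j (s *: delta_mx i 0 + 0) *m invmx (phi (s *: delta_mx i 0 + 0)) - eta j| <= e.
Proof.
move=> e0; have [Lu _] := carrier_inv chart_L_carrier.
have [C [r1 [C0 r10 H1]]] := unitmx_near Lu.
have [k [r2 [k0 r20 H2]]] := chart_line_lipschitz i.
have N0 : 0 <= N by rewrite ler0n.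
pose e1 := e / (2 * (C + 1)).
have C1 : 0 < C + 1 by rewrite ltr_wpDl.
have e10 : 0 < e1 by rewrite divr_gt0// mulr_gt0.
have [r3 r30 H3] := velocity_continuous phi_C U0 e10.
have [r4 r40 H4] := near_line (delta_mx i 0) U0.
pose B := N * `|eta j| * k; have B0 : 0 <= B by rewrite !mulr_ge0.
pose m := Num.min (Num.min r1 r2) (Num.min (Num.min r3 r4) e1).
have m0 : 0 < m by rewrite !lt_min r10 r20 r30 r40.
have [|t [t0 _ tm tK]] := @exists_small R (k + B) m _ m0; first by rewrite addr_ge0.
exists t => // s st; set u := s *: delta_mx i 0 + 0.
have sm : `|s| < m by exact: lt_trans tm.
have mr1 : m <= r1 by rewrite !ge_min lexx.
have mr2 : m <= r2 by rewrite !ge_min lexx !orbT.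
have mr3 : m <= r3 by rewrite !ge_min lexx !orbT.
have mr4 : m <= r4 by rewrite !ge_min lexx !orbT.
have me1 : m <= e1 by rewrite !ge_min lexx !orbT.
have Uu : U u by apply: H4; exact: lt_le_trans mr4.
split=> //; set M := phi u.
have s0 := normr_ge0 s.
have sK : `|s| * (k + B) <= m by apply: (le_trans _ (ltW tK)); rewrite ler_wpM2r ?addr_ge0// ltW.
have ML : `|M - L| <= k * `|s| by apply: H2; exact: lt_le_trans mr2.
have MLr : `|M - L| <= r1.
  apply: (le_trans ML); apply: (le_trans _ mr1); apply: (le_trans _ sK).
  by rewrite mulrC ler_wpM2l// lerDl.
have [Mu bM] := H1 _ MLr.
rewrite (le_trans (bM _ _))//.
have -> : (vel j u *m invmx M - eta j) *m M = (vel j u - vel j 0) - eta j *m (M - L).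
  by rewrite mulmxBl mulmxKV// mulmxBr chart_frameK opprB addrA subrK.
have v1 : `|vel j u - vel j 0| <= e1.
  apply: H3; rewrite subr0 /u addr0 normrZ (le_lt_trans _ (lt_le_trans sm mr3))//.
  by rewrite ler_piMr// norm_delta_cV.
have v2 : `|eta j *m (M - L)| <= e1.
  apply: (le_trans (mx_normM _ _)); apply: (le_trans _ me1); apply: (le_trans _ sK).
  apply: (@le_trans _ _ (`|s| * B)); last by rewrite ler_wpM2l// lerDr.
  by rewrite /B [leRHS]mulrC -[leRHS]mulrA ler_wpM2l// mulr_ge0.
apply: (@le_trans _ _ (C * (2 * e1))).
  rewrite ler_wpM2l// (le_trans (ler_normB _ _))//; lra.
rewrite (_ : C * (2 * e1) = e * (C / (C + 1))); last by rewrite /e1; field; rewrite gt_eqF.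
by rewrite ler_piMr ?(ltW e0)// ler_pdivrMr//; lra.
Qed.

(** The partial derivative of the cost at u is the gradient at phi (u) tested
    against the frame at u. Its increment along e_i is given by the first
    order expansion of the gradient at L, where the displacement of phi (u)
    from L is s times the frame vector, up to o(s). *)
Lemma chart_hessian i j : critical G f E L ->
  partial i (partial j (cost f E \o phi)) 0 = newton_form f E L (eta i) (eta j).
Proof.
move=> crit.
suff : is_derive 0 (delta_mx i 0) (partial j (cost f E \o phi)) (newton_form f E L (eta i) (eta j)).
  by move=> [_ hd]; exact: hd.
apply/is_derive_epsP => e e0.
have [Lu _] := carrier_inv chart_L_carrier.
have [C [r1 [C0 r10 _ H1]]] := gradient_expansion f_C3 E_bf chart_L_carrier crit.
have [B B0 HB] := newton_form_bounded f_C3 E_bf L.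
have [k [r2 [k0 r20 H2]]] := chart_line_lipschitz i.
have N0 : 0 <= N by rewrite ler0n.
pose V := `|invmx L|; pose h := `|eta j| + 1.
have V0 : 0 <= V by exact: normr_ge0.
have h0 : 0 <= h by rewrite addr_ge0.
(* The error is at most |s| (|s| a3 + a1 e1 + a2 e2): second order terms, the
   remainder of the chart, and the variation of the frame. *)
pose a1 := B * h * N * V; have a10 : 0 <= a1 by rewrite !mulr_ge0.
pose a2 := B * `|eta i|; have a20 : 0 <= a2 by rewrite !mulr_ge0.
pose a3 := C * k ^+ 2 * h * (1 + B).
have a30 : 0 <= a3.
  by apply: mulr_ge0; [apply: mulr_ge0 => //; apply: mulr_ge0 => //; exact: exprn_ge0|exact: addr_ge0].
pose e1 := e / (3 * (a1 + 1)); pose e2 := Num.min 1 (e / (3 * (a2 + 1))).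
have a11 : 0 < a1 + 1 by rewrite ltr_wpDl.
have a21 : 0 < a2 + 1 by rewrite ltr_wpDl.
have e10 : 0 < e1 by rewrite divr_gt0// mulr_gt0.
have e20 : 0 < e2 by rewrite lt_min ltr01 divr_gt0// mulr_gt0.
have /is_derive_epsP/(_ _ e10)[r3 r30 H3] := velocity_is_derive phi_C i U0.
have [r4 r40 H4] := chart_frame_continuous i j e20.
pose m := Num.min (Num.min r1 r2) (Num.min (Num.min r3 r4) (e / 3)).
have m0 : 0 < m by rewrite !lt_min r10 r20 r30 r40 divr_gt0.
have [|t [t0 _ tm tK]] := @exists_small R (k + a3) m _ m0; first by rewrite addr_ge0.
exists t => // s st; set u := s *: delta_mx i 0 + 0.
have sm : `|s| < m by exact: lt_trans tm.
have mr1 : m <= r1 by rewrite !ge_min lexx.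
have mr2 : m <= r2 by rewrite !ge_min lexx !orbT.
have mr3 : m <= r3 by rewrite !ge_min lexx !orbT.
have mr4 : m <= r4 by rewrite !ge_min lexx !orbT.
have me : m <= e / 3 by rewrite !ge_min lexx !orbT.
have s0 := normr_ge0 s.
have sK : `|s| * (k + a3) <= m by apply: (le_trans _ (ltW tK)); rewrite ler_wpM2r ?addr_ge0// ltW.
have [Uu etau] := H4 s (lt_le_trans sm mr4).
rewrite -/u in Uu etau; set M := phi u in etau.
have MG : carrier G M by exact: chart_in_carrier.
have [Mu _] := carrier_inv MG.
set nu := vel j u *m invmx M in etau.
have nuG : lie G nu by exact: velocity_tangent.
have nuM : nu *m M = vel j u by rewrite mulmxKV.
have nuh : `|nu| <= h.
  rewrite -[nu](subrK (eta j)) (le_trans (ler_normD _ _))// addrC lerD2l.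
  by rewrite (le_trans etau)// ge_min lexx.
have ML : `|M - L| <= k * `|s| by apply: H2; exact: lt_le_trans mr2.
have MLr : `|M - L| <= r1.
  apply: (le_trans ML); apply: (le_trans _ mr1); apply: (le_trans _ sK).
  by rewrite mulrC ler_wpM2l// lerDl.
have := H1 M MG MLr; set K1 := _ - 1%:M; set xi := lie_proj G K1 => -[_ hxi /(_ nu nuG)].
rewrite nuM => hexp.
have ML2 : `|M - L| ^+ 2 <= k ^+ 2 * `|s| ^+ 2 by rewrite -exprMn ler_pXn2r ?nnegrE// mulr_ge0.
have K1s : `|K1 - s *: eta i| <= N * V * (e1 * `|s|).
  have -> : K1 - s *: eta i = (M - L - s *: vel i 0) *m invmx L.
    by rewrite /K1 !mulmxBl mulmxV// /chart_frame scalemxAl.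
  rewrite (le_trans (mx_normM _ _))// mulrAC ler_wpM2l// ?mulr_ge0//.
  by have := H3 s (lt_le_trans sm mr3); rewrite phi0.
have xis : `|xi - s *: eta i| <= C * k ^+ 2 * `|s| ^+ 2 + N * V * (e1 * `|s|).
  have -> : xi - s *: eta i = (K1 - s *: eta i) - (K1 - xi) by rewrite opprB [RHS]addrC addrA subrK.
  rewrite (le_trans (ler_normB _ _))// addrC lerD// (le_trans hxi)// -mulrA ler_wpM2l//.
rewrite !partial_cost_chart// -/M.
have -> : dcost f E (phi 0) (vel j 0) = 0 by rewrite phi0 -chart_frameK crit//; exact: chart_frame_lie.
rewrite subr0.
have -> : dcost f E M (vel j u) - s *: newton_form f E L (eta i) (eta j) =
  (dcost f E M (vel j u) - newton_form f E L xi nu) + newton_form f E L (xi - s *: eta i) nu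
  + s * newton_form f E L (eta i) (nu - eta j).
  have q1 : newton_form f E L (xi - s *: eta i) nu = newton_form f E L xi nu - s * newton_form f E L (eta i) nu.
    rewrite addrC -scaleNr (newton_form_linearl f_C3 E_bf).
    by rewrite mulNr addrC.
  have q2 : newton_form f E L (eta i) (nu - eta j) = newton_form f E L (eta i) nu - newton_form f E L (eta i) (eta j).
    rewrite addrC -scaleN1r (newton_form_linearr f_C3 E_bf).
    by rewrite mulN1r addrC.
  rewrite q1 q2 -[s *: _]/(s * _).
  by move: (dcost _ _ _ _) (newton_form _ _ _ _ _) (newton_form _ _ _ _ _) (newton_form _ _ _ _ _) => *; ring.
have t1 : `|dcost f E M (vel j u) - newton_form f E L xi nu| <= C * k ^+ 2 * h * `|s| ^+ 2.
  apply: (le_trans hexp); rewrite (_ : C * k ^+ 2 * h * _ = C * (k ^+ 2 * `|s| ^+ 2) * h); last by ring.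
  by rewrite ler_pM// ?mulr_ge0// ?exprn_ge0// ler_wpM2l.
have t2 : `|newton_form f E L (xi - s *: eta i) nu| <= B * (C * k ^+ 2 * `|s| ^+ 2 + N * V * (e1 * `|s|)) * h.
  by apply: (le_trans (HB _ _)); rewrite ler_pM// ?mulr_ge0// ler_wpM2l.
have t3 : `|s * newton_form f E L (eta i) (nu - eta j)| <= `|s| * (a2 * e2).
  by rewrite normrM ler_wpM2l// (le_trans (HB _ _))// ler_wpM2l.
rewrite (le_trans (ler_normD _ _))// (le_trans (lerD (ler_normD _ _) (lexx _)))//.
have e1E : a1 * e1 <= e / 3.
  rewrite (_ : a1 * e1 = e / 3 * (a1 / (a1 + 1))); last by rewrite /e1; field; rewrite gt_eqF.
  by rewrite ler_piMr ?divr_ge0 ?(ltW e0)// ler_pdivrMr//; lra.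
have e2E : a2 * e2 <= e / 3.
  apply: (@le_trans _ _ (a2 * (e / (3 * (a2 + 1))))); first by rewrite ler_wpM2l// ge_min lexx orbT.
  rewrite (_ : a2 * _ = e / 3 * (a2 / (a2 + 1))); last by field; rewrite gt_eqF.
  by rewrite ler_piMr ?divr_ge0 ?(ltW e0)// ler_pdivrMr//; lra.
have a3E : `|s| * a3 <= e / 3.
  by apply: (le_trans _ me); apply: (le_trans _ sK); rewrite ler_wpM2l// lerDr.
apply: (le_trans (lerD (lerD t1 t2) t3)).
rewrite (_ : _ + _ = (`|s| * a3 + a1 * e1 + a2 * e2) * `|s|); last by rewrite /a3 /a1; ring.
by rewrite ler_wpM2r//; lra.
Qed.


End Chart.


(** * One Newton step, and the iteration *)

Section NewtonStep.
Variables (R : realType) (n : nat) (G : motion_group).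
Variables (f : 'cV[R]_n.+1 -> R) (E : ('cV[R]_n.+1 -> R) -> R).
Local Notation p := n.+1.
Local Notation N := ((p + 1)%:R : R).
Hypotheses (f_C3 : is_Ck 3 setT f) (E_bf : bounded_functional E).
Implicit Types (L M X Y : 'M[R]_(p + 1)).

(** A frame of the Lie algebra in which the Newton form is an invertible
    matrix; its independence is a consequence. *)
Definition nondegenerate_frame L d (eta : 'I_d -> 'M[R]_(p + 1)) : Prop :=
  [/\ forall j, lie G (eta j),
      forall X, lie G X -> exists w : 'cV[R]_d, X = \sum_j w j 0 *: eta j &
      (\matrix_(i, j) newton_form f E L (eta i) (eta j)) \in unitmx].

Lemma nondegenerate_critical_pointP L :
  nondegenerate_critical_point G (cost f E) L ->
  [/\ carrier G L, critical G f E L & exists d (eta : 'I_d -> 'M[R]_(p + 1)), nondegenerate_frame L eta].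
Proof.
move=> [d [phi [[U [Uo U0 phi0 [pC pI pO pH]]] grad hess]]].
have LG : carrier G L by apply: (chart_L_carrier U0 phi0 pO).
have crit : critical G f E L.
  exact: (chart_critical f_C3 E_bf Uo U0 phi0 pC pI pO pH grad).
split=> //; exists d, (chart_frame phi L); split.
- by move=> j; exact: (chart_frame_lie Uo U0 phi0 pC pO).
- by move=> X XG; exact: (chart_frame_span Uo U0 phi0 pC pI pO pH XG).
rewrite (_ : \matrix_(i, j) _ = hessian (cost f E \o phi) 0)//.
apply/matrixP => i j; rewrite [LHS]mxE [RHS]mxE.
by rewrite (chart_hessian f_C3 E_bf Uo U0 phi0 pC pO i j crit).
Qed.

Lemma newton_form_suml M d (w : 'rV[R]_d) (eta : 'I_d -> 'M[R]_(p + 1)) Y :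
  newton_form f E M (\sum_i w 0 i *: eta i) Y = \sum_i w 0 i * newton_form f E M (eta i) Y.
Proof.
have D X X' : newton_form f E M (X + X') Y = newton_form f E M X Y + newton_form f E M X' Y.
  by have := newton_form_linearl f_C3 E_bf 1 M X X' Y; rewrite scale1r mul1r.
have Z0 : newton_form f E M 0 Y = 0 by apply: (addrI (newton_form f E M 0 Y)); rewrite -D !addr0.
rewrite (big_morph (fun X => newton_form f E M X Y) D Z0); apply: eq_bigr => i _.
by have := newton_form_linearl f_C3 E_bf (w 0 i) M (eta i) 0 Y; rewrite addr0 Z0 addr0.
Qed.

Lemma newton_form_sumr M d (w : 'cV[R]_d) (eta : 'I_d -> 'M[R]_(p + 1)) X :
  newton_form f E M X (\sum_j w j 0 *: eta j) = \sum_j w j 0 * newton_form f E M X (eta j).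
Proof.
have D Y Y' : newton_form f E M X (Y + Y') = newton_form f E M X Y + newton_form f E M X Y'.
  by have := newton_form_linearr f_C3 E_bf 1 M Y Y' X; rewrite scale1r mul1r.
have Z0 : newton_form f E M X 0 = 0 by apply: (addrI (newton_form f E M X 0)); rewrite -D !addr0.
rewrite (big_morph (newton_form f E M X) D Z0); apply: eq_bigr => i _.
by have := newton_form_linearr f_C3 E_bf (w i 0) M (eta i) 0 X; rewrite addr0 Z0 addr0.
Qed.

(** In a frame, the Newton equation is a square linear system whose matrix is
    close to that at L, so it is uniquely solvable with uniform bounds. *)
Lemma newton_solvable_near L d (eta : 'I_d -> 'M[R]_(p + 1)) : nondegenerate_frame L eta ->
  exists C r : R, [/\ 0 <= C, 0 < r & forall M, `|M - L| <= r ->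
    (exists2 X, lie G X & newton_equation G f E M X) /\
    forall X e, lie G X -> 0 <= e -> (forall Y, lie G Y -> `|newton_form f E M X Y| <= e * `|Y|) ->
      `|X| <= C * e].
Proof.
move=> [eta_lie eta_span Hu].
pose H M : 'M[R]_d := \matrix_(i, j) newton_form f E M (eta i) (eta j).
have [C1 [r1 [C10 r10 H1]]] := unitmx_near Hu.
have [C2 C20 H2] := newton_form_lipschitz f_C3 E_bf L.
pose S := \sum_j `|eta j|; have S0 : 0 <= S by apply: sumr_ge0.
have etaS j : `|eta j| <= S by rewrite /S (bigD1 j)//= lerDl sumr_ge0.
pose k := C2 * S * S; have k0 : 0 <= k by rewrite !mulr_ge0.
have [r [r0 r_1 _ rk]] := @exists_small R k r1 k0 r10.
have near M : `|M - L| <= r -> `|H M - H L| <= r1.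
  move=> Mr; apply: mx_norm_leP => [|i j]; first exact: ltW.
  rewrite !mxE (le_trans (H2 M _ _ (le_trans Mr (ltW r_1))))//.
  rewrite (le_trans _ (ltW rk))// (_ : r * k = C2 * r * S * S); last by rewrite /k; ring.
  by rewrite ler_pM// ?mulr_ge0// ler_pM// ?mulr_ge0// ler_wpM2l.
exists (d%:R * (C1 * S) * S), r; split=> //; first by rewrite !mulr_ge0.
move=> M Mr; have [HMu bM] := H1 _ (near M Mr).
have comb_lie (w : 'rV[R]_d) : lie G (\sum_i w 0 i *: eta i).
  by elim/big_ind: _ => [|X Y|i _]; [exact: lie0|exact: lieD|exact: lieZ].
split.
  pose b : 'rV[R]_d := \row_j dcost f E M (eta j *m M).
  pose w := - (b *m invmx (H M)).
  have wH : w *m H M = - b by rewrite mulNmx mulmxKV.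
  exists (\sum_i w 0 i *: eta i) => // Y /eta_span[y ->].
  rewrite newton_form_sumr mulmx_suml (big_morph _ (dcostD f_C3 E_bf M) (dcost0 f_C3 E_bf M)).
  rewrite -big_split big1// => j _ /=.
  rewrite -scalemxAl (dcostZ f_C3 E_bf) -mulrDr newton_form_suml.
  have /matrixP/(_ 0 j) := wH.
  rewrite [LHS]mxE [RHS]mxE [b 0 j]mxE => wHj.
  rewrite (_ : \sum_i _ = - dcost f E M (eta j *m M)) ?addNr ?mulr0//.
  by rewrite -wHj; apply: eq_bigr => i _; rewrite [H M i j]mxE.
move=> X e /eta_span[x ->] e0 small.
have xE : \sum_j x j 0 *: eta j = \sum_j x^T 0 j *: eta j by apply: eq_bigr => j _; rewrite mxE.
rewrite xE in small *.
have xH : `|x^T *m H M| <= S * e.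
  apply: mx_norm_leP => [|i j]; first by rewrite mulr_ge0.
  rewrite ord1 mxE.
  rewrite (_ : \sum_k _ = newton_form f E M (\sum_i x^T 0 i *: eta i) (eta j)).
    by rewrite (le_trans (small _ (eta_lie j)))// mulrC ler_wpM2r.
  by rewrite newton_form_suml; apply: eq_bigr => l _; rewrite [H M l j]mxE.
have xb : `|x^T| <= C1 * (S * e) by rewrite (le_trans (bM _ _))// ler_wpM2l.
rewrite (le_trans (ler_norm_sum _ _ _))// (@le_trans _ _ (\sum_(j < d) C1 * (S * e) * S))//.
  by apply: ler_sum => j _; rewrite normrZ ler_pM// (le_trans (mx_entry_le _ _ _)).
by rewrite sumr_const card_ord -mulr_natl le_eqVlt; apply/orP; left; apply/eqP; ring.
Qed.

(** Let M = (1 + xi + O(e^2)) L with e = |M - L|, and let X solve the Newton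
    equation at M. The gradient at M is the Newton form at xi up to O(e^2),
    hence the form annihilates X + xi up to O(e^2), and X = - xi + O(e^2).
    The updated point is (1 + X + O(e^2)) (1 + xi + O(e^2)) L = L + O(e^2). *)
Lemma newton_step L : nondegenerate_critical_point G (cost f E) L ->
  exists C r : R, [/\ 0 <= C, 0 < r & forall M, carrier G M -> `|M - L| <= r ->
    (exists O v, newton_system G f E M O v) /\
    forall O v, newton_system G f E M O v ->
      carrier G (nu_QR G M O v) /\ `|nu_QR G M O v - L| <= C * `|M - L| ^+ 2].
Proof.
move=> /nondegenerate_critical_pointP[LG crit [d [eta etaF]]].
have [Lu LiG] := carrier_inv LG.
have [C1 [r1 [C10 r10 H1]]] := newton_solvable_near etaF.
have [C2 [r2 [C20 r20 _ H2]]] := gradient_expansion f_C3 E_bf LG crit.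
have [C3 C30 H3] := newton_form_lipschitz f_C3 E_bf L.
have [C4 [r4 [C40 r40 _ H4]]] := @local_motion_near1 R n G.
have N0 : 0 <= N by rewrite ler0n.
(* The constants of X + xi = O(e^2), of X = O(e), and of the product with the
   current point, in this order. *)
pose c1 := C1 * (C2 + C3 * C2); have c10 : 0 <= c1 by rewrite mulr_ge0// addr_ge0// mulr_ge0.
pose k := C2 + c1; have k0 : 0 <= k by rewrite addr_ge0.
pose c2 := N * (C4 * k ^+ 2) * (1 + k + C2) + N * (1 + k) * C2 + N * k * k + c1.
have c20 : 0 <= c2.
  rewrite /c2; have kk : 0 <= k ^+ 2 by rewrite exprn_ge0.
  have h1 : 0 <= N * (C4 * k ^+ 2) * (1 + k + C2) by apply: mulr_ge0; [rewrite mulr_ge0// mulr_ge0|rewrite !addr_ge0].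
  have h2 : 0 <= N * (1 + k) * C2 by rewrite !mulr_ge0// addr_ge0.
  have h3 : 0 <= N * k * k by rewrite !mulr_ge0.
  by rewrite !addr_ge0.
pose m := Num.min (Num.min r1 r2) (Num.min 1 r4).
have m0 : 0 < m by rewrite !lt_min r10 r20 ltr01.
have [r [r0 r_1 rm rk]] := @exists_small R k m k0 m0.
have mr1 : m <= r1 by rewrite !ge_min lexx.
have mr2 : m <= r2 by rewrite !ge_min lexx !orbT.
have mr4 : m <= r4 by rewrite !ge_min lexx !orbT.
exists (N * c2 * `|L|), r; split=> //; first by rewrite !mulr_ge0.
move=> M MG Mr.
have [[X0 X0G X0E] solb] := H1 M (le_trans Mr (ltW (lt_le_trans rm mr1))).
split.
  have [ O [ v [ OG XE]]] := (lieP G X0).1 X0G; exists O, v.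
  by apply/(newton_systemP f_C3 E_bf O v MG); rewrite -XE.
move=> O v /(newton_systemP f_C3 E_bf O v MG)[OG OE].
set X := algmx O v in OE.
have XG : lie G X by exact: lie_algmx.
set e := `|M - L| in Mr *; have e0 : 0 <= e by exact: normr_ge0.
have e1 : e <= 1 by exact: le_trans (ltW r_1).
have e20 : 0 <= e ^+ 2 by rewrite exprn_ge0.
have ee : e ^+ 2 <= e by rewrite expr2 ler_piMr.
have := H2 M MG (le_trans Mr (ltW (lt_le_trans rm mr2))).
set K1 := _ - 1%:M; set xi := lie_proj G K1; rewrite -/e => -[xie qe gexp].
have xiG : lie G xi by exact: lie_projK.
have Xxi : `|X + xi| <= c1 * e ^+ 2.
  rewrite /c1 -mulrA; apply: solb; [exact: lieD|by rewrite mulr_ge0// addr_ge0// mulr_ge0|].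
  move=> Y YG.
  have -> : newton_form f E M (X + xi) Y =
     (newton_form f E M xi Y - newton_form f E L xi Y) - (dcost f E M (Y *m M) - newton_form f E L xi Y).
    have h := newton_form_linearl f_C3 E_bf 1 M X xi Y; rewrite scale1r mul1r in h.
    have hX := OE Y YG; rewrite h.
    move: (newton_form f E M X Y) (newton_form f E M xi Y) (newton_form f E L xi Y) (dcost _ _ _ _) hX => a b c' d' hX.
    have -> : a = - d' by apply/eqP; rewrite -addr_eq0 hX.
    by ring.
  rewrite (le_trans (ler_normB _ _))// mulrDl mulrDl addrC lerD ?gexp//.
  rewrite (le_trans (H3 M xi Y e1))// ler_wpM2r// -!mulrA ler_wpM2l// -/e expr2.
  by rewrite (_ : C2 * (e * e) = e * (C2 * e)) ?ler_wpM2l//; ring.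
have Xk : `|X| <= k * e.
  have -> : X = (X + xi) - xi by rewrite addrK.
  rewrite (le_trans (ler_normB _ _))// /k mulrDl addrC lerD// (le_trans Xxi)//.
  by rewrite ler_wpM2l.
have Xr4 : `|X| <= r4.
  apply: (le_trans Xk); apply: (le_trans _ mr4); apply: (le_trans _ (ltW rk)).
  by rewrite mulrC ler_wpM2r.
have [AG AE] := H4 O v OG Xr4.
set A := local_motion G O v in AG AE; rewrite -/X in AE.
split; first exact: carrierM.
have AX : `|A - 1%:M - X| <= C4 * k ^+ 2 * e ^+ 2.
  rewrite (le_trans AE)// -mulrA -exprMn ler_wpM2l// ler_pXn2r ?nnegrE//.
  exact: mulr_ge0.
pose K := M *m invmx L.
have AK : `|A *m K - 1%:M - (X + xi)| <=
    (N * (C4 * k ^+ 2) * (1 + k + C2) + N * (1 + k) * C2 + N * k * k) * e ^+ 2.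
  apply: mul_near1; [by rewrite e0|exact: Xk| |exact: AX|exact: qe].
  by rewrite (le_trans xie)// ler_wpM2r// /k lerDl.
have AK1 : `|A *m K - 1%:M| <= c2 * e ^+ 2.
  rewrite -[A *m K - 1%:M](subrK (X + xi)) (le_trans (ler_normD _ _))//.
  by rewrite /c2 mulrDl lerD//; exact: AK.
have -> : nu_QR G M O v - L = (A *m K - 1%:M) *m L.
  by rewrite /nu_QR -/A mulmxBl mul1mx /K mulmxA mulmxKV.
rewrite (le_trans (mx_normM _ _))// (_ : N * c2 * `|L| * e ^+ 2 = N * (c2 * e ^+ 2) * `|L|); last by ring.
by rewrite ler_wpM2r// ler_wpM2l.
Qed.

(** Within a small ball the quadratic estimate is also a contraction by one
    half, so that the iterates stay in the ball, the systems stay solvable,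
    and the iterates converge. *)
Lemma newton_convergence L : nondegenerate_critical_point G (cost f E) L ->
  locally_quadratically_convergent G f E L.
Proof.
move=> nd; have [LG _ _] := nondegenerate_critical_pointP nd.
have [C [r1 [C0 r10 step]]] := newton_step nd.
(* Below 1 / (2 C), the quadratic bound is at most half the distance. *)
pose r := Num.min r1 (2 * (C + 1))^-1.
have C1 : 0 < C + 1 by rewrite ltr_wpDl.
have r0 : 0 < r by rewrite lt_min r10 invr_gt0 mulr_gt0.
have rr1 : r <= r1 by rewrite ge_min lexx.
have rC : C * r <= 2^-1.
  apply: (@le_trans _ _ ((C + 1) * (2 * (C + 1))^-1)).
    by rewrite ler_pM ?(ltW r0)// ?lerDl// ge_min lexx orbT.
  by rewrite invfM mulrCA divff ?mulr1// gt_eqF.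
pose V : set 'M[R]_(p + 1) := carrier G `&` [set M | `|M - L| < r].
have contr M O v : V M -> newton_system G f E M O v ->
    [/\ V (nu_QR G M O v), `|nu_QR G M O v - L| <= C * `|M - L| ^+ 2 &
        `|nu_QR G M O v - L| <= 2^-1 * `|M - L|].
  move=> [MG /= Mr] sys; have [_ h] := step M MG (ltW (lt_le_trans Mr rr1)).
  have [MG' q] := h O v sys.
  have half : `|nu_QR G M O v - L| <= 2^-1 * `|M - L|.
    rewrite (le_trans q)// expr2 mulrA ler_wpM2r// (le_trans _ rC)// ler_wpM2l//.
    exact: ltW.
  split=> //; split=> //=; apply: (le_lt_trans half).
  by apply: le_lt_trans Mr; rewrite ler_piMl// invf_le1// ler1n.
exists V; split.
- exists [set M | `|M - L| < r] => //.
  rewrite (_ : [set M | _] = ball L r); first exact: ball_open.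
  by apply/seteqP; split=> M; rewrite -ball_normE /ball_/= distrC.
- by split=> //=; rewrite subrr normr0.
move=> M0 M0V; split.
  pose next M : 'M[R]_(p + 1) :=
    xget M [set M' | exists O v, newton_system G f E M O v /\ M' = nu_QR G M O v].
  have nextP M : V M -> exists O v, newton_system G f E M O v /\ next M = nu_QR G M O v.
    move=> [MG /= Mr]; have [ [ O [v sys] ] _] := step M MG (ltW (lt_le_trans Mr rr1)).
    apply: (@xgetPex _ M [set M' | exists O v, newton_system G f E M O v /\ M' = nu_QR G M O v]).
    by exists (nu_QR G M O v), O, v.
  pose Ms m := iter m next M0.
  have MsV m : V (Ms m).
    elim: m => //= m IH; have [ O [ v [sys ->]]] := nextP _ IH.
    by have [] := contr _ _ _ IH sys.
  by exists Ms; split=> // m; exact: nextP.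
move=> Ms [Ms0 MsS].
have MsV m : V (Ms m).
  elim: m => [|m IH]; first by rewrite Ms0.
  have [ O [ v [sys ->]]] := MsS m.
  by have [] := contr _ _ _ IH sys.
split; last first.
  exists C => m; have [ O [ v [sys ->]]] := MsS m.
  by have [] := contr _ _ _ (MsV m) sys.
have geo m : `|Ms m - L| <= 2^-1 ^+ m * `|M0 - L|.
  elim: m => [|m IH]; first by rewrite Ms0 expr0 mul1r.
  have [ O [ v [sys ->]]] := MsS m; have [_ _ h] := contr _ _ _ (MsV m) sys.
  by rewrite (le_trans h)// exprS -mulrA ler_wpM2l.
apply/cvgrPdist_le => eps eps0.
have hcv : (fun m => 2^-1 ^+ m * `|M0 - L|) @ \oo --> (0 : R).
  rewrite -(mul0r `|M0 - L|); apply: cvgMl.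
  by apply: cvg_expr; rewrite ger0_norm ?invr_ge0// invf_lt1// ltr1n.
have /cvgrPdist_le/(_ eps eps0) := hcv.
apply: filterS => m; rewrite sub0r normrN => h; rewrite distrC.
by rewrite (le_trans (geo m))// (le_trans (ler_norm _)).
Qed.

End NewtonStep.

Theorem theorem3p4 (R : realType) (n : nat) (G : motion_group)
    (f g : 'cV[R]_n.+1 -> R) (N : nat) (xs : 'I_N -> 'cV[R]_n.+1)
    (g_cont : continuous g) (g_supp : compactly_supported g)
    (f_C3 : is_Ck 3 setT f) (N_gt0 : (0 < N)%N) :
  (forall L : 'M[R]_(n.+1 + 1),
     nondegenerate_critical_point G (cost_int f g) L ->
     locally_quadratically_convergent G f (expect_int g) L) /\
  (forall L : 'M[R]_(n.+1 + 1),
     nondegenerate_critical_point G (cost_sample f g xs) L ->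
     locally_quadratically_convergent G f (expect_sample g xs) L).
Proof.
have int_cost : cost f (expect_int g) = cost_int f g.
  apply/funext => M; apply: (f_equal (@integral_Rn R n.+1)); apply/funext => x.
  exact: mulrC.
have sample_cost : cost f (expect_sample g xs) = cost_sample f g xs.
  apply/funext => M; apply: (f_equal (fun y => N%:R^-1 * y)).
  by apply: eq_bigr => r _; exact: mulrC.
split=> L.
  by rewrite -int_cost => nd; exact: (newton_convergence f_C3 (expect_int_bounded g_cont g_supp) nd).
by rewrite -sample_cost => nd; exact: (newton_convergence f_C3 (expect_sample_bounded g xs) nd).
Qed.
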